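(* Let $\mathcal{G}$ be the generic abelian groupoid in $p=\mathrm{tp}(b_0)$ obtained from a symmetric witness $W=(b_0,b_1,b_2,f'_{01},f'_{12},f'_{02},\theta)$, and let $\mathcal{F}$ be the non-commutative groupoid constructed from $W$. Let $a,b\models p$ be independent. For $c\models p$ independent from $ab$, and $f\in Y_{ab}$, $g\in Y_{bc}$, $h\in Y_{ac}$, we have $h=g.f$ (with the composition $Y_{bc}\times Y_{ab}\to Y_{ac}$) if and only if $\underline{h}=\underline{g}.\underline{f}$ in $\mathcal{F}$. Moreover, $\mathcal{F}$ extends the composition of $\mathcal{G}$, i.e. for all $c,d,e\models p$ (not necessarily independent), $s\in\mathrm{Mor}_{\mathcal{G}}(c,d)$ and $t\in\mathrm{Mor}_{\mathcal{G}}(d,e)$, we have $\underline{t}.\underline{s}=\underline{t.s}$.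
   Context: Conventions: $T$ is a complete stable theory with monster model $\mathcal{M}=\mathcal{M}^{\mathrm{eq}}$; tuples are from $\mathcal{M}$, sets are small; independence is nonforking independence. A fixed algebraically closed base set is named by constants and suppressed, so $\emptyset=\mathrm{acl}(\emptyset)$. $\overline{c}:=\mathrm{acl}(c)$; $c_{01}=c_0c_1$ etc.; $a\equiv_B b$ means $\mathrm{tp}(a/B)=\mathrm{tp}(b/B)$. $\mathrm{Aut}(C/B)$ is the group of elementary maps from $C$ onto $C$ fixing $B$ pointwise (bijections $\sigma$ of $C$ with $\sigma\cup\mathrm{id}_B$ elementary). Symmetric witness: a tuple $(b_0,b_1,b_2,f'_{01},f'_{12},f'_{02},\theta(x,y,z))$ where all $b_i$, $f'_{ij}$ are finite tuples, $\{b_0,b_1,b_2\}$ is independent, $\theta$ is a formula over $\emptyset$, and: (1) $b_{ij}$ is a subtuple of $f'_{ij}\in\overline{b_{ij}}\smallsetminus\mathrm{dcl}(\overline{b_i},\overline{b_j})$; (2) $b_{01}f'_{01}\equiv b_{12}f'_{12}\equiv b_{02}f'_{02}$; (3) $f'_{01}$ is the unique realization of $\theta(x,f'_{12},f'_{02})$, $f'_{12}$ of $\theta(f'_{01},y,f'_{02})$ and $f'_{02}$ of $\theta(f'_{01},f'_{12},z)$; (4) each $\mathrm{tp}(f'_{ij}/\overline{b_i}\,\overline{b_j})$ is isolated by $\mathrm{tp}(f'_{ij}/b_{ij})$. A generic abelian groupoid in $p$ is an $\emptyset$-type-definable connected finitary groupoid $\mathcal{G}$ (connected: all $\mathrm{Mor}(a,b)$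 non-empty; finitary: all $\mathrm{Mor}(a,b)$ finite) such that: $\mathrm{Ob}(\mathcal{G})=p(\mathcal{M})$, $\mathrm{Mor}(\mathcal{G})$ is $\emptyset$-type-definable, and $\mathrm{init},\mathrm{ter}:\mathrm{Mor}(\mathcal{G})\to\mathrm{Ob}(\mathcal{G})$ and composition are $\emptyset$-definable; for $f\in\mathrm{Mor}_{\mathcal{G}}(b_0,b_1)$, $\mathrm{Mor}_{\mathcal{G}}(b_0,b_1)=\{g: g\equiv_{b_{01}}f\}=\{g: g\equiv_{\overline{b_0}\,\overline{b_1}}f\}$; and each vertex group $\mathrm{Mor}_{\mathcal{G}}(a,a)$ is finite abelian. The groupoid obtained from $W$ is a fixed such $\mathcal{G}$ in $p=\mathrm{tp}(b_0)$ for which moreover: there is a $b_{01}$-definable bijection $\pi_{01}:\{f': f'\equiv_{b_{01}}f'_{01}\}=\{f': f'\equiv_{\overline{b_0}\,\overline{b_1}}f'_{01}\}\to\mathrm{Mor}_{\mathcal{G}}(b_0,b_1)$, and with $\pi_{ij}$ the corresponding (conjugate) bijections and $f_{ij}:=\pi_{ij}(f'_{ij})\in\mathrm{Mor}_{\mathcal{G}}(b_i,b_j)$, one has $f_{12}.f_{01}=f_{02}$. Write $X_{cd}=\mathrm{Mor}_{\mathcal{G}}(c,d)$. Composition is written right-to-left. Binding group: for $c,d\models p$ the map $X_{cc}\to X_{dd}$, $\sigma\mapsto f.\sigma.f^{-1}$ ($f\in X_{cd}$) is an isomorphism not depending on $f$; identifying along these isomorphisms gives a finite abelian group $G\subseteq\mathrm{acl}(\emptyset)$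 (the set of classes). $G$ acts regularly on $X_{cd}$ by $\boldsymbol{\sigma}.f:=\sigma_d.f=f.\sigma_c$, where $\sigma_c$ is the element of the class $\boldsymbol\sigma$ in $X_{cc}$. For independent $c,d\models p$ and any $f_{cd}\in X_{cd}$: $Y_{cd}:=\{f\in\mathrm{dcl}(f_{cd},\overline{c}) : f\equiv_{\overline{c}}f_{cd}\text{ and }\mathrm{dcl}(f\overline{c})=\mathrm{dcl}(f_{cd}\overline{c})\}\supseteq X_{cd}$ (independent of the choice of $f_{cd}$); $F_{cd}:=\mathrm{Aut}(Y_{cd}/\overline{c})$, which acts regularly on $Y_{cd}$; $G_{cd}:=\mathrm{Aut}(X_{cd}/\overline{c}\,\overline{d})$, identified with a subgroup of $F_{cd}$ since each of its elements extends uniquely to $F_{cd}$; $\rho_{cd}:G\to G_{cd}$ is the isomorphism with $\rho_{cd}(\boldsymbol{\sigma})(f)=\boldsymbol{\sigma}.f$ for $f\in X_{cd}$. Extended binding group: fix independent $a_0,b_0'\models p$ and an enumeration $Y_{a_0b_0'}=\{g_i\}_i\cup\{g'_j\}_j$ with $X_{a_0b_0'}=\{g_i\}_i$. For $cd\equiv a_0b_0'$ choose an enumeration $Y_{cd}=\{h_i\}_i\cup\{h'_j\}_j$ with $X_{cd}=\{h_i\}_i$ and $\langle g_i\rangle^\frown\langle g_j'\rangle a_0b_0'\equiv\langle h_i\rangle^\frown\langle h'_j\rangle cd$. Sending the unique element of $F_{a_0b_0'}$ taking $g_0$ to $g_i$ (resp. $g'_j$) to the unique element of $F_{cd}$ taking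 $h_0$ to $h_i$ (resp. $h'_j$) gives a well-defined isomorphism $F_{a_0b_0'}\to F_{cd}$ extending $\rho_{cd}\circ\rho_{a_0b_0'}^{-1}$. Fix a group $F\ge G$ with isomorphisms $\rho^F_{cd}:F\to F_{cd}$ extending $\rho_{cd}$, for all independent $c,d\models p$, such that $\rho^F_{cd}\circ(\rho^F_{a_0b_0'})^{-1}$ is this isomorphism. $F$ acts regularly on $Y_{cd}$ by $\boldsymbol{\mu}.f:=\rho^F_{cd}(\boldsymbol{\mu})(f)$. Partial composition: if $\{a,b,c\}$ is an independent set of realizations of $p$, $g=\boldsymbol{\tau_0}.g_0\in Y_{ab}$, $h=\boldsymbol{\sigma_0}.h_0\in Y_{bc}$ with $\boldsymbol{\tau_0},\boldsymbol{\sigma_0}\in F$, $g_0\in X_{ab}$, $h_0\in X_{bc}$, put $h.g:=(\boldsymbol{\sigma_0}\boldsymbol{\tau_0}).(h_0.g_0)\in Y_{ac}$; this is well defined. The non-commutative groupoid $\mathcal{F}$: $\mathrm{Ob}(\mathcal{F})=p(\mathcal{M})$. For $c,d\models p$ an $n$-step directed path from $c$ to $d$ is a sequence $(c_0,g_1,c_1,g_2,\dots,c_n)$ with $c=c_0$, $d=c_n$, $c_{i-1},c_i$ independent realizations of $p$ and $g_i\in Y_{c_{i-1}c_i}$; $D^n(c,d)$ is the set of these. Paths $q=(c_0,g_1,\dots,c_n)\in D^n(c,d)$ and $r=(d_0,h_1,\dots,d_m)\in D^m(c,d)$ are equivalent, $q\sim r$, if for some (equivalently any) $c^*\models p$ independent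 from $qr$ and $g^*\in Y_{c^*c}$ one has $g^*_n=h^*_m\in Y_{c^*d}$, where $g^*_0=h^*_0=g^*$, $g^*_{i+1}=g_{i+1}.g^*_i$, $h^*_{j+1}=h_{j+1}.h^*_j$. Every path is equivalent to a $2$-step path. $\mathrm{Mor}_{\mathcal{F}}(c,d):=D^2(c,d)/\!\sim$, with composition induced by concatenation of paths. For independent $c,d$ there is a canonical bijection $Y_{cd}\to\mathrm{Mor}_{\mathcal{F}}(c,d)$, $f\mapsto\underline{f}$, where $\underline{f}$ is the class of the $2$-step paths equivalent to the $1$-step path $(c,f,d)$. For arbitrary $c,d\models p$ there is a canonical injection $X_{cd}\to\mathrm{Mor}_{\mathcal{F}}(c,d)$, also written $f\mapsto\underline{f}$, where $\underline{f}$ is the class of any path $(c,u,e,v,d)$ with $e\models p$ independent from $cd$, $u\in X_{ce}$, $v\in X_{ed}$ and $v.u=f$ in $\mathcal{G}$; the two agree on $X_{cd}$ when $c,d$ are independent. *)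

(* Defs.v *)
From Stdlib Require List.
From mathcomp Require Import all_boot.
From mathcomp Require Import mathcomp_extra boolp classical_sets functions.
From mathcomp Require Import cardinality.

Set Implicit Arguments.
Unset Strict Implicit.
Unset Printing Implicit Defensive.

Local Open Scope classical_set_scope.
Local Open Scope card_scope.

(** * Many-sorted first-order logic *)

(* Languages are relational: function symbols and constants are given by their
   graphs, which does not change the definable sets. *)
Record language := Language {
  lsort : Type;
  relsym : Type;
  arity : relsym -> nat;
  rel_sorts : forall r : relsym, (arity r).-tuple lsort }.

(* [carrier] is the disjoint union of the sorts; an atomic formula whose
   arguments have the wrong sorts is false. *)
Record structure (L : language) := Structure {
  carrier :> Type;
  sort_of : carrier -> lsort L;
  interp : forall r : relsym L, (arity r).-tuple carrier -> Prop;
  interp_sorted : forall r (v : (arity r).-tuple carrier),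
    interp v -> map_tuple sort_of v = rel_sorts r }.

(* [formula L n]: formulas with free variables x_0, ..., x_(n-1).
   [FEx s phi] quantifies over the sort [s] and binds x_0 of [phi]. *)
Inductive formula (L : language) : nat -> Type :=
| FEq n (i j : 'I_n) : formula L n
| FRel n (r : relsym L) (args : (arity r).-tuple 'I_n) : formula L n
| FNot n (phi : formula L n) : formula L n
| FAnd n (phi psi : formula L n) : formula L n
| FEx n (s : lsort L) (phi : formula L n.+1) : formula L n.

Fixpoint sat (L : language) (M : structure L) n (phi : formula L n) :
    n.-tuple M -> Prop :=
  match phi in formula _ n return n.-tuple M -> Prop with
  | FEq _ i j => fun v => tnth v i = tnth v j
  | FRel _ r args => fun v => interp (map_tuple (tnth v) args)
  | FNot _ phi => fun v => ~ sat phi v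
  | FAnd _ phi psi => fun v => sat phi v /\ sat psi v
  | FEx _ s phi => fun v =>
      exists u : M, sort_of u = s /\ sat phi [tuple of u :: v]
  end.

Section ModelTheory.
Variables (L : language) (M : structure L).
Implicit Types (A B : set M) (R : set (M * M)) (n m k : nat).

Definition sorts n (a : n.-tuple M) : n.-tuple (lsort L) :=
  map_tuple (@sort_of L M) a.

Definition coords n (a : n.-tuple M) : set M := range (tnth a).

(** Elementary maps, given by their graphs; taking [phi] to be an equality
    shows that an elementary relation is the graph of an injective partial
    function. *)
Definition elementary R : Prop :=
  forall n (phi : formula L n) (v w : n.-tuple M),
    (forall i, R (tnth v i, tnth w i)) -> (sat phi v <-> sat phi w).

Definition tgraph n (a b : n.-tuple M) : set (M * M) :=
  range (fun i => (tnth a i, tnth b i)).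

Definition id_on B : set (M * M) := [set (x, x) | x in B].

(* a ≡_B b *)
Definition eqtp B n (a b : n.-tuple M) : Prop :=
  elementary (tgraph a b `|` id_on B).

(** Formulas with parameters in n variables. *)
Record pformula n := PFormula {
  pdim : nat;
  pform : formula L (n + pdim);
  params : pdim.-tuple M }.

Definition psat n (theta : pformula n) (x : n.-tuple M) : Prop :=
  sat (pform theta) [tuple of x ++ params theta].

Definition params_in B n (theta : pformula n) : Prop :=
  coords (params theta) `<=` B.

Definition dcl B : set M := [set x | exists theta : pformula 1,
  [/\ params_in B theta, psat theta [tuple x] &
      forall y, psat theta [tuple y] -> y = x]].

Definition acl B : set M := [set x | exists theta : pformula 1,
  [/\ params_in B theta, psat theta [tuple x] &
      finite_set [set y | psat theta [tuple y]]]].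

(* \overline{c} *)
Definition aclt n (c : n.-tuple M) : set M := acl (coords c).

(** ** Nonforking independence *)

(* Dividing: for some k, some sequence of realizations of the type over A of
   the parameters yields a k-inconsistent family of instances. *)
Definition divides A n (theta : pformula n) : Prop :=
  exists b : nat -> (pdim theta).-tuple M,
    (forall i, eqtp A (b i) (params theta)) /\
    exists k, forall I : 'I_k -> nat, injective I ->
      ~ exists x : n.-tuple M,
          forall j, psat (PFormula (pform theta) (b (I j))) x.

Definition forks A n (theta : pformula n) : Prop :=
  exists s : seq (pformula n),
    (forall psi, List.In psi s -> divides A psi) /\
    (forall x, psat theta x -> exists psi, List.In psi s /\ psat psi x).

(* a is independent from B over A: tp(a/AB) does not fork over A *)
Definition indep_over A n (a : n.-tuple M) B : Prop :=
  forall theta : pformula n,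
    params_in (A `|` B) theta -> psat theta a -> ~ forks A theta.

Definition indep n (a : n.-tuple M) B : Prop := indep_over set0 a B.

Definition indep2 n m (a : n.-tuple M) (b : m.-tuple M) : Prop :=
  indep a (coords b).

Definition indep3 n m k
    (a : n.-tuple M) (b : m.-tuple M) (c : k.-tuple M) : Prop :=
  [/\ indep a (coords b `|` coords c), indep b (coords a `|` coords c) &
      indep c (coords a `|` coords b)].

(** ** Standing assumptions on M *)

(* Small sets are those of cardinality at most |K|. *)
Definition small (K : Type) A : Prop := A #<= [set: K].

Definition saturated (K : Type) : Prop :=
  forall A (s : lsort L) (Pi : set (pformula 1)),
    small K A -> (forall theta, Pi theta -> params_in A theta) ->
    (forall l : seq (pformula 1), (forall theta, List.In theta l -> Pi theta) ->
       exists x, sort_of x = s /\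
         forall theta, List.In theta l -> psat theta [tuple x]) ->
    exists x, sort_of x = s /\ forall theta, Pi theta -> psat theta [tuple x].

Definition automorphism (alpha : M -> M) : Prop :=
  bijective alpha /\ elementary (range (fun x => (x, alpha x))).

Definition strongly_homogeneous (K : Type) : Prop :=
  forall R, elementary R -> small K [set z.1 | z in R] ->
    exists alpha, automorphism alpha /\ forall z, R z -> z.2 = alpha z.1.

(* |K|^+-saturated and strongly |K|^+-homogeneous with |K| >= |L| + aleph_0 *)
Definition monster (K : Type) : Prop :=
  [/\ [set: {n & formula L n}] #<= [set: K], saturated K &
      strongly_homogeneous K].

(* M = M^eq: every quotient of a product of sorts by a 0-definable equivalence
   relation is (0-definably identified with) a sort. *)
Definition eq_closed : Prop :=
  forall n (s : n.-tuple (lsort L)) (E : formula L (n + n)),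
    let dom := [set x : n.-tuple M | sorts x = s] in
    let rE (x y : n.-tuple M) := sat E [tuple of x ++ y] in
    (forall x, dom x -> rE x x) ->
    (forall x y, dom x -> dom y -> rE x y -> rE y x) ->
    (forall x y z, dom x -> dom y -> dom z -> rE x y -> rE y z -> rE x z) ->
    exists (t : lsort L) (pr : n.-tuple M -> M) (psi : formula L (n + 1)),
      [/\ forall x, dom x -> sort_of (pr x) = t,
          forall u : M, sort_of u = t -> exists2 x, dom x & pr x = u,
          forall x y, dom x -> dom y -> (pr x = pr y <-> rE x y) &
          forall x u, dom x -> sort_of u = t ->
            (pr x = u <-> sat psi [tuple of x ++ [tuple u]])].

(* No formula has the order property. *)
Definition stable : Prop :=
  forall n k (phi : formula L (n + k))
    (s : n.-tuple (lsort L)) (t : k.-tuple (lsort L)),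
    ~ exists (a : nat -> n.-tuple M) (b : nat -> k.-tuple M),
        [/\ forall i, sorts (a i) = s, forall j, sorts (b j) = t &
            forall i j, sat phi [tuple of a i ++ b j] <-> (i < j)%N].

Definition type_definable n (S : set (n.-tuple M)) : Prop :=
  exists (s : n.-tuple (lsort L)) (Phi : set (formula L n)),
    S = [set x | sorts x = s /\ forall phi, Phi phi -> sat phi x].

(* Aut(C/B) for a set C of tuples *)
Definition Aut_over m (C : set (m.-tuple M)) B
    (sigma : m.-tuple M -> m.-tuple M) : Prop :=
  set_bij C C sigma /\
  elementary (\bigcup_(x in C) tgraph x (sigma x) `|` id_on B).

Definition subtuple n m (a : n.-tuple M) (b : m.-tuple M) : Prop :=
  exists mk : m.-tuple bool, val a = mask mk b.

(** ** Symmetric witnesses *)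

Definition witness_edge n k (bi bj : n.-tuple M) (f' : k.-tuple M) : Prop :=
  let bij := [tuple of bi ++ bj] in
  [/\ subtuple bij f',
      coords f' `<=` aclt bij,
      ~ (coords f' `<=` dcl (aclt bi `|` aclt bj)) &
      (* tp(f'/b_ij) isolates the type over both algebraic closures *)
      forall g, eqtp (coords bij) g f' -> eqtp (aclt bi `|` aclt bj) g f'].

Record symmetric_witness n k := SymmetricWitness {
  sw_b0 : n.-tuple M; sw_b1 : n.-tuple M; sw_b2 : n.-tuple M;
  sw_f01 : k.-tuple M; sw_f12 : k.-tuple M; sw_f02 : k.-tuple M;
  sw_theta : formula L (k + (k + k));
  sw_indep : indep3 sw_b0 sw_b1 sw_b2;
  sw_edge01 : witness_edge sw_b0 sw_b1 sw_f01;
  sw_edge12 : witness_edge sw_b1 sw_b2 sw_f12;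
  sw_edge02 : witness_edge sw_b0 sw_b2 sw_f02;
  sw_conj12 : eqtp set0 [tuple of sw_b0 ++ sw_b1 ++ sw_f01]
                        [tuple of sw_b1 ++ sw_b2 ++ sw_f12];
  sw_conj02 : eqtp set0 [tuple of sw_b1 ++ sw_b2 ++ sw_f12]
                        [tuple of sw_b0 ++ sw_b2 ++ sw_f02];
  sw_unique01 : forall x : k.-tuple M,
    sat sw_theta [tuple of x ++ sw_f12 ++ sw_f02] <-> x = sw_f01;
  sw_unique12 : forall y : k.-tuple M,
    sat sw_theta [tuple of sw_f01 ++ y ++ sw_f02] <-> y = sw_f12;
  sw_unique02 : forall z : k.-tuple M,
    sat sw_theta [tuple of sw_f01 ++ sw_f12 ++ z] <-> z = sw_f02 }.

(** ** Generic abelian groupoids *)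

(* Everything is a set of tuples of M; [ginit], [gter], [gid], [ginv] and
   [gcomp] are only meaningful on objects, morphisms, resp. composable pairs;
   [gcomp g f] is g.f, with f first. *)
Record groupoid_data n m := GroupoidData {
  Ob : set (n.-tuple M);
  Mor : set (m.-tuple M);
  ginit : m.-tuple M -> n.-tuple M;
  gter : m.-tuple M -> n.-tuple M;
  gid : n.-tuple M -> m.-tuple M;
  ginv : m.-tuple M -> m.-tuple M;
  gcomp : m.-tuple M -> m.-tuple M -> m.-tuple M }.

(* X_{cd} *)
Definition Hom n m (G : groupoid_data n m) (c d : n.-tuple M) :
    set (m.-tuple M) :=
  [set f | [/\ Mor G f, ginit G f = c & gter G f = d]].

Record is_groupoid n m (G : groupoid_data n m) : Prop := IsGroupoid {
  init_ob : forall f, Mor G f -> Ob G (ginit G f);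
  ter_ob : forall f, Mor G f -> Ob G (gter G f);
  gcomp_hom : forall a b c f g,
    Hom G a b f -> Hom G b c g -> Hom G a c (gcomp G g f);
  gcompA : forall a b c d f g h,
    Hom G a b f -> Hom G b c g -> Hom G c d h ->
    gcomp G h (gcomp G g f) = gcomp G (gcomp G h g) f;
  gid_hom : forall a, Ob G a -> Hom G a a (gid G a);
  gcomp_idr : forall a b f, Hom G a b f -> gcomp G f (gid G a) = f;
  gcomp_idl : forall a b f, Hom G a b f -> gcomp G (gid G b) f = f;
  ginv_hom : forall a b f, Hom G a b f -> Hom G b a (ginv G f);
  gcomp_invl : forall a b f, Hom G a b f -> gcomp G (ginv G f) f = gid G a;
  gcomp_invr : forall a b f, Hom G a b f -> gcomp G f (ginv G f) = gid G b }.

(* [b0], [b1] are the independent realizations of p coming from the witness. *)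
Record generic_abelian n m (b0 b1 : n.-tuple M) (G : groupoid_data n m) :
    Prop := GenericAbelian {
  ga_groupoid : is_groupoid G;
  ga_ob : Ob G = [set a | eqtp set0 a b0];
  ga_mor : type_definable (Mor G);
  ga_init : exists phi : formula L (m + n),
    forall (f : m.-tuple M) (a : n.-tuple M), Mor G f -> Ob G a ->
    (ginit G f = a <-> sat phi [tuple of f ++ a]);
  ga_ter : exists phi : formula L (m + n),
    forall (f : m.-tuple M) (a : n.-tuple M), Mor G f -> Ob G a ->
    (gter G f = a <-> sat phi [tuple of f ++ a]);
  ga_comp : exists phi : formula L (m + (m + m)), forall f g h,
    Mor G f -> Mor G g -> Mor G h -> gter G f = ginit G g ->
    (gcomp G g f = h <-> sat phi [tuple of g ++ f ++ h]);
  ga_connected : forall a b, Ob G a -> Ob G b -> Hom G a b !=set0;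
  ga_finitary : forall a b, Ob G a -> Ob G b -> finite_set (Hom G a b);
  ga_types : forall f, Hom G b0 b1 f ->
    Hom G b0 b1 = [set g | eqtp (coords b0 `|` coords b1) g f] /\
    Hom G b0 b1 = [set g | eqtp (aclt b0 `|` aclt b1) g f];
  ga_abelian : forall a f g, Ob G a -> Hom G a a f -> Hom G a a g ->
    gcomp G g f = gcomp G f g }.

(* [psi(-,-,bi,bj)] is the graph of the bijection [pi] between the set of
   realizations of tp(f'/b_ij) and Mor(bi,bj). *)
Definition definable_bij n m k (G : groupoid_data n m)
    (psi : formula L (k + (m + (n + n)))) (bi bj : n.-tuple M)
    (f' : k.-tuple M) (pi : k.-tuple M -> m.-tuple M) : Prop :=
  let D := [set g' | eqtp (coords bi `|` coords bj) g' f'] in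
  set_bij D (Hom G bi bj) pi /\
  forall g' g, D g' -> Hom G bi bj g ->
    (pi g' = g <-> sat psi [tuple of g' ++ g ++ bi ++ bj]).

(* The same [psi] serves for the three pairs: the [pi_ij] are conjugate. *)
Definition obtained_from n m k (W : symmetric_witness n k)
    (G : groupoid_data n m) : Prop :=
  generic_abelian (sw_b0 W) (sw_b1 W) G /\
  exists (psi : formula L (k + (m + (n + n))))
         (pi01 pi12 pi02 : k.-tuple M -> m.-tuple M),
    [/\ definable_bij G psi (sw_b0 W) (sw_b1 W) (sw_f01 W) pi01,
        definable_bij G psi (sw_b1 W) (sw_b2 W) (sw_f12 W) pi12,
        definable_bij G psi (sw_b0 W) (sw_b2 W) (sw_f02 W) pi02 &
        gcomp G (pi12 (sw_f12 W)) (pi01 (sw_f01 W)) = pi02 (sw_f02 W)].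

Section NonCommutativeGroupoid.
Variables (n m : nat) (G : groupoid_data n m).
Implicit Types (a b c d e : n.-tuple M) (f g h u v : m.-tuple M).

(** ** The binding group *)

(* A class is represented by the set of its members, one in each vertex
   group. *)
Definition conj_class (s : m.-tuple M) : set (m.-tuple M) :=
  [set gcomp G f (gcomp G s (ginv G f)) | f in
    [set f | Mor G f /\ ginit G f = ginit G s]].

Definition binding : set (set (m.-tuple M)) :=
  [set conj_class s | s in [set s | exists2 c, Ob G c & Hom G c c s]].

Definition binding_mul (S T : set (m.-tuple M)) : set (m.-tuple M) :=
  [set r | exists s t, [/\ S s, T t, ginit G s = ginit G t & r = gcomp G s t]].

(** ** The extended binding group *)

Definition Y c d : set (m.-tuple M) :=
  [set f | exists f0, [/\ Hom G c d f0,
     coords f `<=` dcl (coords f0 `|` aclt c),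
     eqtp (aclt c) f f0 &
     dcl (coords f `|` aclt c) = dcl (coords f0 `|` aclt c)]].

(* [eb_emb] is the inclusion of the binding group into F, and [eb_rho c d] is
   rho^F_{cd}, an element of F_{cd} being given by its values on Y_{cd}.
   [eb_compat] is required for every admissible enumeration of Y_{cd}: the
   isomorphism from F_{a_0b_0'} to F_{cd} is well defined. *)
Record extended_binding := ExtendedBinding {
  eb_group : groupType;
  eb_emb : set (m.-tuple M) -> eb_group;
  eb_emb_inj : forall S T, binding S -> binding T ->
    eb_emb S = eb_emb T -> S = T;
  eb_emb_mul : forall S T, binding S -> binding T ->
    eb_emb (binding_mul S T) = (eb_emb S * eb_emb T)%g;
  eb_rho : n.-tuple M -> n.-tuple M -> eb_group -> m.-tuple M -> m.-tuple M;
  eb_rho_aut : forall c d, Ob G c -> Ob G d -> indep2 c d ->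
    forall mu, Aut_over (Y c d) (aclt c) (eb_rho c d mu);
  eb_rho_mul : forall c d, Ob G c -> Ob G d -> indep2 c d ->
    forall mu nu f, Y c d f ->
    eb_rho c d (mu * nu)%g f = eb_rho c d mu (eb_rho c d nu f);
  eb_rho_inj : forall c d, Ob G c -> Ob G d -> indep2 c d ->
    forall mu nu, {in Y c d, eb_rho c d mu =1 eb_rho c d nu} -> mu = nu;
  eb_rho_surj : forall c d, Ob G c -> Ob G d -> indep2 c d ->
    forall sigma, Aut_over (Y c d) (aclt c) sigma ->
    exists mu, {in Y c d, eb_rho c d mu =1 sigma};
  eb_rho_ext : forall c d, Ob G c -> Ob G d -> indep2 c d ->
    forall S s f, binding S -> S s -> Hom G d d s -> Hom G c d f ->
    eb_rho c d (eb_emb S) f = gcomp G s f;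
  eb_a0 : n.-tuple M;
  eb_b0' : n.-tuple M;
  eb_a0_ob : Ob G eb_a0;
  eb_b0'_ob : Ob G eb_b0';
  eb_a0b0'_indep : indep2 eb_a0 eb_b0';
  eb_I : Type;
  eb_J : Type;
  eb_i0 : eb_I;
  eb_g : eb_I -> m.-tuple M;
  eb_g' : eb_J -> m.-tuple M;
  eb_g_range : range eb_g = Hom G eb_a0 eb_b0';
  eb_gg'_range : range eb_g `|` range eb_g' = Y eb_a0 eb_b0';
  eb_compat : forall c d, Ob G c -> Ob G d -> indep2 c d ->
    forall (h : eb_I -> m.-tuple M) (h' : eb_J -> m.-tuple M),
    range h = Hom G c d -> range h `|` range h' = Y c d ->
    elementary (\bigcup_i tgraph (eb_g i) (h i) `|`
                \bigcup_j tgraph (eb_g' j) (h' j) `|`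
                tgraph eb_a0 c `|` tgraph eb_b0' d) ->
    forall mu,
      (forall i, eb_rho eb_a0 eb_b0' mu (eb_g eb_i0) = eb_g i ->
                 eb_rho c d mu (h eb_i0) = h i) /\
      (forall j, eb_rho eb_a0 eb_b0' mu (eb_g eb_i0) = eb_g' j ->
                 eb_rho c d mu (h eb_i0) = h' j) }.

Variable F : extended_binding.

(* Graph of the partial composition Y_{bc} x Y_{ab} -> Y_{ac}: h = g.f *)
Definition partial_comp a b c g f h : Prop :=
  indep3 a b c /\
  exists (tau0 sigma0 : eb_group F) (f0 g0 : m.-tuple M),
    [/\ Hom G a b f0, Hom G b c g0,
        f = eb_rho a b tau0 f0, g = eb_rho b c sigma0 g0 &
        h = eb_rho a c (sigma0 * tau0)%g (gcomp G g0 f0)].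

(** ** The groupoid F *)

(* The path (c_0, g_1, c_1, ..., g_k, c_k) is given by c_0 and the sequence of
   the pairs (g_i, c_i). *)
Definition steps := seq (m.-tuple M * n.-tuple M).

Fixpoint is_path c (q : steps) d : Prop :=
  match q with
  | [::] => c = d
  | (g, c1) :: q' =>
      [/\ Ob G c, Ob G c1, indep2 c c1, Y c c1 g & is_path c1 q' d]
  end.

(* D^k(c,d) *)
Definition dpaths k c d : set steps := [set q | size q = k /\ is_path c q d].

Fixpoint path_coords c (q : steps) : set M :=
  coords c `|`
  match q with
  | [::] => set0
  | (g, c1) :: q' => coords g `|` path_coords c1 q'
  end.

(* [transport cs c g q g']: starting from g in Y_{cs,c} and composing with the
   successive steps of the path (c, q) yields g'. *)
Fixpoint transport cs c g (q : steps) g' : Prop :=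
  match q with
  | [::] => g' = g
  | (g1, c1) :: q' =>
      exists2 h, partial_comp cs c c1 g1 g h & transport cs c1 h q' g'
  end.

Definition path_equiv c d (q r : steps) : Prop :=
  exists (cs : n.-tuple M) (gs k : m.-tuple M),
    [/\ Ob G cs, indep cs (path_coords c q `|` path_coords c r), Y cs c gs,
        Y cs d k & transport cs c gs q k /\ transport cs c gs r k].

Definition path_class c d (q : steps) : set steps :=
  [set r | dpaths 2 c d r /\ path_equiv c d q r].

(* Mor_F(c,d) *)
Definition MorF c d : set (set steps) :=
  [set path_class c d q | q in dpaths 2 c d].

(* Q.P for P in Mor_F(c,d) and Q in Mor_F(d,e) *)
Definition compF c d e (Q P : set steps) : set steps :=
  [set r | exists q1 q2, [/\ P q1, Q q2 & path_class c e (q1 ++ q2) r]].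

(* \underline{f} for f in Y_{cd}, with c and d independent *)
Definition underY c d f : set steps := path_class c d [:: (f, d)].

(* \underline{f} for f in X_{cd}, with c and d arbitrary *)
Definition underX c d f : set steps :=
  [set r | exists e u v,
     [/\ Ob G e, indep e (coords c `|` coords d),
         Hom G c e u, Hom G e d v &
         gcomp G v u = f /\ path_class c d [:: (u, e); (v, d)] r]].

End NonCommutativeGroupoid.
End ModelTheory.

(* Main.v *)
(* The forking calculus is reduced to three facts about finite tuples: every
   type over the empty set has a realization independent from a given small set;
   independence is monotone; and if a is independent from B and c from aB, then
   a is independent from cB.  They come from global Aut(M)-invariant types.  Such
   an extension of tp(a) is a maximal invariant consistent set of formulas: by
   stability some condition decides all instances of a given formula, by
   maximality finitely many conjugates of it cover, so the resulting definition
   has finitely many conjugates and is invariant because acl(0) = dcl(0) in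
   M^eq.  Two invariant types commute (Harrington), and a tuple is independent
   from B iff it realizes its invariant extension over B.

   On the groupoid side, F acts regularly on every Y_cd, and the compatibility
   requirement on rho, applied to the pair (a_0, b_0') itself, makes the binding
   group central in F.  Hence the value mu_k...mu_1.(h_k...h_1) of a path with
   steps mu_i.h_i is well defined up to moving elements of the binding group
   between the two factors; two paths are equivalent iff they have the same value,
   and every value is that of a 2-step path.  Both assertions then express the
   multiplicativity of the value. *)

(* Forking enters only through its definition by dividing. An invariant type is the right tool
   because it contains all conjugates of a formula as soon as it contains one, so none of its
   formulas can divide; conversely, a formula true of the tuple but outside the type is made to
   divide along a Morley sequence of its parameters.

   The language may be uncountable, but saturation is used only for countably many variables over
   countable sets of parameters. The exception to countability is acl(c), which may be as large as
   the language: it is shown to be small and is then handled by homogeneity alone.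

   On the groupoid side the obstacle is that the ends c, d of a morphism of F need not be
   independent, so that there is no regular action on Y_cd in which to compare two pairs (mu, h).
   They are compared after composition with a morphism from some cs independent from d, inside
   Y_{cs,d}, where the action is free. *)
From Stdlib Require Import Eqdep_dec.
Require Import Defs.
From mathcomp Require Import all_boot.
From mathcomp Require Import mathcomp_extra boolp classical_sets functions.
From mathcomp Require Import cardinality filter.

Set Implicit Arguments.
Unset Strict Implicit.
Unset Printing Implicit Defensive.

Local Open Scope classical_set_scope.
Local Open Scope card_scope.

(** * Definable predicates on families of elements *)

Section Definable.
Variables (L : language) (M : structure L).

(** The map need not be injective, so that variables can be identified as well as permuted or added;
    a bound variable is kept apart from the renamed ones. *)
Fixpoint rename n (phi : formula L n) : forall q, ('I_n -> 'I_q) -> formula L q :=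
  match phi in formula _ n return forall q, ('I_n -> 'I_q) -> formula L q with
  | FEq _ i j => fun _ f => FEq L (f i) (f j)
  | FRel _ r args => fun _ f => FRel (map_tuple f args)
  | FNot _ phi => fun _ f => FNot (rename phi f)
  | FAnd _ phi psi => fun _ f => FAnd (rename phi f) (rename psi f)
  | FEx _ s phi => fun _ f =>
      FEx s (rename phi
        (fun i => if unlift ord0 i is Some j then lift ord0 (f j) else ord0))
  end.

Lemma sat_rename n (phi : formula L n) q (f : 'I_n -> 'I_q) (v : q.-tuple M) :
  sat (rename phi f) v <-> sat phi [tuple tnth v (f i) | i < n].
Proof.
elim: phi q f v => {n} [n i j|n r args|n phi IH|n phi IH psi IH'|n s phi IH]
  q f v /=.
- by rewrite !tnth_mktuple.
- have -> : map_tuple (tnth v) (map_tuple f args) =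
            map_tuple (tnth [tuple tnth v (f i) | i < n]) args.
    by apply: eq_from_tnth => i; rewrite !tnth_map tnth_ord_tuple.
  by [].
- by rewrite IH.
- by rewrite IH IH'.
- have E u : [tuple tnth [tuple of u :: v]
       (if unlift ord0 i is Some j then lift ord0 (f j) else ord0) | i < n.+1] =
     [tuple of u :: [tuple tnth v (f i) | i < n]].
    apply: eq_from_tnth => i; rewrite tnth_mktuple.
    case: unliftP => [j ->|->]; last by rewrite !tnth0.
    by rewrite !tnthS tnth_mktuple.
  split=> -[u [su H]]; exists u; split=> //.
    by move/(IH q.+1): H; rewrite E.
  by apply/(IH q.+1); rewrite E.
Qed.

Lemma sat_eq n (phi : formula L n) (v w : n.-tuple M) :
  (forall i, tnth v i = tnth w i) -> sat phi v <-> sat phi w.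
Proof. by move=> /eq_from_tnth ->. Qed.

(** An argument of a formula is either a variable or an element standing for itself, so parameters
    need no tuple of their own. *)
Definition ev (I : Type) (v : I -> M) (x : I + M) : M :=
  match x with inl i => v i | inr m => m end.

Definition par_in (A : set M) (I : Type) (x : I + M) : Prop :=
  match x with inl _ => True | inr m => A m end.

(* A-definable subsets of M^I, for an index type I that may be infinite: only
   finitely many coordinates matter. *)
Definition definable (A : set M) (I : Type) (P : (I -> M) -> Prop) : Prop :=
  exists n (phi : formula L n) (e : 'I_n -> I + M),
    (forall i, par_in A (e i)) /\
    forall v, P v <-> sat phi [tuple ev v (e i) | i < n].

Implicit Types (A B : set M) (I J : Type).

Lemma eq_definable A I (P Q : (I -> M) -> Prop) :
  (forall v, P v <-> Q v) -> definable A P -> definable A Q.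
Proof.
by move=> PQ [n [phi [e [eA H]]]]; exists n, phi, e; split=> // v; rewrite -PQ.
Qed.

Lemma definable_subst A B I J (f : J -> I + M) (P : (J -> M) -> Prop) :
  (forall j, par_in B (f j)) -> A `<=` B ->
  definable A P -> definable B (fun v : I -> M => P (ev v \o f)).
Proof.
move=> fB AB [n [phi [e [eA H]]]].
exists n, phi, (fun i => match e i with inl j => f j | inr m => inr m end).
split=> [i|v]; first by have := eA i; case: (e i) => [j _|m /AB].
by rewrite H; apply: sat_eq => i; rewrite !tnth_mktuple; case: (e i).
Qed.

Lemma definable_comp A I J (f : J -> I) (P : (J -> M) -> Prop) :
  definable A P -> definable A (fun v : I -> M => P (v \o f)).
Proof. exact: (@definable_subst A A I J (fun j => inl (f j)) P). Qed.

Lemma sub_definable A B I (P : (I -> M) -> Prop) :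
  A `<=` B -> definable A P -> definable B P.
Proof. exact: (@definable_subst A B I I inl P). Qed.

Lemma definable_sat A I n (phi : formula L n) (e : 'I_n -> I + M) :
  (forall i, par_in A (e i)) ->
  definable A (fun v => sat phi [tuple ev v (e i) | i < n]).
Proof. by move=> eA; exists n, phi, e. Qed.

Lemma definableN A I (P : (I -> M) -> Prop) :
  definable A P -> definable A (fun v => ~ P v).
Proof.
by move=> [n [phi [e [eA H]]]]; exists n, (FNot phi), e; split=> // v /=; rewrite H.
Qed.

Lemma definableI A I (P Q : (I -> M) -> Prop) :
  definable A P -> definable A Q -> definable A (fun v => P v /\ Q v).
Proof.
move=> [n [phi [e [eA H]]]] [q [psi [e' [e'A H']]]].
pose e2 (i : 'I_(n + q)) :=
  match fintype.split i with inl i => e i | inr i => e' i end.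
exists (n + q), (FAnd (rename phi (@lshift n q)) (rename psi (@rshift n q))), e2.
split=> [i|v /=]; first by rewrite /e2; case: (fintype.split i).
have E1 : sat (rename phi (@lshift n q)) [tuple ev v (e2 i) | i < n + q] <-> P v.
  rewrite sat_rename H; apply: sat_eq => i; rewrite !tnth_mktuple /e2.
  by rewrite (unsplitK (inl i : 'I_n + 'I_q)).
have E2 : sat (rename psi (@rshift n q)) [tuple ev v (e2 i) | i < n + q] <-> Q v.
  rewrite sat_rename H'; apply: sat_eq => i; rewrite !tnth_mktuple /e2.
  by rewrite (unsplitK (inr i : 'I_n + 'I_q)).
by rewrite /= E1 E2.
Qed.

Lemma definable_imp A I (P Q : (I -> M) -> Prop) :
  definable A P -> definable A Q -> definable A (fun v => P v -> Q v).
Proof.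
move=> dP dQ; apply: (@eq_definable _ _ (fun v => ~ (P v /\ ~ Q v))).
  by move=> v; split=> [H p|H [/H]] //; apply: contrapT => q; apply: H.
by apply: definableN; apply: definableI => //; exact: definableN.
Qed.

Lemma definable_iff A I (P Q : (I -> M) -> Prop) :
  definable A P -> definable A Q -> definable A (fun v => P v <-> Q v).
Proof. by move=> dP dQ; apply: definableI; exact: definable_imp. Qed.

Lemma definable_ex A I s (P : (option I -> M) -> Prop) :
  definable A P ->
  definable A (fun v => exists u : M, sort_of u = s /\ P (oapp v u)).
Proof.
move=> [n [phi [e [eA H]]]].
suff [n' [e' [g [e'A E]]]] : exists n' (e' : 'I_n' -> I + M) (g : 'I_n -> 'I_n'.+1),
    (forall i, par_in A (e' i)) /\ forall (v : I -> M) u i,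
    tnth [tuple of u :: [tuple ev v (e' j) | j < n']] (g i) = ev (oapp v u) (e i).
  exists n', (FEx s (rename phi g)), e'; split=> // v /=.
  have E' u : [tuple tnth [tuple of u :: [tuple ev v (e' j) | j < n']] (g i) | i
    < n]
      = [tuple ev (oapp v u) (e i) | i < n].
    by apply: eq_from_tnth => i; rewrite !tnth_mktuple E.
  split=> -[u [su Pu]]; exists u; split=> //.
    by apply/sat_rename; rewrite E' -H.
  by move/sat_rename: Pu; rewrite E' -H.
pose conv (x : option I + M) : option (I + M) :=
  match x with inl None => None | inl (Some i) => Some (inl i)
             | inr m => Some (inr m) end.
have convE (v : I -> M) u x y : conv x = Some y -> ev (oapp v u) x = ev v y.
  by case: x => [[i|]|m] //= [<-].
have convN (v : I -> M) u x : conv x = None -> ev (oapp v u) x = u.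
  by case: x => [[i|]|m].
(* Positions held by the bound variable have no counterpart in [I + M]. They receive as filler the
   value [x0] of another position; if there is none, the bound variable is the only one and the list
   is empty. *)
have [[i0 [x0 Ex0]]|none] := pselect (exists i0 x0, conv (e i0) = Some x0).
  exists n, (fun i => odflt x0 (conv (e i))),
    (fun i => if conv (e i) is Some _ then lift ord0 i else ord0).
  split=> [i|v u i].
    have parE j y : conv (e j) = Some y -> par_in A y.
      by have := eA j; case: (e j) => [[k|]|m] //= Am [<-].
    case Ei: (conv (e i)) => [y|] /=; [exact: parE Ei|exact: parE Ex0].
  case Ei: (conv (e i)) => [y|]; last by rewrite tnth0 convN.
  by rewrite tnthS tnth_mktuple Ei (convE _ _ _ _ Ei).
exists 0, (fun i : 'I_0 => False_rect _ (Bool.diff_false_true (ltn_ord i))),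
  (fun=> ord0).
split=> [[]//|v u i]; rewrite tnth0 convN //.
by case Ei: (conv (e i)) => [y|] //; case: none; exists i, y.
Qed.

Lemma definable_eq A I (x y : I + M) : par_in A x -> par_in A y ->
  definable A (fun v => ev v x = ev v y).
Proof.
move=> Ax Ay; exists 2, (FEq L ord0 ord_max), (fun i => if i == ord0 then x else y).
split=> [i|v /=]; first by case: ifP.
by rewrite !tnth_mktuple.
Qed.

(** Sorts are visible to formulas only through quantifiers, hence the detour by an element of sort s
    equal to the given one. *)
Lemma definable_sort A I (i : I) s : definable A (fun v : I ->
  M => sort_of (v i) = s).
Proof.
apply: (@eq_definable _ _ (fun v => exists u : M, sort_of u = s /\
  ev (oapp v u) (inl None) = ev (oapp v u) (inl (Some i)))).
  by move=> v; split=> [[u [<- /= ->]]|<-] //; exists (v i).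
by apply: (@definable_ex A I s (fun w => ev w (inl None) = ev w (inl (Some i))));
  exact: definable_eq.
Qed.

End Definable.

(** * Automorphisms, and the passage between definable predicates and formulas *)

Section Automorphisms.
Variables (L : language) (M : structure L).
Implicit Types (A B : set M) (I J : Type) (alpha beta : M -> M).

Lemma aut_sat alpha n (phi : formula L n) (v : n.-tuple M) :
  automorphism alpha -> sat phi (map_tuple alpha v) <-> sat phi v.
Proof.
move=> [_ el]; have -> // := el n phi v (map_tuple alpha v).
by move=> i; exists (tnth v i) => //; rewrite tnth_map.
Qed.

Lemma aut_definable alpha A I (P : (I -> M) -> Prop) v :
  automorphism alpha -> (forall m, A m -> alpha m = m) ->
  definable A P -> P (alpha \o v) <-> P v.
Proof.
move=> aut fixA [n [phi [e [eA H]]]]; rewrite !H.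
rewrite -(aut_sat phi [tuple ev v (e i) | i < n] aut).
apply: sat_eq => i; rewrite [RHS]tnth_map !tnth_mktuple.
by have := eA i; case: (e i) => [j _|m /= Am] //; rewrite fixA.
Qed.

Lemma aut_sort alpha m : automorphism alpha -> sort_of (alpha m) = sort_of m.
Proof.
move=> aut.
have := @aut_definable _ set0 unit _ (fun=> m) aut (fun x => False_ind _)
  (definable_sort set0 tt (sort_of m)).
by case=> _; exact.
Qed.

Lemma aut_id : automorphism (id : M -> M).
Proof.
split; first by exists id.
move=> n phi v w H; apply: sat_eq => i.
by have [x _ [<- <-]] := H i.
Qed.

Lemma aut_comp alpha beta :
  automorphism alpha -> automorphism beta -> automorphism (alpha \o beta).
Proof.
move=> aa ab; split; first by apply: bij_comp; [case: aa|case: ab].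
move=> n phi v w H; rewrite -(aut_sat phi v ab) -(aut_sat phi _ aa).
apply: sat_eq => i; rewrite !tnth_map.
by have [x _ [<- <-]] := H i.
Qed.

Lemma aut_inv alpha : automorphism alpha ->
  exists beta, [/\ automorphism beta, cancel alpha beta & cancel beta alpha].
Proof.
move=> aa; have [[beta bK aK] _] := aa; exists beta; split=> //.
split; first by exists alpha.
move=> n phi v w H; rewrite -(aut_sat phi w aa).
apply: sat_eq => i; rewrite !tnth_map.
by have [x _ [<- <-]] := H i; rewrite aK.
Qed.

Definition fixes alpha A := forall m, A m -> alpha m = m.

Lemma psat_definable A n (theta : pformula M n) : params_in A theta ->
  definable A (fun v : 'I_n -> M => psat theta [tuple v i | i < n]).
Proof.
move=> pA.
pose e (i : 'I_(n + pdim theta)) : 'I_n + M :=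
  match fintype.split i with inl i => inl i | inr j =>
    inr (tnth (params theta) j) end.
apply: eq_definable (@definable_sat _ _ A _ _ (pform theta) e _) => [v|i].
  rewrite /psat.
  apply: sat_eq => i; rewrite tnth_mktuple /e.
  case: splitP => j ij /=.
    have -> : i = lshift _ j by apply: val_inj.
    by rewrite tnth_lshift tnth_mktuple.
  have -> : i = rshift _ j by apply: val_inj.
  by rewrite tnth_rshift.
rewrite /e; case: (fintype.split i) => //= j; apply: pA; by exists j.
Qed.

Lemma definable_psat A n (P : ('I_n -> M) -> Prop) : definable A P ->
  exists theta : pformula M n, params_in A theta /\
    forall x, psat theta x <-> P (tnth x).
Proof.
move=> [q [phi [e [eA H]]]].
suff [d [g [b [bA E]]]] : exists d (g : 'I_q -> 'I_(n + d)) (b : d.-tuple M),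
    coords b `<=` A /\
    forall (x : n.-tuple M) i, tnth [tuple of x ++ b] (g i) = ev (tnth x) (e i).
  exists (PFormula (rename phi g) b); split=> // x.
  rewrite /psat /= sat_rename H.
  by apply: sat_eq => i; rewrite !tnth_mktuple E.
(* The parameter tuple has one slot for each position of [e], and the slots of variables need a
   filler from A. If A is empty, there are no parameters at all. *)
have [[m Am]|A0] := pselect (exists m, A m).
  exists q, (fun i => match e i with inl j => lshift q j | inr _ => rshift n i end).
  exists [tuple match e i with inl _ => m | inr m' => m' end | i < q].
  split=> [_ [i _ <-]|x i].
    by rewrite tnth_mktuple; have := eA i; case: (e i).
  case Ei: (e i) => [j|m']; first by rewrite tnth_lshift.
  by rewrite tnth_rshift tnth_mktuple Ei.
have eI i : exists j, e i = inl j.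
  have := eA i; case: (e i) => [j|m Am]; first by exists j.
  by case: A0; exists m.
have [f fE] := choice eI.
exists 0, (fun i => lshift 0 (f i)), [tuple]; split=> [_ [[]]//|x i].
by rewrite tnth_lshift fE.
Qed.

Lemma definable_formula n (P : ('I_n -> M) -> Prop) : definable set0 P ->
  exists phi : formula L n, forall x, sat phi x <-> P (tnth x).
Proof.
move=> [q [phi [e [eA H]]]].
have eI i : exists j, e i = inl j.
  by have := eA i; case: (e i) => [j|//]; exists j.
have [f fE] := choice eI.
exists (rename phi f) => x; rewrite sat_rename H.
by apply: sat_eq => i; rewrite !tnth_mktuple fE.
Qed.

Lemma formula_definable n (phi : formula L n) :
  definable set0 (fun v : 'I_n -> M => sat phi [tuple v i | i < n]).
Proof. exact: (@definable_sat _ _ set0 _ _ phi inl). Qed.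

End Automorphisms.

Lemma countableU T (A B : set T) : countable A -> countable B ->
  countable (A `|` B).
Proof.
move=> cA cB; have -> : A `|` B = \bigcup_(b in [set: bool]) (if b then A else B).
  apply/seteqP; split=> [x [?|?]|x [[] _ ?]]; [by exists true|by exists false| |].
    by left.
  by right.
by apply: bigcup_countable => // -[].
Qed.

Lemma countable_range (T : countType) U (f : T -> U) : countable (range f).
Proof. exact: (sub_countable (card_image_le _ _)). Qed.

(** * Homogeneity and saturation for indexed families *)

Section Monster.
Variables (L : language) (M : structure L) (K : Type).
Hypothesis hM : monster M K.
Implicit Types (A B : set M) (alpha beta : M -> M).

(** K is infinite because it bounds the set of formulas, which contains one equality for each
    positive number of variables. *)
Lemma countable_small A : countable A -> small K A.
Proof.
move=> /card_le_trans; apply; have [+ _ _] := hM; apply: card_le_trans.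
pose f n := existT (formula L) n.+1 (FEq L ord0 ord0).
have f_inj : injective f by move=> p q /(congr1 (@projT1 _ _)) [].
have := inj_card_eq (in2W f_inj : {in [set: nat] &, injective f}).
by move=> /card_eqPle [_] /card_le_trans; apply; exact: card_leT.
Qed.

(** The one-sided hypothesis suffices: applied to negations, it gives the converse implication. *)
Lemma homogeneous (I : Type) A (v w : I -> M) :
  small K (range v `|` A) -> (forall P, definable A P -> P v -> P w) ->
  exists alpha, [/\ automorphism alpha, fixes alpha A &
                    forall i, alpha (v i) = w i].
Proof.
move=> sA vw; have [_ _ hom] := hM.
pose R : set (M * M) := range (fun i => (v i, w i)) `|` id_on A.
have elR : elementary R.
  move=> n phi x y xy.
  have /choice [e eP] : forall k, exists e : I + M,
      [/\ par_in A e, tnth x k = ev v e & tnth y k = ev w e].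
    move=> k; have [[i _ [<- <-]]|[m Am [<- <-]]] := xy k.
      by exists (inl i).
    by exists (inr m).
  have d := @definable_sat _ _ A _ _ phi e (fun i => let: And3 h _ _ := eP i in h).
  have Ex : sat phi x <-> sat phi [tuple ev v (e i) | i < n].
    by apply: sat_eq => i; rewrite tnth_mktuple; case: (eP i).
  have Ey : sat phi y <-> sat phi [tuple ev w (e i) | i < n].
    by apply: sat_eq => i; rewrite tnth_mktuple; case: (eP i).
  rewrite Ex Ey; split; first exact: vw d.
  move=> H; apply: contrapT => nH.
  exact: (vw _ (definableN d) nH H).
have [|alpha [aut aR]] := hom R elR.
  apply: card_le_trans sA; apply: subset_card_le => _ [z [[i _ <-]|[m Am <-]] <-].
    by left; exists i.
  by right.
exists alpha; split=> // [m Am|i].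
  by rewrite -(aR (m, m)) //; right; exists m.
by rewrite -(aR (v i, w i)) //; left; exists i.
Qed.

Definition upd (I : eqType) (v : I -> M) j x : I -> M :=
  fun i => if i == j then x else v i.

Lemma definable_upd A (I : eqType) (P : (I -> M) -> Prop) v j :
  definable A P ->
  definable (A `|` range v) (fun y : 'I_1 -> M => P (upd v j (y ord0))).
Proof.
move=> dP; apply: eq_definable (@definable_subst _ _ A (A `|` range v) 'I_1 I
  (fun i => if i == j then inl ord0 else inr (v i)) P _ _ dP) => [y|i|m].
- have -> // : ev y \o (fun i => if i == j then inl ord0 else inr (v i)) =
    upd v j (y ord0).
  by apply/funext => i /=; rewrite /upd; case: eqP.
- by case: eqP => //= _; right; exists i.
- by left.
Qed.

Lemma definable_ex_upd A (I : eqType) s (P : (I -> M) -> Prop) j :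
  definable A P ->
  definable A (fun v => exists u : M, sort_of u = s /\ P (upd v j u)).
Proof.
move=> dP.
have := definable_ex s (definable_comp (fun i =>
  if i == j then None else Some i) dP).
apply: eq_definable => v.
have E u : oapp v u \o (fun i => if i == j then None else Some i) = upd v j u.
  by apply/funext => i /=; rewrite /upd; case: eqP.
by split=> -[u [su Pu]]; exists u; split=> //; move: Pu; rewrite E.
Qed.

(** The hypothesis on M concerns one variable only. The given conditions are extended to a complete
    type, in the form of an ultrafilter, whose coordinates are realized one after another in the
    order of [pickle], each over A and the earlier ones. *)
Lemma saturation (I : countType) A (s : I -> lsort L)
    (Pi : set ((I -> M) -> Prop)) : countable A ->
  (forall P, Pi P -> definable A P) ->
  (forall l, (forall P, List.In P l -> Pi P) ->
    exists v, (forall i, sort_of (v i) = s i) /\ forall P, List.In P l -> P v) ->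
  exists v, (forall i, sort_of (v i) = s i) /\ forall P, Pi P -> P v.
Proof.
move=> cA dPi fs; pose srt (v : I -> M) := forall i, sort_of (v i) = s i.
pose F : set_system (I -> M) :=
  [set Q | exists l, (forall P, List.In P l -> Pi P) /\
  forall v, srt v -> (forall P, List.In P l -> P v) -> Q v].
have FF : ProperFilter F.
  split.
    by move=> [l [lPi H]]; have [v [sv lv]] := fs l lPi; exact: (H v sv lv).
  split; first by exists [::].
    move=> P Q [l [lPi lP]] [l' [lPi' lQ]]; exists (l ++ l'); split.
      by move=> R Rl; have [/lPi|/lPi'] := List.in_app_or _ _ _ Rl.
    move=> v sv H; split.
      by apply: lP => // R Rl; apply: H; apply: List.in_or_app; left.
    by apply: lQ => // R Rl; apply: H; apply: List.in_or_app; right.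
  move=> P Q PQ [l [lPi lP]]; exists l; split=> // v sv H.
  exact/PQ/lP.
have [G [GU FG]] := ultraFilterLemma FF.
have Gsrt : G srt by apply: FG; exists [::].
have GPi P : Pi P -> G P.
  move=> PP; apply: FG; exists [:: P]; split=> [_ [<-|]|v _ H] //.
  by apply: H; left.
pose dep k (P : (I -> M) -> Prop) := forall v w,
  (forall i, pickle i < k -> v i = w i) -> P v -> P w.
(* Stage k satisfies every member of the ultrafilter that sees only coordinates coded below k, so it
   never has to be revised. *)
pose good k v := srt v /\ forall P, definable A P -> dep k P -> G P -> P v.
have step k : forall v, exists v', good k v ->
    good k.+1 v' /\ forall i, pickle i < k -> v' i = v i.
  move=> v; have [gk|] := pselect (good k v); last by exists v.
  have [[j jk]|nj] := pselect (exists j : I, pickle j = k); last first.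
    exists v => -[sv gv]; split=> //; split=> // P dP depP;
      apply: gv => // w w' ww'.
    apply: depP => i; rewrite ltnS leq_eqVlt => /orP[/eqP ik|]; last exact: ww'.
    by case: nj; exists i.
  have [sv gv] := gk; have [_ sat _] := hM.
  pose A' := A `|` range v.
  have cA' : countable A' by apply: countableU => //; exact: countable_range.
  pose Pi' : set (pformula M 1) := [set theta | params_in A' theta /\
    exists P, [/\ definable A P, dep k.+1 P, G P &
      forall x, psat theta [tuple x] <-> P (upd v j x)]].
  have [|||x [sx xPi]] := sat A' (s j) Pi'.
  - exact: countable_small.
  - by move=> theta [].
  - move=> l lPi.
    have [Q [dQ depQ GQ Ql]] : exists Q, [/\ definable A Q, dep k.+1 Q, G Q &
        forall x, Q (upd v j x) -> forall theta, List.In theta l ->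
          psat theta [tuple x]].
      elim: l lPi => [|theta l IH] lPi.
        exists (fun w => sort_of (w j) = s j); split=> //.
        - exact: definable_sort.
        - by move=> w w' ww'; rewrite ww' // jk.
        - exact: filterS Gsrt.
      have [|Q [dQ depQ GQ Ql]] := IH; first by move=> t tl; apply: lPi; right.
      have [_ [P [dP depP GP PE]]] := lPi theta (or_introl erefl).
      exists (fun w => P w /\ Q w); split.
      - exact: definableI.
      - by move=> w w' ww' [Pw Qw]; split; [apply: depP Pw|apply: depQ Qw].
      - exact: filterI.
      - by move=> x [Px Qx] t [<-|tl]; [apply/PE|exact: Ql].
    (* Once the coordinate j is quantified away, the condition depends only on the earlier
       coordinates, and stage k already satisfies it. *)
    have [|||u [su Qu]] := gv (fun w => exists u, sort_of u = s j /\ Q (upd w j u)).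
    - exact: definable_ex_upd.
    - move=> w w' ww' [u [su Qu]]; exists u; split=> //; apply: depQ Qu => i.
      rewrite ltnS leq_eqVlt /upd => /orP[/eqP ik|/ww' ->] //.
      by rewrite -jk in ik; rewrite (pcan_inj pickleK ik) eqxx.
    - apply: filterS (filterI Gsrt GQ) => w [sw Qw]; exists (w j).
      split=> //; suff -> : upd w j (w j) = w by [].
      by apply/funext => i; rewrite /upd; case: eqP => [->|].
    by exists u; split=> // theta; exact: Ql.
  exists (upd v j x) => _; split; last first.
    by move=> i ik; rewrite /upd; case: eqP => // ij; rewrite ij jk ltnn in ik.
  split=> [i|P dP depP GP]; first by rewrite /upd; case: eqP => [->|].
  have [theta [tA' tP]] := definable_psat (definable_upd v j dP).
  have E y : psat theta [tuple y] <-> P (upd v j y) by rewrite tP.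
  by apply/E/xPi; split=> //; exists P.
have step' k : exists h : (I -> M) -> I -> M, forall v, good k v ->
    good k.+1 (h v) /\ forall i, pickle i < k -> h v i = v i.
  by have [h hP] := choice (step k); exists h.
have [g gP] := choice step'.
have [v0 sv0] := filter_ex Gsrt.
pose f := fix f k := if k is k'.+1 then g k' (f k') else v0.
have goodf k : good k (f k).
  elim: k => [|k IH]; last by have [] := gP k _ IH.
  split=> // P _ depP GP; have [w Pw] := filter_ex GP.
  by apply: depP Pw.
have ff k p i : pickle i < k -> f (k + p) i = f k i.
  move=> ik; elim: p => [|p IH]; first by rewrite addn0.
  rewrite addnS /=; have [_ ->] := gP _ _ (goodf (k + p)); first exact: IH.
  exact: ltn_addr.
(* The coordinate i is final from stage [pickle i + 1] on, and a definable predicate sees finitely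
   many coordinates, so the diagonal family agrees on them with a late stage. *)
exists (fun i => f (pickle i).+1 i); split=> [i|P PiP].
  by have [sf _] := goodf (pickle i).+1.
have dP := dPi _ PiP.
have [k depk] : exists k, dep k P.
  have [n [phi [e [eA H]]]] := dP.
  exists (\sum_i if e i is inl j then (pickle j).+1 else 0) => w w' ww'.
  rewrite !H; have -> // : [tuple ev w (e i) | i < n] = [tuple ev w' (e i) | i < n].
  apply: eq_from_tnth => i; rewrite !tnth_mktuple.
  case Ei: (e i) => [j|] //=; apply: ww'.
  by rewrite (bigD1 i) //= Ei ltn_addr.
have [_ /(_ P dP depk (GPi P PiP))] := goodf k.
apply: depk => i ik; by rewrite -(ff (pickle i).+1 (k - (pickle i).+1)) // subnKC.
Qed.

End Monster.

(** * Stable relations *)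

Lemma In_mkseq T (f : nat -> T) n x :
  List.In x (mkseq f n) <-> exists2 i, i < n & x = f i.
Proof.
elim: n x => [|n IH] x; first by split=> // -[].
rewrite mkseqS -cats1; split.
  move=> H; have [/IH[i ilt ->]|[<-|[]]] := List.in_app_or _ _ _ H.
    by exists i => //; exact: ltnW.
  by exists n.
move=> [i]; rewrite ltnS leq_eqVlt => /orP[/eqP ->|ilt] ->.
  by apply: List.in_or_app; right; left.
by apply: List.in_or_app; left; apply/IH; exists i.
Qed.

(** Dependent choice in which each term may refer to the whole list of its predecessors. *)
Lemma dependent_sequence X (Good : X -> Prop) (Phi : seq X -> X -> Prop) :
  (forall l, (forall x, List.In x l -> Good x) -> exists x, Good x /\ Phi l x) ->
  exists f : nat -> X, forall i, Good (f i) /\ Phi (mkseq f i) (f i).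
Proof.
move=> H; have [x0 _] := H [::] (fun _ => False_ind _).
have /choice [g gP] : forall l, exists x,
    (forall x, List.In x l -> Good x) -> Good x /\ Phi l x.
  move=> l; have [/H[x xP]|] := pselect (forall x, List.In x l -> Good x).
    by exists x.
  by exists x0.
pose hist := fix hist k := if k is k'.+1 then rcons (hist k') (g (hist k')) else
  [::].
have histE i : hist i = mkseq (g \o hist) i.
  by elim: i => //= i IH; rewrite mkseqS -IH.
exists (g \o hist); elim/ltn_ind => i IH; rewrite -histE; apply: gP => x.
by rewrite histE => /In_mkseq[j ji ->]; have [] := IH j ji.
Qed.

Lemma filter_In (T U : Type) (F : set_system T) (l : seq U) (P : U -> set T) :
  Filter F -> (forall u, List.In u l -> F (P u)) ->
  F [set x | forall u, List.In u l -> P u x].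
Proof.
move=> FF; elim: l => [|u l IH] H.
  by apply: filterS filterT => x _ v [].
apply: filterS (filterI (H u (or_introl erefl)) (IH _)) =>
  [x [Pu Pl] v [<-//|/Pl//]|v vl].
by apply: H; right.
Qed.

(** Ramsey for pairs by a nonprincipal ultrafilter: one colour occurs at almost all j for almost all
    i, and a homogeneous sequence is then picked greedily. *)
Lemma ramsey_pairs (c : nat -> nat -> Prop) : exists (s : nat -> nat) (b : bool),
  (forall i j, i < j -> s i < s j) /\ forall i j, i < j -> (c (s i) (s j) <-> b).
Proof.
have [G [GU FG]] := ultraFilterLemma eventually_filter.
have large k : G [set j | k < j] by apply: FG; exists k.+1.
have half d : G [set i | G [set j | d i j]] -> exists s : nat -> nat,
    (forall i j, i < j -> s i < s j) /\ forall i j, i < j -> d (s i) (s j).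
  move=> Gd; have [|s sP] := @dependent_sequence nat (fun i => G [set j | d i j])
      (fun l x => forall y, List.In y l -> y < x /\ d y x).
    move=> l lG; have H : G [set x | forall y, List.In y l -> y < x /\ d y x].
      by apply: (filter_In (P := fun y => [set x | y < x /\ d y x])) => y yl;
         apply: filterI; [exact: large|exact: lG].
    by have [x [Gx xP]] := filter_ex (filterI Gd H); exists x.
  by exists s; split=> i j ij; have [_ /(_ (s i))[]] := sP j => //;
     apply/In_mkseq; exists i.
have [|Gn] := in_ultra_setVsetC [set i | G [set j | c i j]] GU.
  by move=> /half[s [sm sc]]; exists s, true; split=> // i j /sc.
have [|s [sm sc]] := half (fun i j => ~ c i j).
  apply: filterS Gn => i nc.
  by have [//|] := in_ultra_setVsetC [set j | c i j] GU.
by exists s, false; split=> // i j /sc.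
Qed.

Definition half_graph X Y (R : X -> Y -> Prop) : Prop :=
  exists (x : nat -> X) (y : nat -> Y), forall i j, R (x i) (y j) <-> i < j.

Section StableRelation.
Variables (X Y : Type) (R : X -> Y -> Prop).
Hypotheses (noR : ~ half_graph R) (noRC : ~ half_graph (fun x y => ~ R x y)).

(* Otherwise choose a_i, b_i, c_i such that the b_i, c_i are not separated by
   the earlier a's but are separated by the later ones, as by D. *)
Lemma definable_trace (A : set X) (D : Y -> Prop) :
  (forall l : seq Y, exists2 a, A a & forall y, List.In y l -> (R a y <-> D y)) ->
  exists l : seq X, (forall x, List.In x l -> A x) /\
    forall y z, (forall x, List.In x l -> (R x y <-> R x z)) -> (D y <-> D z).
Proof.
move=> fs; apply: contrapT => noD.
have sep (l : seq X) : (forall x, List.In x l -> A x) -> exists b c,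
    [/\ D b, ~ D c & forall x, List.In x l -> (R x b <-> R x c)].
  move=> lA; apply: contrapT => nsep; apply: noD; exists l; split=> // y z yz.
  have [Dy|nDy] := pselect (D y); have [Dz|nDz] := pselect (D z) => //.
    by case: nsep; exists y, z.
  by case: nsep; exists z, y; split=> // x /yz[].
have [|f fP] := @dependent_sequence (X * (Y * Y))
   (fun t => [/\ A t.1, D t.2.1 & ~ D t.2.2])
   (fun l t => (forall u, List.In u l -> (R u.1 t.2.1 <-> R u.1 t.2.2)) /\
     forall u, List.In u (t :: l) -> R t.1 u.2.1 /\ ~ R t.1 u.2.2).
  move=> l lG; have [|b [c [Db Dc bc]]] := sep (map fst l).
    by move=> x /List.in_map_iff[u [<- /lG[]]].
  have [a Aa aP] := fs (b :: c :: map (fun t => t.2.1) l ++ map (fun t => t.2.2) l).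
  exists (a, (b, c)); split=> //=; split=> [u ul|u [<- /=|ul]].
  - by apply: bc; apply: List.in_map.
  - by split; [apply/aP => //; left|move=> /aP H; apply/Dc/H; right; left].
  - have [_ Du1 Du2] := lG u ul; split.
      apply/aP => //; right; right; apply: List.in_or_app; left.
      exact: (List.in_map (fun t => t.2.1)).
    move=> /aP H; apply/Du2/H; right; right; apply: List.in_or_app; right.
    exact: (List.in_map (fun t => t.2.2)).
pose a i := (f i).1; pose b i := (f i).2.1; pose c i := (f i).2.2.
have after i j : j <= i -> R (a i) (b j) /\ ~ R (a i) (c j).
  rewrite leq_eqVlt => ji; have [_ [_ H]] := fP i; apply: H.
  by case/orP: ji => [/eqP ->|ji]; [left|right; apply/In_mkseq; exists j].
have before i j : i < j -> (R (a i) (b j) <-> R (a i) (c j)).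
  by move=> ij; have [_ [H _]] := fP j; apply: H; apply/In_mkseq; exists i.
(* For i < j the relation does not separate b_j from c_j. If it holds there on a subsequence, the
   c's form a half graph, as it fails for j <= i; if it fails there, the b's form one for the
   negation. *)
have [s [[] [smono sP]]] := ramsey_pairs (fun i j => R (a i) (b j)).
  apply: noR; exists (a \o s), (c \o s) => i j /=; split.
    case: ltnP => // ji; have [] := after (s i) (s j) _ => //.
    by move: ji; rewrite leq_eqVlt => /orP[/eqP ->//|/smono/ltnW].
  by move=> ij; apply/(before _ _ (smono _ _ ij))/sP.
apply: noRC; exists (a \o s), (b \o s) => i j /=; split.
  case: ltnP => // ji; have [] := after (s i) (s j) _ => //.
  by move: ji; rewrite leq_eqVlt => /orP[/eqP ->//|/smono/ltnW].
by move=> ij /(sP _ _ ij).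
Qed.

End StableRelation.

(** The latest value comes first, so that the parent of a node is its tail. *)
Definition branch (eta : nat -> bool) (k : nat) : seq bool := rev (mkseq eta k).

Lemma cantor_countType (T : countType) (f : (nat -> bool) -> T) : ~ injective f.
Proof.
move=> finj.
pose d n := `[< ~ exists eta, pickle (f eta) = n /\ eta n >].
have : d (pickle (f d)) <-> ~ d (pickle (f d)); last by tauto.
rewrite {1}/d; split=> [/asboolP H dd|H]; first by apply: H; exists d.
by apply/asboolP => -[eta [/(pcan_inj pickleK)/finj -> ?]].
Qed.

(* A stable relation has only countably many traces on a countable set,
   whereas the branches of a binary tree have distinct traces. *)
Lemma binary_tree_half_graph X (R : X -> seq bool -> Prop) (a : (nat -> bool) ->
  X) :
  (forall eta k, R (a eta) (branch eta k) <-> eta k) ->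
  half_graph R \/ half_graph (fun x y => ~ R x y).
Proof.
move=> aR; apply: contrapT => /not_orP[noR noRC].
pose realizes x (l : seq (bool * seq bool)) :=
  forall u, List.In u l -> (R x u.2 <-> u.1).
(* One realization for each finite pattern that some [a eta] realizes: a countable set in which
   every [a eta] is finitely approximated. *)
have /choice [w wP] : forall l, exists x,
    (exists eta, realizes (a eta) l) -> realizes x l.
  move=> l; have [[eta H]|] := pselect (exists eta, realizes (a eta) l).
    by exists (a eta).
  by exists (a (fun=> true)).
pose pattern (ls : seq (seq (bool * seq bool))) y :=
  map (fun c => `[< R (w c) y >]) ls.
(* By [definable_trace] the trace of [a eta] is a Boolean combination of finitely many traces of the
   w's. It is coded by the list of these and the truth patterns on which it holds, an element of a
   countable type. *)
have /choice [code codeP] : forall eta, exists cd :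
    seq (seq (bool * seq bool)) * seq (seq bool),
    forall y, R (a eta) y <-> pattern cd.1 y \in cd.2.
  move=> eta; have [|l [lw lD]] :=
    @definable_trace _ _ R noR noRC (range w) (R (a eta)).
    move=> l; exists (w [seq (`[< R (a eta) y >], y) | y <- l]);
      first by exists [seq (`[< R (a eta) y >], y) | y <- l].
    have H : realizes (w [seq (`[< R (a eta) y >], y) | y <- l])
        [seq (`[< R (a eta) y >], y) | y <- l].
      apply: wP; exists eta => u /List.in_map_iff[y [<- _]] /=.
      by split=> [/asboolP|/asboolP].
    move=> y yl; have /= -> := H (`[< R (a eta) y >], y).
      by split=> [/asboolP|/asboolP].
    by apply/List.in_map_iff; exists y.
  have [ls lsE] : exists ls, l = map w ls.
    elim: l lw {lD} => [|x l IH] lw; first by exists [::].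
    have [|ls ->] := IH; first by move=> y yl; apply: lw; right.
    by have [c _ <-] := lw x (or_introl erefl); exists (c :: ls).
  exists (ls, [seq p <- map val (enum {: (size ls).-tuple bool})
                | `[< exists y, pattern ls y = p /\ R (a eta) y >]]) => y /=.
  rewrite mem_filter; split=> [Ry|/andP[/asboolP[z [zy Rz]] _]].
    apply/andP; split; first by apply/asboolP; exists y.
    have sz : size (pattern ls y) == size ls by rewrite size_map.
    by apply/mapP; exists (Tuple sz) => //; rewrite mem_enum.
  apply/(lD z y) => //; rewrite lsE => x /List.in_map_iff[c [<- cl]].
  elim: ls cl zy {lsE} => //= c' ls IH [->|cl] [e1 e2]; last exact: IH.
  by split=> [/asboolP|/asboolP]; [rewrite e1|rewrite -e1] => /asboolP.
(* Equal codes mean equal traces. As the value of eta at level k is read off the trace at its own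
   node of that level, the two branches agree by induction on k. *)
apply: (@cantor_countType _ code) => eta eta' E.
have D y : R (a eta) y <-> R (a eta') y by rewrite !codeP E.
have Eb k : branch eta k = branch eta' k.
  elim: k => // k IH; rewrite /branch !mkseqS !rev_rcons -/(branch eta k) IH.
  congr (_ :: _); apply/idP/idP => H.
    by apply/aR; rewrite -IH -D; apply/aR.
  by apply/aR; rewrite IH D; apply/aR.
apply/funext => k; apply/idP/idP => H.
  by apply/aR; rewrite -Eb -D; apply/aR.
by apply/aR; rewrite Eb D; apply/aR.
Qed.

Definition juxt (M I J : Type) (x : I -> M) (y : J -> M) (s : I + J) : M :=
  match s with inl i => x i | inr j => y j end.

Section StableFormulas.
Variables (L : language) (M : structure L).
Hypothesis stM : stable M.

Definition sorted_by I (s : I -> lsort L) : set (I -> M) :=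
  [set v | forall i, sort_of (v i) = s i].

(** The parameters are appended to the second tuple as constant entries; slots belonging to
    variables receive arbitrary fixed fillers. *)
Lemma stable_definable A n k (Q : ('I_n + 'I_k -> M) -> Prop) s t :
  definable A Q ->
  ~ half_graph (fun (x : {x | sorted_by (I := 'I_n) s x})
                    (y : {y | sorted_by (I := 'I_k) t y}) =>
                Q (juxt (sval x) (sval y))).
Proof.
move=> [q [phi [e [_ H]]]] [a [b ab]].
pose d i := match e i with
  inr m => m | inl x => juxt (sval (a 0)) (sval (b 0)) x end.
pose g i := match e i with
  | inl (inl l) => lshift (k + q) l
  | inl (inr l) => rshift n (lshift q l)
  | inr _ => rshift n (rshift k i) end.
apply: (stM (phi := rename phi g) (s := mktuple s)
  (t := [tuple of mktuple t ++ [tuple sort_of (d i) | i < q]])).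
exists (fun i => mktuple (sval (a i))),
  (fun j => [tuple of mktuple (sval (b j)) ++ mktuple d]); split.
- move=> i; apply: eq_from_tnth => l; rewrite tnth_map !tnth_mktuple.
  by case: (a i) => x /= ->.
- move=> j; apply: eq_from_tnth => l; rewrite tnth_map.
  case: (split_ordP l) => l' ->.
    by rewrite !tnth_lshift !tnth_mktuple; case: (b j) => y /= ->.
  by rewrite !tnth_rshift !tnth_mktuple.
move=> i j; rewrite -ab H sat_rename; apply: sat_eq => l; rewrite !tnth_mktuple /g.
case El: (e l) => [[l'|l']|m] /=.
- by rewrite tnth_lshift tnth_mktuple.
- by rewrite tnth_rshift tnth_lshift tnth_mktuple.
- by rewrite !tnth_rshift tnth_mktuple /d El.
Qed.

End StableFormulas.

Lemma finite_In T (l : seq T) : finite_set [set x | List.In x l].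
Proof.
elim: l => [|x l IH]; first by rewrite (_ : mkset _ = set0) //; apply/seteqP.
rewrite (_ : mkset _ = [set x] `|` [set y | List.In y l]).
  by rewrite finite_setU; split=> //; exact: finite_set1.
by apply/seteqP; split=> y [/esym|]; [left|right|move=> ->; left|right].
Qed.

Lemma mem_In (T : eqType) (x : T) (l : seq T) : x \in l -> List.In x l.
Proof.
elim: l => //= y l IH; rewrite inE => /orP[/eqP ->|/IH]; first by left.
by right.
Qed.

(** * Orbits and the closures acl and dcl *)

Section Orbits.
Variables (L : language) (M : structure L) (K : Type).
Hypothesis hM : monster M K.
Implicit Types (A B X : set M) (alpha beta : M -> M) (u : M).

(** Compactness: if no formula over B true of u is confined to X, the type of u over B together with
    x outside X is realized, and homogeneity makes the realization a conjugate of u. *)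
Lemma aut_escape B X u : countable B -> countable X ->
  (forall P : ('I_1 -> M) -> Prop, definable B P -> P (fun=> u) ->
     exists y, P (fun=> y) /\ ~ X y) ->
  exists alpha, [/\ automorphism alpha, fixes alpha B & ~ X (alpha u)].
Proof.
move=> cB cX H.
pose Pi : set (('I_1 -> M) -> Prop) := [set P | definable B P /\ P (fun=> u)] `|`
  [set P | exists2 m, X m & P = (fun v => v ord0 <> m)].
have [|||v [sv vPi]] := @saturation _ _ _ hM _ (B `|` X) (fun=> sort_of u) Pi.
- exact: countableU.
- move=> P [[dP _]|[m Xm ->]]; first by apply: sub_definable dP => m; left.
  apply: definableN; apply: (@definable_eq _ _ _ 'I_1 (inl ord0) (inr m)) => //=.
  by right.
- move=> l lPi.
  have [Q [dQ Qu Ql]] : exists Q : ('I_1 -> M) ->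
    Prop, [/\ definable B Q, Q (fun=> u) &
     forall y, Q (fun=> y) -> sort_of y = sort_of u /\
       (~ X y -> forall P, List.In P l -> P (fun=> y))].
    elim: l lPi => [|P l IH] lPi.
      exists (fun v => sort_of (v ord0) = sort_of u); split=> //.
      exact: definable_sort.
    have [|Q [dQ Qu Ql]] := IH; first by move=> R Rl; apply: lPi; right.
    case: (lPi P (or_introl erefl)) => [[dP Pu]|[m Xm PE]].
      exists (fun v => P v /\ Q v); split=> //; first exact: definableI.
      by move=> y [Py /Ql[sy H']]; split=> // nX R [<- //|Rl]; exact: H'.
    exists Q; split=> // y /Ql[sy H']; split=> // nX R [<-|Rl]; last exact: H'.
    by rewrite PE => ym; apply: nX; rewrite ym.
  have [y [/Ql[sy yl] nXy]] := H Q dQ Qu.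
  by exists (fun=> y); split=> // P Pl; exact: yl.
have [|P dP Pu|alpha [aa fB aE]] := @homogeneous _ _ _ hM 'I_1 B (fun=> u) v.
- by apply: (countable_small hM); apply: countableU => //; exact: countable_range.
- by apply: vPi; left.
- exists alpha; split=> // Xu.
  have : Pi (fun v => v ord0 <> alpha u) by right; exists (alpha u).
  by move=> /vPi; apply; rewrite -(aE ord0).
Qed.

Lemma definable1_psat B (P : ('I_1 -> M) -> Prop) : definable B P ->
  exists theta : pformula M 1, params_in B theta /\
    forall y, psat theta [tuple y] <-> P (fun=> y).
Proof.
move=> /definable_psat[theta [tB tP]]; exists theta; split=> // y.
rewrite tP; have -> // : tnth [tuple y] = fun=> y.
by apply/funext => i; rewrite ord1.
Qed.

(** An orbit inside X cannot escape X, so by [aut_escape] some formula over B true of u has all its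
    solutions in X. *)
Lemma finite_orbit_acl B X u : countable B -> finite_set X ->
  (forall alpha, automorphism alpha -> fixes alpha B -> X (alpha u)) -> acl B u.
Proof.
move=> cB fX orb; apply: contrapT => nacl.
have [|P dP Pu|alpha [aa fB]] := @aut_escape B X u cB; last by apply; exact: orb.
  exact: finite_set_countable.
apply: contrapT => nex; apply: nacl.
have [theta [tB tP]] := definable1_psat dP; exists theta; split=> //.
  exact/tP.
apply: sub_finite_set fX => y /tP Py; apply: contrapT => nX.
by apply: nex; exists y.
Qed.

Lemma fixed_dcl B u : countable B ->
  (forall alpha, automorphism alpha -> fixes alpha B -> alpha u = u) -> dcl B u.
Proof.
move=> cB orb; apply: contrapT => ndcl.
have [|P dP Pu|alpha [aa fB]] :=
  @aut_escape B [set u] u cB; last by apply; exact: orb.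
  exact: finite_set_countable (finite_set1 u).
apply: contrapT => nex; apply: ndcl.
have [theta [tB tP]] := definable1_psat dP; exists theta; split=> //.
  exact/tP.
move=> y /tP Py; apply: contrapT => nX.
by apply: nex; exists y.
Qed.

End Orbits.

Section DefinableSets.
Variables (L : language) (M : structure L).
Implicit Types (A B : set M) (alpha beta : M -> M) (u : M).

Lemma aut_dcl alpha B u : automorphism alpha -> fixes alpha B -> dcl B u ->
  alpha u = u.
Proof.
move=> aa fB [theta [tB tu tuniq]]; apply: tuniq.
have := aut_definable (fun=> u) aa fB (psat_definable tB).
have E y : [tuple (fun _ : 'I_1 => y) i | i < 1] = [tuple y].
  by apply: eq_from_tnth => i; rewrite tnth_mktuple ord1.
have -> : alpha \o (fun _ : 'I_1 => u) = fun=> alpha u by [].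
by rewrite !E => ->.
Qed.

Lemma definable_aut I alpha A (P : (I -> M) -> Prop) : automorphism alpha ->
  definable (alpha @` A) P -> definable A (fun v => P (alpha \o v)).
Proof.
move=> aa [n [phi [e [eA H]]]]; have [beta [ab aK bK]] := aut_inv aa.
exists n, phi, (fun i => if e i is inr m then inr (beta m) else e i).
split=> [i|v].
  by have := eA i; case: (e i) => //= _ [m Am <-]; rewrite aK.
rewrite H -[X in _ <-> X](aut_sat phi _ aa); apply: sat_eq => i.
rewrite [RHS]tnth_map !tnth_mktuple.
by case: (e i) => //= m; rewrite bK.
Qed.

Lemma definable_support A I (P : (I -> M) -> Prop) : definable A P ->
  exists l : seq I, forall v w, (forall i, List.In i l -> v i = w i) -> P v -> P w.
Proof.
move=> [n [phi [e [_ H]]]].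
exists (pmap (fun i => if e i is inl j then Some j else None) (enum 'I_n)) =>
  v w vw.
rewrite !H; have -> // : [tuple ev v (e i) | i < n] = [tuple ev w (e i) | i < n].
apply: eq_from_tnth => i; rewrite !tnth_mktuple.
case Ei: (e i) => [j|//] /=; apply: vw.
have : List.In i (enum 'I_n) by apply: mem_In; rewrite mem_enum.
elim: (enum 'I_n) => //= i' s IH [->|/IH]; first by rewrite Ei; left.
by case: (e i') => //= j'; right.
Qed.

(* P0 plays the role of the true formula: a relational language may have no
   formula at all without free variables. *)
Lemma definable_on_atoms A I (S : set (I -> M)) (P0 : (I -> M) -> Prop)
    (l : seq ((I -> M) -> Prop)) (D : (I -> M) -> Prop) :
  definable A P0 -> (forall y, S y -> P0 y) ->
  (forall P, List.In P l -> definable A P) ->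
  (forall y z, S y -> S z -> (forall P, List.In P l -> (P y <-> P z)) ->
     (D y <-> D z)) ->
  exists D', definable A D' /\ forall y, S y -> (D y <-> D' y).
Proof.
move=> dP0 SP0; elim: l D => [|P l IH] D dl Dl.
  (* Without atoms D is constant on S: it is either [P0] or its negation there. *)
  have [[z [Sz Dz]]|nD] := pselect (exists z, S z /\ D z).
    exists P0; split=> // y Sy; split=> _; first exact: SP0.
    exact/(Dl z).
  exists (fun v => ~ P0 v); split=> [|y Sy]; first exact: definableN.
  by split=> [Dy|/(_ (SP0 _ Sy))] //; case: nD; exists y.
have dl' R : List.In R l -> definable A R by move=> Rl; apply: dl; right.
have dP := dl P (or_introl erefl).
(* On a part E where P has one truth value, the remaining atoms decide D. Off that part D is
   redefined by agreement with some point of it, which makes the induction hypothesis applicable on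
   all of S. *)
have side (E : (I -> M) -> Prop) : (forall y z, S y -> S z -> E y -> E z ->
  (P y <-> P z)) ->
    exists D', definable A D' /\ forall y, S y -> E y -> (D y <-> D' y).
  move=> EP; have [|D' [dD' D'E]] := IH (fun y => exists z, [/\ S z, E z, D z &
      forall R, List.In R l -> (R y <-> R z)]) dl'.
    move=> y z Sy Sz yz; split=> -[w [Sw Ew Dw yw]]; exists w; split=> // R Rl.
      by rewrite -yz // yw.
    by rewrite yz // yw.
  exists D'; split=> // y Sy Ey; rewrite -D'E //; split=> [Dy|[z [Sz Ez Dz yz]]].
    by exists y.
  apply/(Dl y z) => // R [<-|Rl]; [exact: (EP y z)|exact: yz].
have [|D1 [dD1 D1E]] := side P; first by [].
have [|D2 [dD2 D2E]] := side (fun v => ~ P v); first by [].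
exists (fun v => (P v -> D1 v) /\ (~ P v -> D2 v)); split.
  apply: definableI; first exact: definable_imp.
  by apply: definable_imp => //; exact: definableN.
move=> y Sy; have [Py|nPy] := pselect (P y).
  by rewrite D1E //; split=> [|[/(_ Py)]].
by rewrite D2E //; split=> [|[_ /(_ nPy)]].
Qed.

Lemma definable_ex_tuple A k I (t : 'I_k -> lsort L) (P : ('I_k + I -> M) -> Prop) :
  definable A P ->
  definable A (fun v => exists y, sorted_by t y /\ P (juxt y v)).
Proof.
elim: k I t P => [|k IH] I t P dP.
  have := definable_comp (fun x : 'I_0 + I =>
    match x with inl i => False_rect _ (Bool.diff_false_true (ltn_ord i)) | inr i
      => i end) dP.
  apply: eq_definable => v.
  have E (y : 'I_0 -> M) : v \o (fun x : 'I_0 + I =>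
     match x with inl i => False_rect _ (Bool.diff_false_true (ltn_ord i)) | inr
       i => i end) = juxt y v.
    by apply/funext => -[[]|].
  split=> [Pv|[y [_ Pv]]]; last by rewrite (E y).
  exists (fun i : 'I_0 => False_rect _ (Bool.diff_false_true (ltn_ord i))).
  by split; [case|rewrite -E].
pose f (x : 'I_k.+1 + I) : 'I_k + option I :=
  match x with
  | inl i => if unlift ord0 i is Some j then inl j else inr None
  | inr i => inr (Some i) end.
have := IH _ (t \o lift ord0) _ (definable_comp f dP).
move=> /(definable_ex (t ord0)); apply: eq_definable => v.
pose cons y (u : M) : 'I_k.+1 -> M :=
  fun i => if unlift ord0 i is Some j then y j else u.
have E y u : juxt y (oapp v u) \o f = juxt (cons y u) v.
  by apply/funext => -[i|i] //=; rewrite /f /cons; case: (unlift ord0 i).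
split=> [[u [su [y [sy]]]]|[y [sy Py]]].
  rewrite E => Py; exists (cons y u); split=> // i; rewrite /cons.
  by case: unliftP => [j ->|->]; [exact: sy|].
exists (y ord0); split; first exact: sy.
exists (y \o lift ord0); split=> [i|]; first exact: sy.
rewrite E; have -> // : cons (y \o lift ord0) (y ord0) = y.
by apply/funext => i; rewrite /cons; case: unliftP => [j ->|->].
Qed.

End DefinableSets.

(** * Invariant types *)

Section InvariantTypes.
Variables (L : language) (M : structure L) (K : Type).
Hypotheses (hM : monster M K) (heq : eq_closed M) (stM : stable M).
Hypothesis hbase : acl (set0 : set M) `<=` dcl set0.
Implicit Types (A B : set M) (alpha beta : M -> M).

(* The canonical parameter of D has finitely many conjugates, hence lies in
   acl(0) = dcl(0). *)
Lemma finite_orbit_invariant k (t : 'I_k -> lsort L) (D : ('I_k -> M) -> Prop)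
    (auts : seq (M -> M)) :
  definable setT D -> (forall alpha, List.In alpha auts -> automorphism alpha) ->
  (forall beta, automorphism beta -> exists alpha, List.In alpha auts /\
    forall y, sorted_by t y -> (D (beta \o y) <-> D (alpha \o y))) ->
  forall beta y, automorphism beta -> sorted_by t y -> (D (beta \o y) <-> D y).
Proof.
move=> [q [phi [e [_ De]]]] auts_aut fin_orb beta0 y0 ab0 sy0.
(* The parameters of D are collected in p and turned into variables of [delta]; the slots of p that
   belong to variables are filled from [y0]. *)
pose p : q.-tuple M := [tuple ev y0 (e i) | i < q].
pose es i : ('I_k + 'I_q) + M :=
  match e i with inl j => inl (inl j) | inr _ => inl (inr i) end.
pose delta (w : 'I_k + 'I_q -> M) := sat phi [tuple ev w (es i) | i < q].
have ddelta : definable set0 delta.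
  by apply: definable_sat => i; rewrite /es; case: (e i).
have deltaD (alpha gamma : M -> M) y : automorphism gamma -> cancel alpha gamma ->
    (D (alpha \o y) <-> delta (juxt y (gamma \o tnth p))).
  move=> ag aK; rewrite De -(aut_sat phi _ ag); apply: sat_eq => i.
  rewrite [LHS]tnth_map !tnth_mktuple /es.
  by case Ei: (e i) => [j|m] /=; [rewrite aK|rewrite tnth_mktuple Ei].
(* Two parameter tuples are equivalent when they define the same set of tuples of sorts t; the class
   of p will be the canonical parameter u of D. *)
pose Erel (w : 'I_q + 'I_q -> M) := ~ exists y, sorted_by t y /\
  ~ (delta (juxt y (w \o inl)) <-> delta (juxt y (w \o inr))).
have ErelP (w : 'I_q + 'I_q -> M) : Erel w <-> forall y, sorted_by t y ->
   (delta (juxt y (w \o inl)) <-> delta (juxt y (w \o inr))).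
  split=> [nex y sy|H [y [sy]]]; last by apply; exact: H.
  by apply: contrapT => ny; apply: nex; exists y.
have dErel : definable set0 Erel.
  apply: definableN.
  pose f1 (s : 'I_k + 'I_q) : 'I_k + ('I_q + 'I_q) :=
    match s with inl i => inl i | inr i => inr (inl i) end.
  pose f2 (s : 'I_k + 'I_q) : 'I_k + ('I_q + 'I_q) :=
    match s with inl i => inl i | inr i => inr (inr i) end.
  have := definable_ex_tuple t (definableN
    (definable_iff (definable_comp f1 ddelta) (definable_comp f2 ddelta))).
  apply: eq_definable => w.
  have E1 y : juxt y w \o f1 = juxt y (w \o inl) by apply/funext => -[].
  have E2 y : juxt y w \o f2 = juxt y (w \o inr) by apply/funext => -[].
  by split=> -[y [sy H]]; exists y; split=> //; move: H; rewrite E1 E2.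
have [E EE] := definable_formula (definable_comp (@unsplit q q) dErel).
have {}EE (x x' : q.-tuple M) : sat E [tuple of x ++ x'] <-> forall y,
  sorted_by t y ->
    (delta (juxt y (tnth x)) <-> delta (juxt y (tnth x'))).
  have -> : tnth x = (tnth [tuple of x ++ x'] \o @unsplit q q) \o inl.
    by apply/funext => i /=; rewrite tnth_lshift.
  have -> : tnth x' = (tnth [tuple of x ++ x'] \o @unsplit q q) \o inr.
    by apply/funext => i /=; rewrite tnth_rshift.
  by rewrite EE ErelP.
have [|||t' [pr [psi [prt _ prE prdef]]]] := heq (s := sorts p) (E := E).
- by move=> x _; apply/EE.
- by move=> x x' _ _ /EE H; apply/EE => y sy; rewrite H.
- move=> x x' x'' _ _ _ /EE H /EE H'; apply/EE => y sy.
  by rewrite (H y sy) (H' y sy).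
have dom_aut alpha : automorphism alpha -> sorts (map_tuple alpha p) = sorts p.
  move=> aa; apply: eq_from_tnth => i.
  by rewrite !(tnth_map (@sort_of L M)) tnth_map aut_sort.
pose u := pr p.
have pr_aut alpha : automorphism alpha -> pr (map_tuple alpha p) = alpha u.
  move=> aa; apply/prdef; [exact: dom_aut|by rewrite aut_sort // prt|].
  have /(aut_sat psi _ aa) : sat psi [tuple of p ++ [tuple u]].
    by apply/prdef => //; exact: prt.
  congr (sat psi _); apply: val_inj => /=; by rewrite map_cat.
have prD alpha beta gamma : automorphism alpha -> automorphism beta ->
    cancel gamma alpha ->
    alpha u = beta u <-> (forall y, sorted_by t y -> (D (gamma \o y) <->
      delta (juxt y (beta \o tnth p)))).
  move=> aa ab gK; rewrite -!pr_aut // prE; try exact: dom_aut.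
  have tE sigma : tnth (map_tuple sigma p) = sigma \o tnth p.
    by apply/funext => i; rewrite tnth_map.
  rewrite EE !tE; split=> H y sy.
    by rewrite (deltaD _ alpha) // H.
  by rewrite -H // (deltaD _ alpha).
have /choice [iv ivP] : forall alpha, exists beta, automorphism alpha ->
    [/\ automorphism beta, cancel alpha beta & cancel beta alpha].
  move=> alpha; have [/aut_inv[beta]|] :=
    pselect (automorphism alpha); first by exists beta.
  by exists id.
have u_acl : acl set0 u.
  apply: (@finite_orbit_acl _ _ _ hM set0
    ((fun alpha => iv alpha u) @` [set alpha | List.In alpha auts])).
  - exact: countable0.
  - exact/finite_image/finite_In.
  (* Precomposing D with the inverse of gamma amounts to replacing its parameters p by their images
     under gamma, hence the inverses in the finite orbit of u. *)
  move=> gamma ag _; have [ab gK bK] := ivP _ ag.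
  have [alpha [al H]] := fin_orb _ ab; have [ai aK iK] := ivP _ (auts_aut _ al).
  exists alpha => //; apply/(prD _ _ _ ai ag aK) => y sy.
  by rewrite -H // (deltaD _ gamma).
have [ab bK ibK] := ivP _ ab0.
have := aut_dcl ab (fun x => False_ind _) (hbase u_acl).
move=> /esym/(prD id _ id (aut_id M) ab (fun _ => erefl)) H.
by rewrite (deltaD _ (iv beta0)) // -H.
Qed.


Definition finitely_consistent I (Gamma : set ((I -> M) -> Prop)) : Prop :=
  forall l, (forall P, List.In P l -> Gamma P) ->
    exists v, forall P, List.In P l -> P v.

Definition aut_closed I (Gamma : set ((I -> M) -> Prop)) : Prop :=
  forall alpha P, automorphism alpha -> Gamma P -> Gamma (fun v => P (alpha \o v)).

Definition tp A I (a : I -> M) : set ((I -> M) -> Prop) :=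
  [set P | definable A P /\ P a].

(** A global Aut(M)-invariant type. Members are arbitrary predicates, and completeness is asked of
    the definable ones, which are also the only ones that [realizes] reads. *)
Record invariant_type I (T : set ((I -> M) -> Prop)) : Prop := InvariantType {
  it_consistent : finitely_consistent T;
  it_aut : aut_closed T;
  it_complete : forall P, definable setT P -> T P \/ T (fun v => ~ P v) }.

Lemma tp_aut_closed I (a : I -> M) : aut_closed (tp set0 a).
Proof.
move=> alpha P aa [dP Pa].
have -> : (fun v => P (alpha \o v)) = P; last by [].
by apply/funext => v; apply/propext; apply: (aut_definable v aa _ dP).
Qed.

Lemma maximal_invariant I (a : I -> M) : exists Pi, [/\ finitely_consistent Pi,
  aut_closed Pi, tp set0 a `<=` Pi & forall Gamma, aut_closed Gamma ->
    finitely_consistent (Pi `|` Gamma) -> Gamma `<=` Pi].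
Proof.
(* The type of a is joined to Pi instead of being required inside it, so that the union of the empty
   chain is still good. *)
pose Good (Pi : set ((I -> M) -> Prop)) :=
  aut_closed Pi /\ finitely_consistent (Pi `|` tp set0 a).
have [F FG Ftot|Pi [[Piaut Pifc] Pimax]] := @Zorn_bigcup _ Good.
  split=> [alpha P aa [X FX XP]|l lF].
    by exists X => //; have [+ _] := FG X FX; apply.
  have [[X FX]|F0] := pselect (exists X, F X); last first.
    exists a => P Pl; have [[X FX _]|[]//] := lF P Pl.
    by case: F0; exists X.
  have [Z [FZ Zl]] : exists Z, F Z /\ forall P, List.In P l -> (Z `|` tp set0 a) P.
    elim: l lF => [|P l IH] lF; first by exists X.
    have [|Z [FZ Zl]] := IH; first by move=> Q Ql; apply: lF; right.
    have [[Z' FZ' Z'P]|tP] := lF P (or_introl erefl); last first.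
      by exists Z; split=> // Q [<-|/Zl //]; right.
    have [ZZ'|Z'Z] := Ftot Z Z' FZ FZ'.
      exists Z'; split=> // Q [<-|/Zl[/ZZ'|]]; [by left|by left|by right].
    by exists Z; split=> // Q [<-|/Zl //]; left; exact: Z'Z.
  by have [_ +] := FG Z FZ; apply.
have add Gamma : aut_closed Gamma ->
    finitely_consistent ((Pi `|` Gamma) `|` tp set0 a) -> Gamma `<=` Pi.
  move=> Gaut Gfc; apply: contrapT => nsub.
  apply: (Pimax (Pi `|` Gamma)).
    split; first by move=> P; left.
    by move=> H; apply: nsub => P GP; apply: H; right.
  by split=> // alpha P aa [PiP|GP]; [left; exact: Piaut|right; exact: Gaut].
have tpPi : tp set0 a `<=` Pi.
  apply: add; first exact: tp_aut_closed.
  by move=> l lP; apply: Pifc => P /lP[//|]; right.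
exists Pi; split=> //.
  by move=> l lP; apply: Pifc => P /lP; left.
move=> Gamma Gaut Gfc; apply: add => // l lP; apply: Gfc => P /lP[] // /tpPi.
by left.
Qed.

Lemma sorted_aut I (t' : I -> lsort L) alpha y :
  automorphism alpha -> sorted_by t' y -> sorted_by t' (alpha \o y).
Proof. by move=> aa sy i; rewrite /= aut_sort. Qed.

Section Maximal.
Variables (n : nat) (a : 'I_n -> M) (Pi : set (('I_n -> M) -> Prop)).
Hypotheses (Pifc : finitely_consistent Pi) (Piaut : aut_closed Pi).
Hypothesis tpPi : tp set0 a `<=` Pi.
Hypothesis Pimax : forall Gamma, aut_closed Gamma ->
  finitely_consistent (Pi `|` Gamma) -> Gamma `<=` Pi.
Implicit Types (R S : ('I_n -> M) -> Prop).

Let s i := sort_of (a i).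

Let con R := forall l, (forall P, List.In P l -> Pi P) ->
  exists v, R v /\ forall P, List.In P l -> P v.

Let sub_con R S : (forall v, R v -> S v) -> con R -> con S.
Proof. by move=> RS cR l /cR[v [/RS Sv lv]]; exists v. Qed.

(** Two finite parts of Pi, each refuting one half, would together refute R. *)
Let con_split R S : con R -> con (fun v => R v /\ S v) \/ con (fun v => R v /\
  ~ S v).
Proof.
move=> cR; apply: contrapT => /not_orP[/existsNP[l1 /not_implyP[l1Pi n1]]].
move=> /existsNP[l2 /not_implyP[l2Pi n2]].
have [|v [Rv lv]] := cR (l1 ++ l2).
  by move=> P Pl; have [/l1Pi|/l2Pi] := List.in_app_or _ _ _ Pl.
have [Sv|nSv] := pselect (S v).
  apply: n1; exists v; split=> // P Pl.
  by apply: lv; apply: List.in_or_app; left.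
apply: n2; exists v; split=> // P Pl.
by apply: lv; apply: List.in_or_app; right.
Qed.

Let con_aut alpha R : automorphism alpha -> con R -> con (fun v => R (alpha \o v)).
Proof.
move=> aa cR l lPi; have [beta [ab aK bK]] := aut_inv aa.
have [|v [Rv lv]] := cR (map (fun P v => P (beta \o v)) l).
  by move=> _ /List.in_map_iff[P [<- /lPi PP]]; exact: Piaut.
exists (beta \o v); split.
  have -> // : alpha \o (beta \o v) = v by apply/funext => i /=; rewrite bK.
move=> P Pl; apply: (lv (fun v => P (beta \o v))).
exact: (List.in_map (fun P v => P (beta \o v))).
Qed.

Let con_sorted R : con R -> forall l, (forall P, List.In P l -> Pi P) ->
  exists v, [/\ R v, sorted_by s v & forall P, List.In P l -> P v].
Proof.
move=> cR l lPi.
pose f i : ('I_n -> M) -> Prop := fun v => sort_of (v i) = s i.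
have [|v [Rv lv]] := cR (map f (enum 'I_n) ++ l).
  move=> P Pl; have [/List.in_map_iff[i [<- _]]|/lPi//] := List.in_app_or _ _ _ Pl.
  by apply: tpPi; split=> //; exact: definable_sort.
exists v; split=> // [i|P Pl]; last by apply: lv; apply: List.in_or_app; right.
apply: (lv (f i)); apply: List.in_or_app; left; apply: List.in_map.
by apply: mem_In; rewrite mem_enum.
Qed.

(* Otherwise the negations of all conjugates of R could be added to Pi. *)
Let con_cover R : con R -> exists (l : seq (('I_n -> M) ->
  Prop)) (auts : seq (M -> M)),
  [/\ forall P, List.In P l -> Pi P, forall alpha, List.In alpha auts ->
    automorphism alpha
    & forall v, (forall P, List.In P l -> P v) ->
        exists alpha, List.In alpha auts /\ R (alpha \o v)].
Proof.
move=> cR; apply: contrapT => ncover.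
pose Gamma : set (('I_n -> M) -> Prop) :=
  [set P | exists2 alpha, automorphism alpha & P = fun v => ~ R (alpha \o v)].
have GPi : Gamma `<=` Pi.
  apply: Pimax.
    by move=> alpha P aa [beta ab ->]; exists (beta \o alpha) => //;
      exact: aut_comp.
  move=> l lPG.
  have [l1 [auts [l1Pi autsP cov]]] : exists (l1 : seq (('I_n -> M) ->
    Prop)) (auts : seq (M -> M)),
      [/\ forall P, List.In P l1 -> Pi P, forall alpha, List.In alpha auts ->
        automorphism alpha
      & forall v, (forall P, List.In P l1 -> P v) ->
          (forall alpha, List.In alpha auts -> ~ R (alpha \o v)) ->
          forall P, List.In P l -> P v].
    elim: l lPG => [|P l IH] lPG; first by exists [::], [::].
    have [|l1 [auts [l1Pi autsP cov]]] :=
      IH; first by move=> Q Ql; apply: lPG; right.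
    have [PiP|[alpha aa PE]] := lPG P (or_introl erefl).
      exists (P :: l1), auts; split=> // [Q [<- //|/l1Pi //]|v lv nv Q [<-|Ql]].
        by apply: lv; left.
      by apply: cov => // Q' Ql'; apply: lv; right.
    exists l1, (alpha :: auts);
      split=> // [beta [<- //|/autsP //]|v lv nv Q [<-|Ql]].
      by rewrite PE; apply: nv; left.
    by apply: cov => // beta bl; apply: nv; right.
  apply: contrapT => nv; apply: ncover; exists l1, auts; split=> // v lv.
  apply: contrapT => nR; apply: nv; exists v; apply: cov => // alpha al Rv.
  by apply: nR; exists alpha.
have [|v [Rv lv]] := cR [:: fun v => ~ R (id \o v)].
  by move=> _ [<-|//]; apply: GPi; exists id => //; exact: aut_id.
by apply: (lv _ (or_introl erefl)).
Qed.

Variables (k : nat) (t : 'I_k -> lsort L) (Q : ('I_n + 'I_k -> M) -> Prop).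
Hypothesis dQ : definable set0 Q.

Let holds (l : seq (bool * ('I_k -> M))) v :=
  forall u, List.In u l -> (Q (juxt v u.2) <-> u.1).

(** Otherwise every consistent condition splits over some y. Splitting repeatedly grows a binary
    tree of conditions whose branches are all realized by saturation, and [binary_tree_half_graph]
    contradicts stability. *)
Let decisive : exists l, con (holds l) /\
  forall y, sorted_by t y -> ~ (con (holds ((true, y) :: l)) /\
    con (holds ((false, y) :: l))).
Proof.
apply: contrapT => nodec.
(* Choice demands a y even for inconsistent l. Any tuple will do, and if there is no tuple at all
   the empty condition is decisive vacuously. *)
have /choice [b bP] : forall l, exists y, con (holds l) ->
    [/\ sorted_by t y, con (holds ((true, y) :: l)) & con (holds ((false,
      y) :: l))].
  move=> l; have [cl|ncl] := pselect (con (holds l)); last first.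
    have [cl0|ncl0] := pselect (exists y : 'I_k -> M, True).
      by have [y _] := cl0; exists y.
    exfalso; apply: nodec; exists [::]; split.
      by move=> l0 /Pifc[v lv]; exists v.
    by move=> y; case: ncl0; exists y.
  apply: contrapT => nb; apply: nodec; exists l; split=> // y sy [c1 c2].
  by apply: nb; exists y.
pose node := fix node sg : seq (bool * ('I_k -> M)) :=
  if sg is c :: sg' then (c, b (node sg')) :: node sg' else [::].
have con_node sg : con (holds (node sg)).
  elim: sg => [|c sg IH]; first by move=> l0 /Pifc[v lv]; exists v.
  by have [_ ct cf] := bP _ IH; case: c.
have branch_mono eta i j v : i <= j ->
    holds (node (branch eta j)) v -> holds (node (branch eta i)) v.
  move=> /subnKC <-; elim: (j - i) => [|d IH]; first by rewrite addn0.
  rewrite addnS => H; apply: IH => u ul; apply: H.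
  by rewrite /branch mkseqS rev_rcons; right.
have /choice [g gP] : forall eta, exists v, sorted_by s v /\
    forall i, holds (node (branch eta i)) v.
  move=> eta.
  pose A := range (fun z : seq bool * 'I_k => b (node z.1) z.2).
  have [|||v [sv vP]] := @saturation _ _ _ hM _ A s
     (range (fun i v => Q (juxt v (b (node (branch eta i)))) <-> eta i)).
  - exact: countable_range.
  - move=> _ [i _ <-].
    have := @definable_subst _ _ set0 A 'I_n _ (fun z : 'I_n + 'I_k => match z with
      inl x => inl x | inr j => inr (b (node (branch eta i)) j) end) Q _ _ dQ.
    have E v : ev v \o (fun z : 'I_n + 'I_k => match z with
      inl x => inl x | inr j => inr (b (node (branch eta i)) j) end) =
      juxt v (b (node (branch eta i))) by apply/funext => -[].
    case: (eta i) => H.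
      apply: eq_definable (H _ _) => [v|[z|z]|//] //=;
        last by exists (branch eta i, z).
      by rewrite E; split=> // -[_]; apply.
    apply: eq_definable (definableN (H _ _)) => [v|[z|z]|//] //=;
      last by exists (branch eta i, z).
    by rewrite E; split=> // -[H1 _ /H1].
  - move=> l lP.
    have [N NP] : exists N, forall v, holds (node (branch eta N)) v ->
        forall P, List.In P l -> P v.
      elim: l lP => [|P l IH] lP; first by exists 0.
      have [|N NP] := IH; first by move=> P' Pl; apply: lP; right.
      have [i _ PE] := lP P (or_introl erefl).
      exists (maxn N i.+1) => v hv P' [<-|Pl]; last first.
        by apply: NP Pl; apply: branch_mono hv; exact: leq_maxl.
      rewrite -PE; have := branch_mono eta i.+1 _ v (leq_maxr N _) hv.
      move=> /(_ (eta i, b (node (branch eta i)))); apply.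
      by rewrite /branch mkseqS rev_rcons; left.
    have [|v [hv sv _]] := con_sorted (con_node (branch eta N)) (l := [::]).
      by move=> ? [].
    by exists v; split=> //; exact: NP.
  exists v; split=> // i.
  elim: i => [|i IH]; first by move=> ? [].
  rewrite /branch mkseqS rev_rcons => u [<-|ul]; last exact: IH.
  by apply: (vP (fun v => Q (juxt v (b (node (branch eta i)))) <-> eta i));
    exists i.
have sb sg : sorted_by t (b (node sg)) by have [] := bP _ (con_node sg).
have sg eta : sorted_by s (g eta) by have [] := gP eta.
pose X := {x : 'I_n -> M | sorted_by s x}.
have [|[x [y xy]]|[x [y xy]]] := @binary_tree_half_graph X
   (fun x sg => Q (juxt (sval x) (b (node sg)))) (fun eta =>
     exist _ (g eta) (sg eta)).
- move=> eta i /=; have [_ /(_ i.+1)] := gP eta.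
  rewrite /branch mkseqS rev_rcons => /(_ (eta i, b (node (branch eta i)))).
  by apply; left.
- apply: (stable_definable (s := s) (t := t) stM dQ).
  by exists x, (fun j => exist _ _ (sb (y j))).
apply: (stable_definable (s := s) (t := t) stM (definableN dQ)).
by exists x, (fun j => exist _ _ (sb (y j))).
Qed.

(** D collects the y whose instance is consistent with a decisive condition l. Once D is known to be
    invariant, the formulas saying that Q is defined by D form an invariant family consistent with
    Pi, so they belong to Pi by maximality. *)
Lemma decided : exists D : ('I_k -> M) -> Prop,
  forall y, sorted_by t y -> Pi (fun v => Q (juxt v y) <-> D y).
Proof.
have [l [cl dec]] := decisive.
pose D y := con (holds ((true, y) :: l)).
have holds1 c y v : holds ((c, y) :: l) v <-> (Q (juxt v y) <-> c) /\ holds l v.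
  split=> [H|[H1 H2] u [<-//|/H2//]].
  by split=> [|u ul]; [apply: (H (c, y)); left|apply: H; right].
have conD R y : sorted_by t y -> (forall v, R v -> holds l v) -> con R ->
    con (fun v => R v /\ (Q (juxt v y) <-> D y)).
  move=> sy Rl cR; have [c1|c0] := con_split (fun v => Q (juxt v y)) cR.
    have Dy : D y.
      by apply: sub_con c1 => v [Rv Qv]; apply/holds1; split=> //; exact: Rl.
    by apply: sub_con c1 => v [Rv Qv]; split.
  have nDy : ~ D y.
    move=> Dy; apply: (dec y sy); split=> //.
    by apply: sub_con c0 => v [Rv Qv]; apply/holds1; split=> //; exact: Rl.
  by apply: sub_con c0 => v [Rv Qv]; split.
have conDs ys : (forall y, List.In y ys -> sorted_by t y) ->
    con (fun v => holds l v /\ forall y, List.In y ys -> (Q (juxt v y) <-> D y)).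
  elim: ys => [|y ys IH] sys; first by apply: sub_con cl => v lv; split.
  have := conD _ y (sys y (or_introl erefl)) _ (IH _).
  move=> H; apply: sub_con (H _ _) => [v [[hv yv] Dv]|v []//|z zl].
    by split=> // z [<-|/yv].
  by apply: sys; right.
(* Finitely many translates of l cover Pi. The translate of l by beta is consistent with Pi, hence
   jointly with one of these; both translates decide every instance, so there the two conjugates of
   D coincide. *)
have [auts [autsP orb]] : exists auts : seq (M -> M),
    (forall alpha, List.In alpha auts -> automorphism alpha) /\
    forall beta, automorphism beta -> exists alpha, List.In alpha auts /\
      forall y, sorted_by t y -> (D (beta \o y) <-> D (alpha \o y)).
  have [l0 [auts [l0Pi autsP cov]]] := con_cover cl.
  exists auts; split=> // beta ab.
  have [alpha [al ca]] : exists alpha, List.In alpha auts /\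
      con (fun v => holds l (beta \o v) /\ holds l (alpha \o v)).
    apply: contrapT => nca.
    have [l1 [l1Pi l1n]] : exists l1, (forall P, List.In P l1 -> Pi P) /\
        forall v, holds l (beta \o v) -> (forall P, List.In P l1 -> P v) ->
          forall alpha, List.In alpha auts -> ~ holds l (alpha \o v).
      have : forall alpha, List.In alpha auts -> List.In alpha auts by [].
      elim: {-2}auts => [|alpha auts' IH] sub; first by exists [::].
      have [|l1 [l1Pi l1n]] := IH; first by move=> al alin; apply: sub; right.
      have /existsNP[l2 /not_implyP[l2Pi n2]] :
          ~ con (fun v => holds l (beta \o v) /\ holds l (alpha \o v)).
        by move=> ca; apply: nca; exists alpha; split=> //; apply: sub; left.
      exists (l1 ++ l2); split.
        by move=> P Pl; have [/l1Pi|/l2Pi] := List.in_app_or _ _ _ Pl.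
      move=> v bv lv gamma [<- av|gl].
        apply: n2; exists v; split=> // P Pl.
        by apply: lv; apply: List.in_or_app; right.
      apply: l1n gl => // P Pl.
      by apply: lv; apply: List.in_or_app; left.
    have [|v [bv lv]] := con_aut ab cl (l := l0 ++ l1).
      by move=> P Pl; have [/l0Pi|/l1Pi] := List.in_app_or _ _ _ Pl.
    have [|alpha [al av]] := cov v.
      by move=> P Pl; apply: lv; apply: List.in_or_app; left.
    apply: (l1n v bv _ alpha al av) => P Pl.
    by apply: lv; apply: List.in_or_app; right.
  exists alpha; split=> // y sy; have aa := autsP _ al.
  have Qaut gamma v : automorphism gamma ->
      Q (juxt (gamma \o v) (gamma \o y)) <-> Q (juxt v y).
    move=> ag; rewrite -(aut_definable (juxt v y) ag _ dQ) //.
    have -> // : gamma \o juxt v y = juxt (gamma \o v) (gamma \o y).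
    by apply/funext => -[].
  have moved gamma (c : bool) R : automorphism gamma ->
      (forall v, R v -> holds l (gamma \o v)) ->
      con (fun v => R v /\ (Q (juxt v y) <-> c)) ->
      con (holds ((c, gamma \o y) :: l)).
    move=> ag Rl cR; have [delta [ad gK dK]] := aut_inv ag.
    apply: sub_con (con_aut ad cR) => v [/Rl Rv Qv].
    have dv : gamma \o (delta \o v) = v by apply/funext => i /=; rewrite dK.
    rewrite dv in Rv; apply/holds1; split=> //.
    by rewrite -Qv -(Qaut gamma) // dv.
  have [c1|c0] := con_split (fun v => Q (juxt v y)) ca.
    have {}c1 : con (fun v => (holds l (beta \o v) /\ holds l (alpha \o v)) /\
        (Q (juxt v y) <-> true)) by apply: sub_con c1 => v [].
    by split=> _; apply: moved c1 => // v [].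
  have {}c0 : con (fun v => (holds l (beta \o v) /\ holds l (alpha \o v)) /\
      (Q (juxt v y) <-> false)) by apply: sub_con c0 => v [].
  have nD gamma : automorphism gamma ->
      (forall v, holds l (beta \o v) /\
        holds l (alpha \o v) -> holds l (gamma \o v)) ->
      ~ D (gamma \o y).
    move=> ag gl Dy; apply: (dec (gamma \o y)); first exact: sorted_aut.
    by split=> //; apply: moved c0.
  by split=> H; exfalso; [apply: (nD beta) H|apply: (nD alpha) H] => // v [].
(* Invariance requires D to be definable: finite pieces of D are realized by single tuples, so
   [definable_trace] and [definable_on_atoms] apply. A true formula then needs a free variable, so k
   = 0 is treated apart, where beta does not move y. *)
have Dinv beta y : automorphism beta -> sorted_by t y -> (D (beta \o y) <-> D y).
  move=> ab sy.
  have [k0|kpos] := posnP k.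
    have -> // : beta \o y = y.
    by apply/funext => i; have := ltn_ord i; rewrite {2}k0.
  pose X := {x : 'I_n -> M | sorted_by s x}; pose Y :=
    {y : 'I_k -> M | sorted_by t y}.
  have [||ys|l' [_ l'D]] := @definable_trace X Y (fun x y =>
    Q (juxt (sval x) (sval y)))
      _ _ setT (fun y => D (sval y)).
  - exact: (stable_definable stM dQ).
  - exact: (stable_definable stM (definableN dQ)).
  - have [||v [[hv yv] sv _]] := con_sorted (conDs (map sval ys) _) (l := [::]).
    + by move=> _ /List.in_map_iff[z [<- _]]; exact: (svalP z).
    + by move=> ? [].
    + exists (exist _ v sv) => // z zl; apply: yv.
      exact: (List.in_map sval).
  have [||||D' [dD' D'E]] := @definable_on_atoms _ _ setT 'I_k (sorted_by t)
     (fun v => sort_of (v (Ordinal kpos)) = t (Ordinal kpos))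
     (map (fun x : X => fun y => Q (juxt (sval x) y)) l') D.
  - exact: definable_sort.
  - by move=> z; exact.
  - move=> _ /List.in_map_iff[x [<- _]].
    have := @definable_subst _ _ set0 setT 'I_k _ (fun z : 'I_n + 'I_k =>
      match z with inl i => inr (sval x i) | inr j => inl j end) Q _ _ dQ.
    move=> H; apply: eq_definable (H _ _) => [v|[]|] //.
    have -> // : ev v \o (fun z : 'I_n + 'I_k =>
      match z with inl i => inr (sval x i) | inr j => inl j end) = juxt (sval x) v.
    by apply/funext => -[].
  - move=> z z' sz sz' zz'; apply: (l'D (exist _ z sz) (exist _ z' sz')) => x xl.
    exact: (zz' _ (List.in_map _ _ _ xl)).
  rewrite !D'E //; last exact: sorted_aut.
  apply: (finite_orbit_invariant (t := t) dD' autsP) => // gamma ag.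
  have [alpha [al aE]] := orb gamma ag; exists alpha; split=> // z sz.
  rewrite -!D'E; [exact: aE|apply: sorted_aut => //;
    exact: autsP|exact: sorted_aut].
exists D.
pose Gamma : set (('I_n -> M) -> Prop) :=
  [set P | exists2 y, sorted_by t y & P = fun v => Q (juxt v y) <-> D y].
have GPi : Gamma `<=` Pi; last by move=> y sy; apply: GPi; exists y.
apply: Pimax => [alpha P aa [y sy ->]|l0 l0P].
  have [beta [ab aK bK]] := aut_inv aa; exists (beta \o y); first exact: sorted_aut.
  apply/funext => v; apply/propext.
  rewrite Dinv // -(aut_definable (juxt v (beta \o y)) aa _ dQ) //.
  have -> // : alpha \o juxt v (beta \o y) = juxt (alpha \o v) y.
  by apply/funext => -[] //= i; rewrite bK.
have [l1 [ys [l1Pi sys ysP]]] : exists (l1 : seq (('I_n -> M) -> Prop)) ys,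
    [/\ forall P, List.In P l1 -> Pi P, forall y, List.In y ys -> sorted_by t y &
    forall v, (forall y, List.In y ys -> (Q (juxt v y) <-> D y)) ->
      (forall P, List.In P l1 -> P v) -> forall P, List.In P l0 -> P v].
  elim: l0 l0P => [|P l0 IH] l0P; first by exists [::], [::].
  have [|l1 [ys [l1Pi sys ysP]]] := IH; first by move=> R Rl; apply: l0P; right.
  have [PiP|[y sy PE]] := l0P P (or_introl erefl).
    exists (P :: l1), ys; split=> // [R [<-//|/l1Pi//]|v yv lv R [<-|Rl]].
      by apply: lv; left.
    by apply: ysP => // R' Rl'; apply: lv; right.
  exists l1, (y :: ys); split=> // [z [<-//|/sys//]|v yv lv R [<-|Rl]].
    by rewrite PE; apply: yv; left.
  by apply: ysP => // z zl; apply: yv; right.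
have [v [[_ yv] lv]] := conDs ys sys l1 l1Pi.
by exists v; exact: ysP.
Qed.

End Maximal.

Lemma invariant_extension n (a : 'I_n -> M) :
  exists T, invariant_type T /\ tp set0 a `<=` T.
Proof.
have [Pi [Pifc Piaut tpPi Pimax]] := maximal_invariant a.
exists Pi; split=> //; split=> // P [q [phi [e [_ H]]]].
(* The parameters of P become the tuple y, with fillers from a, at which the parameter-free Q is
   decided. *)
pose y i : M := if e i is inr m then m else ev a (e i).
pose Q (w : 'I_n + 'I_q -> M) := sat phi [tuple ev w
  (match e i with inl j => inl (inl j) | inr _ => inl (inr i) end) | i < q].
have dQ : definable set0 Q.
  by apply: (@definable_sat _ _ set0 _ _ phi) => i; case: (e i).
have [D DP] := decided Pifc Piaut tpPi Pimax (fun i => sort_of (y i)) dQ.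
have PE v : P v <-> Q (juxt v y).
  rewrite H; apply: sat_eq => i; rewrite !tnth_mktuple /=.
  by case Ei: (e i) => [j|m] //=; rewrite /y Ei.
have := DP y (fun=> erefl).
have [Dy|nDy] := pselect (D y).
  have -> : (fun v => Q (juxt v y) <-> D y) = P; last by left.
  by apply/funext => v; apply/propext; rewrite PE; tauto.
have -> : (fun v => Q (juxt v y) <-> D y) = (fun v => ~ P v); last by right.
by apply/funext => v; apply/propext; rewrite PE; tauto.
Qed.

End InvariantTypes.

(** * Nonforking independence *)

Section Independence.
Variables (L : language) (M : structure L) (K : Type).
Hypotheses (hM : monster M K) (heq : eq_closed M) (stM : stable M).
Hypothesis hbase : acl (set0 : set M) `<=` dcl set0.
Implicit Types (A B : set M) (alpha beta : M -> M).

Definition realizes I (T : set ((I -> M) -> Prop)) A (v : I -> M) : Prop :=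
  forall P, definable A P -> T P -> P v.

Section OneType.
Variables (I : Type) (T : set ((I -> M) -> Prop)).
Hypothesis iT : invariant_type T.

Lemma it_not P : T P -> ~ T (fun v => ~ P v).
Proof.
move=> TP TnP; have [|v H] := it_consistent iT (l := [:: P; fun v => ~ P v]).
  by move=> _ [<-|[<-|//]].
have Pv := H P (or_introl erefl).
by case: (H _ (or_intror (or_introl erefl))).
Qed.

Lemma sub_realizes A B v : A `<=` B -> realizes T B v -> realizes T A v.
Proof. by move=> AB H P dP; apply: H; exact: sub_definable dP. Qed.

Lemma realizes_sort a A v : tp set0 a `<=` T -> realizes T A v ->
  forall i, sort_of (v i) = sort_of (a i).
Proof.
move=> aT rv i; apply: (rv (fun w => sort_of (w i) = sort_of (a i)));
  first exact: definable_sort.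
by apply: aT; split=> //; exact: definable_sort.
Qed.

Lemma tp_realizes a v : tp set0 a `<=` T -> (forall P, definable set0 P -> P a ->
  P v) ->
  realizes T set0 v.
Proof.
move=> aT av P dP TP; apply: av => //; apply: contrapT => nPa.
by apply: (it_not TP); apply: aT; split=> //; exact: definableN.
Qed.

Lemma aut_realizes alpha A v : automorphism alpha -> realizes T A v ->
  realizes T (alpha @` A) (alpha \o v).
Proof.
move=> aa rv P dP TP; apply: (rv (fun w => P (alpha \o w))).
  exact: definable_aut.
exact: it_aut iT _ _ aa TP.
Qed.

End OneType.

(** A complete type leaves only one type over A to its realizations. *)
Lemma realizes_conj (I : countType) T A (v w : I -> M) : invariant_type T ->
  countable A ->
  realizes T A v -> realizes T A w ->
  exists alpha, [/\ automorphism alpha, fixes alpha A & forall i,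
    alpha (v i) = w i].
Proof.
move=> iT cA rv rw; apply: (homogeneous hM).
  apply: (countable_small hM); apply: countableU => //; exact: countable_range.
move=> P dP Pv; apply: rw => //.
have [//|TnP] : T P \/ T (fun v => ~ P v) by apply: it_complete iT _ _;
  exact: sub_definable dP.
by case: (rv _ (definableN dP) TnP).
Qed.

Lemma realize n (a : 'I_n -> M) T A : invariant_type T -> tp set0 a `<=` T ->
  countable A -> exists v, realizes T A v.
Proof.
move=> iT aT cA.
have [|l lT|v [_ vP]] := @saturation _ _ _ hM _ A (fun i => sort_of (a i))
  [set P | definable A P /\ T P] cA; last by exists v => P dP TP; exact: vP.
- by move=> P [].
pose f i : ('I_n -> M) -> Prop := fun v => sort_of (v i) = sort_of (a i).
have [|v vP] := it_consistent iT (l := map f (enum 'I_n) ++ l).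
  move=> P Pl; have [/List.in_map_iff[i [<- _]]|/lT[]//] := List.in_app_or _ _ _ Pl.
  by apply: aT; split=> //; exact: definable_sort.
exists v; split=> [i|P Pl]; last by apply: vP; apply: List.in_or_app; right.
apply: (vP (f i)); apply: List.in_or_app; left; apply: List.in_map.
by apply: mem_In; rewrite mem_enum.
Qed.

Lemma it_move n k T B (Q : ('I_n + 'I_k -> M) -> Prop) c c' :
  invariant_type T -> definable B Q ->
  (exists alpha, [/\ automorphism alpha, fixes alpha B & forall i,
    alpha (c i) = c' i]) ->
  T (fun v => Q (juxt v c)) -> T (fun v => Q (juxt v c')).
Proof.
move=> iT dQ [alpha [aa fB ac]] TQ; have [beta [ab aK bK]] := aut_inv aa.
have := it_aut iT ab TQ.
have -> // : (fun v => Q (juxt (beta \o v) c)) = (fun v => Q (juxt v c')).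
apply/funext => v; apply/propext; rewrite -(aut_definable _ aa fB dQ).
have -> // : alpha \o juxt (beta \o v) c = juxt v c'.
by apply/funext => -[] i /=; [rewrite bK|rewrite ac].
Qed.

Lemma definable_juxt_r n k A (Q : ('I_n + 'I_k -> M) -> Prop) c :
  definable A Q -> definable (range c `|` A) (fun v => Q (juxt v c)).
Proof.
move=> dQ; have H := @definable_subst _ _ A (range c `|` A) 'I_n _ (fun z : 'I_n
  + 'I_k =>
  match z with inl i => inl i | inr j => inr (c j) end) Q _ _ dQ.
apply: eq_definable (H _ _) => [v|[]//|m Am]; last by right.
  have -> // : ev v \o (fun z : 'I_n + 'I_k =>
    match z with inl i => inl i | inr j => inr (c j) end) = juxt v c.
  by apply/funext => -[].
by move=> j /=; left; exists j.
Qed.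

Definition swap I J (z : I + J) : J + I :=
  match z with inl i => inr i | inr j => inl j end.

Lemma juxt_swap I J (x : I -> M) (y : J -> M) : juxt y x \o @swap I J = juxt x y.
Proof. by apply/funext => -[]. Qed.

Lemma definable_swap n k A (Q : ('I_n + 'I_k -> M) -> Prop) : definable A Q ->
  definable A (fun w => Q (w \o @swap 'I_n 'I_k)).
Proof. exact: definable_comp. Qed.

Lemma definable_juxt_l n k A (Q : ('I_n + 'I_k -> M) -> Prop) a :
  definable A Q -> definable (range a `|` A) (fun w => Q (juxt a w)).
Proof.
move=> /definable_swap/(definable_juxt_r a); apply: eq_definable => w.
by rewrite juxt_swap.
Qed.

Definition range_of I (l : seq (I -> M)) : set M :=
  [set m | exists2 v, List.In v l & range v m].

Lemma countable_range_of (I : countType) (l : seq (I ->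
  M)) : countable (range_of l).
Proof.
elim: l => [|v l IH].
  by rewrite (_ : range_of _ = set0) //; apply/seteqP; split=> // m [].
have -> : range_of (v :: l) = range v `|` range_of l.
  apply/seteqP; split=> m; first by move=> [w [<-|wl] wm]; [left|right; exists w].
  by move=> [vm|[w wl wm]]; [exists v => //; left|exists w => //; right].
by apply: countableU => //; exact: countable_range.
Qed.

(* Harrington's symmetry, from an alternating sequence of realizations. *)
Lemma invariant_types_commute n k (a : 'I_n -> M) (c : 'I_k -> M) T R B
    (Q : ('I_n + 'I_k -> M) -> Prop) :
  invariant_type T -> invariant_type R -> tp set0 a `<=` T -> tp set0 c `<=` R ->
  countable B -> realizes T B a -> realizes R B c -> definable B Q ->
  (T (fun v => Q (juxt v c)) <-> R (fun w => Q (juxt a w))).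
Proof.
move=> iT iR aT cR cB ra rc.
have core (Q' : ('I_n + 'I_k -> M) -> Prop) : definable B Q' ->
    T (fun v => Q' (juxt v c)) -> R (fun w => Q' (juxt a w)).
  move=> dQ TQ; apply: contrapT => nRQ.
  have RnQ : R (fun w => ~ Q' (juxt a w)).
    have [|/nRQ//|//] := it_complete iR (P := fun w => Q' (juxt a w)) _.
    exact: sub_definable (definable_juxt_l a dQ).
  (* x_i realizes T over the y_j with j < i, and y_i realizes R over the x_j with j <= i. If the two
     types disagreed on Q', then Q'(x_i, y_j) would hold exactly for j < i. *)
  have [|f fP] := @dependent_sequence (('I_n -> M) * ('I_k -> M))
    (fun t => realizes T B t.1 /\ realizes R B t.2)
    (fun l t => realizes T (range_of (map snd l) `|` B) t.1 /\
                realizes R (range_of (t.1 :: map fst l) `|` B) t.2).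
    move=> l _.
    have [|v rv] := realize iT aT (A := range_of (map snd l) `|` B).
      by apply: countableU => //; exact: countable_range_of.
    have [|w rw] := realize iR cR (A := range_of (v :: map fst l) `|` B).
      by apply: countableU => //; exact: countable_range_of.
    exists (v, w); split=> //; split=> /=;
      [apply: sub_realizes rv|apply: sub_realizes rw];
      by move=> m; right.
  pose x i := (f i).1; pose y i := (f i).2.
  have rx i : realizes T B (x i) by have [[]] := fP i.
  have ry i : realizes R B (y i) by have [[]] := fP i.
  have later i j : j < i -> Q' (juxt (x i) (y j)).
    move=> ji; have [_ [rxi _]] := fP i.
    apply: (rxi (fun v => Q' (juxt v (y j)))).
      apply: sub_definable (definable_juxt_r (y j) dQ) => m [ym|Bm]; last by right.
      left; exists (y j) => //; apply: (List.in_map snd).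
      by apply/In_mkseq; exists j.
    by apply: it_move iT dQ _ TQ; exact: realizes_conj (ry j).
  have earlier i j : i <= j -> ~ Q' (juxt (x i) (y j)).
    move=> ij; have [_ [_ ryj]] := fP j.
    apply: (ryj (fun w => ~ Q' (juxt (x i) w))).
      apply: definableN; apply: sub_definable (definable_juxt_l (x i) dQ) =>
        m [xm|Bm]; last by right.
      left; exists (x i) => //; move: ij; rewrite leq_eqVlt => /orP[/eqP ->|ij];
        first by left.
      by right; apply: (List.in_map fst); apply/In_mkseq; exists i.
    have -> : (fun w => ~ Q' (juxt (x i) w)) =
        (fun w => ~ Q' (juxt w (x i) \o @swap 'I_n 'I_k)).
      by apply/funext => w; rewrite juxt_swap.
    apply: (it_move (c := a) iR (definableN (definable_swap dQ))).
      exact: realizes_conj (rx i).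
    suff <- : (fun w => ~ Q' (juxt a w)) =
        (fun w => ~ Q' (juxt w a \o @swap 'I_n 'I_k)) by [].
    by apply/funext => w; rewrite juxt_swap.
  apply: (stable_definable (s := fun i => sort_of (c i)) (t :=
    fun i => sort_of (a i))
    stM (definable_swap dQ)).
  exists (fun j => exist _ (y j) (realizes_sort cR (ry j))),
         (fun i => exist _ (x i) (realizes_sort aT (rx i))) => j i /=.
  rewrite juxt_swap; split=> [Qij|/later //].
  by case: ltnP => // /earlier.
move=> dQ; split; first exact: core.
move=> RQ; have [|//|TnQ] := it_complete iT (P := fun v => Q (juxt v c)) _.
  exact: sub_definable (definable_juxt_r c dQ).
case: (it_not iR RQ).
exact: (core (fun z => ~ Q z) (definableN dQ) TnQ).
Qed.

Lemma eqtp_aut alpha n B (v w : n.-tuple M) : automorphism alpha -> fixes alpha B ->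
  (forall i, alpha (tnth v i) = tnth w i) -> eqtp B v w.
Proof.
move=> aa fB vw q phi x y xy; rewrite -(aut_sat phi _ aa); apply: sat_eq => i.
rewrite tnth_map; have [[j _ [<- <-]]|[m Bm [<- <-]]] := xy i; first exact: vw.
exact: fB.
Qed.

Lemma eqtp_definable n B (v w : n.-tuple M) : eqtp B v w ->
  forall P, definable B P -> P (tnth v) -> P (tnth w).
Proof.
move=> vw P [q [phi [e [eB H]]]]; rewrite !H; apply: (vw q phi _ _ _).1 => i.
rewrite !tnth_mktuple; have := eB i.
case: (e i) => [j _|m Bm] /=; first by left; exists j.
by right; exists m.
Qed.

Lemma eqtp_conj n B (v w : n.-tuple M) : small K (coords v `|` B) -> eqtp B v w ->
  exists alpha, [/\ automorphism alpha, fixes alpha B & map_tuple alpha v = w].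
Proof.
move=> sB vw; have [alpha [aa fB aE]] := homogeneous hM sB (eqtp_definable vw).
exists alpha; split=> //; apply: eq_from_tnth => i; by rewrite tnth_map aE.
Qed.

(** If a formula of T were covered by finitely many dividing formulas, T would contain one of these
    by completeness and all its conjugate instances by invariance; T being consistent, no k of them
    are inconsistent. *)
Lemma realizes_indep n (a : n.-tuple M) T B : invariant_type T ->
  realizes T B (tnth a) -> indep a B.
Proof.
move=> iT ra theta; rewrite set0U => tB ta [s [sdiv cov]].
pose pred_of (psi : pformula M n) : ('I_n -> M) -> Prop :=
  fun v => psat psi [tuple v i | i < n].
have pred_def psi : definable setT (pred_of psi).
  exact: (psat_definable (A := setT)).
have Ta : T (pred_of theta).
  have [//|Tn] := it_complete iT (pred_def theta).
  have := ra _ (definableN (psat_definable tB)) Tn.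
  suff -> : [tuple tnth a i | i < n] = a by [].
  by apply: eq_from_tnth => i; rewrite tnth_mktuple.
have [psi [psis Tpsi]] : exists psi, List.In psi s /\ T (pred_of psi).
  apply: contrapT => nT.
  have [|v vP] := it_consistent iT
      (l := pred_of theta :: map (fun psi v => ~ pred_of psi v) s).
    move=> _ [<- //|/List.in_map_iff[psi [<- psis]]].
    have [Tpsi|//] := it_complete iT (pred_def psi).
    by case: nT; exists psi.
  have [|psi [psis psiv]] := cov [tuple v i | i < n].
    by apply: (vP (pred_of theta)); left.
  apply: (vP (fun v => ~ pred_of psi v)) => //; right.
  exact: (List.in_map (fun psi v => ~ pred_of psi v)).
have [b [bE [k kinc]]] := sdiv psi psis.
have Tb i : T (pred_of (PFormula (pform psi) (b i))).
  have [|alpha [aa _ aE]] := eqtp_conj (B := set0) _ (bE i).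
    by apply: (countable_small hM); apply: countableU => //; exact: countable_range.
  have := it_aut iT aa Tpsi.
  suff -> : (fun v => pred_of psi (alpha \o v)) = pred_of (PFormula (pform psi)
    (b i)) by [].
  apply/funext => v; apply/propext; rewrite /pred_of /psat /=.
  rewrite -[X in _ <-> X](aut_sat _ _ aa) -aE; apply: sat_eq => j.
  rewrite [RHS]tnth_map; case: (split_ordP j) => j' ->.
    by rewrite !tnth_lshift !tnth_mktuple.
  by rewrite !tnth_rshift tnth_map.
apply: (kinc (fun i : 'I_k => val i) val_inj).
have [|v vP] := it_consistent iT
    (l := map (fun i : 'I_k => pred_of (PFormula (pform psi) (b (val i)))) (enum
      'I_k)).
  by move=> _ /List.in_map_iff[i [<- _]].
exists [tuple v i | i < n] => i.
apply: (vP (pred_of (PFormula (pform psi) (b (val i))))).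
apply: (List.in_map (fun i : 'I_k => pred_of (PFormula (pform psi) (b (val i))))).
by apply: mem_In; rewrite mem_enum.
Qed.

End Independence.

(** * Independence as realization of the invariant type, and the resulting calculus *)

Section Forking.
Variables (L : language) (M : structure L) (K : Type).
Hypotheses (hM : monster M K) (heq : eq_closed M) (stM : stable M).
Hypothesis hbase : acl (set0 : set M) `<=` dcl set0.
Implicit Types (A B : set M) (alpha beta : M -> M).

Section MorleySequence.
Variables (d : nat) (R : set (('I_d -> M) -> Prop)).
Hypothesis iR : invariant_type R.

Definition before (b : nat -> 'I_d -> M) i : set M := range_of (mkseq b i).

(** After an automorphism has matched the first N terms, invariance of R puts the image of b_N and
    c_N in the same type over them, and a second automorphism corrects the last term. *)
Lemma morley_conj_prefix b c N :
  (forall i, i < N -> realizes R (before b i) (b i)) ->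
  (forall i, i < N -> realizes R (before c i) (c i)) ->
  exists alpha, automorphism alpha /\ forall i j, i < N -> alpha (b i j) = c i j.
Proof.
move=> mb mc; elim: N mb mc => [|N IH] mb mc; first by exists id; split=> //;
  exact: aut_id.
have [||alpha [aa ab]] := IH.
- by move=> i iN; apply: mb; exact: ltnW.
- by move=> i iN; apply: mc; exact: ltnW.
have E : alpha @` before b N = before c N.
  apply/seteqP; split=> [_ [_ [v /In_mkseq[i iN ->] [j _ <-]] <-]|_ [v
    /In_mkseq[i iN ->] [j _ <-]]].
    by rewrite ab //; exists (c i); [apply/In_mkseq; exists i|exists j].
  exists (b i j); last exact: ab.
  by exists (b i); [apply/In_mkseq; exists i|exists j].
have := aut_realizes iR aa (mb N (ltnSn N)); rewrite E => rb.
have [|beta [ab' fb be]] := realizes_conj hM iR _ rb (mc N (ltnSn N)).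
  exact: countable_range_of.
exists (beta \o alpha); split=> [|i j]; first exact: aut_comp.
rewrite ltnS leq_eqVlt => /orP[/eqP ->|iN] /=; first exact: be.
by rewrite ab // fb //; exists (c i); [apply/In_mkseq; exists i|exists j].
Qed.

Lemma morley_conj b c :
  (forall i, realizes R (before b i) (b i)) ->
  (forall i, realizes R (before c i) (c i)) ->
  exists alpha, automorphism alpha /\ forall i j, alpha (b i j) = c i j.
Proof.
move=> mb mc.
have [||alpha [aa _ aE]] := @homogeneous _ _ _ hM (nat * 'I_d)%type set0
    (fun z => b z.1 z.2) (fun z => c z.1 z.2).
- by apply: (countable_small hM); apply: countableU => //; exact: countable_range.
- move=> P dP Pb; have [l lP] := definable_support dP.
  have [N NP] : exists N, forall z, List.In z l -> z.1 < N.
    elim: l {lP} => [|z l [N NP]]; first by exists 0.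
    exists (maxn z.1.+1 N) => u [<-|/NP uN]; first by rewrite leq_max leqnn.
    by rewrite leq_max uN orbT.
  have [alpha [aa aE]] := @morley_conj_prefix b c N (fun i _ => mb i) (fun i _ =>
    mc i).
  apply: (lP (fun z => alpha (b z.1 z.2))); first by move=> z /NP; exact: aE.
  exact/(aut_definable (fun z : nat * 'I_d => b z.1 z.2) aa (fun x =>
    False_ind _) dP).
by exists alpha; split=> // i j; exact: (aE (i, j)).
Qed.

End MorleySequence.

(* If theta(x,b) is not in the invariant extension T of tp(a), then theta(x,b),
   together with finitely many formulas of tp(a), divides along a Morley
   sequence in tp(b): otherwise some realization of tp(a) satisfies theta(x,b_i)
   for all i, and conjugating the sequences that turn generic over it at the
   j-th step yields the order property. *)
Lemma indep_realizes n (a : n.-tuple M) T B : invariant_type T ->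
  tp set0 (tnth a) `<=` T -> indep a B -> realizes T B (tnth a).
Proof.
move=> iT aT ind P dP TP; apply: contrapT => nPa.
have [theta [tB tE]] := definable_psat (definableN dP).
pose d := pdim theta; pose b := tnth (params theta).
pose Q (w : 'I_n + 'I_d -> M) :=
  sat (pform theta) [tuple w (fintype.split i) | i < n + d].
have dQ : definable set0 Q.
  exact: (definable_comp (@fintype.split n d) (formula_definable M (pform theta))).
have QE (x : n.-tuple M) (y : d.-tuple M) :
    Q (juxt (tnth x) (tnth y)) <-> sat (pform theta) [tuple of x ++ y].
  apply: sat_eq => i; rewrite tnth_mktuple; case: (split_ordP i) => j ->.
    by rewrite tnth_lshift.
  by rewrite tnth_rshift.
have TnQ : ~ T (fun v => Q (juxt v b)).
  suff -> : (fun v => Q (juxt v b)) = (fun v => ~ P v) by exact: (it_not iT TP).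
  apply/funext => v; apply/propext.
  have -> : v = tnth [tuple v i | i < n] by apply/funext => i; rewrite tnth_mktuple.
  exact: iff_trans (QE _ (params theta)) (tE _).
have [R [iR bR]] := invariant_extension hM heq stM hbase b.
have rb : realizes R set0 b by apply: (tp_realizes iR bR).
have [f0 fP] := @dependent_sequence ('I_d -> M) (fun=> True)
  (fun l w => realizes R (range_of l) w)
  (fun l _ => let: ex_intro w rw := realize hM iR bR (countable_range_of l) in
    ex_intro _ w (conj I rw)).
have mf i : realizes R (before f0 i) (f0 i) by have [] := fP i.
(* The number of instances is [k.+1] because at least one of them is needed to recover the formulas
   of l from their conjunction with theta. *)
have [[l [k [lE kinc]]]|ndiv] := pselect (exists (l : seq (formula L n)) k,
    (forall phi, List.In phi l -> sat phi a) /\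
    forall J : 'I_k.+1 -> nat, injective J -> ~ exists x : n.-tuple M,
      (forall phi, List.In phi l -> sat phi x) /\
      forall i, Q (juxt (tnth x) (f0 (J i)))).
  pose big := foldr (fun phi psi =>
    FAnd (rename phi (@lshift n d)) psi) (pform theta) l.
  have bigE (x : n.-tuple M) (y : d.-tuple M) : sat big [tuple of x ++ y] <->
      (forall phi, List.In phi l -> sat phi x) /\
        sat (pform theta) [tuple of x ++ y].
    rewrite /big {lE kinc big}; elim: l => [|phi l IH] /=.
      by split=> [|[]].
    have E : sat (rename phi (@lshift n d)) [tuple of x ++ y] <-> sat phi x.
      rewrite sat_rename; apply: sat_eq => i.
      by rewrite tnth_mktuple tnth_lshift.
    rewrite E IH; split=> [[Hp [Hl Ht]]|[H Ht]].
      by split=> // psi [<-|/Hl].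
    split; first by apply: H; left.
    by split=> // psi psil; apply: H; right.
  apply: (ind (PFormula big (params theta))).
  - by rewrite set0U.
  - by apply/bigE; split=> //; apply/tE.
  exists [:: PFormula big (params theta)]; split; last first.
    by move=> x xP; exists (PFormula big (params theta)); split=> //; left.
  move=> _ [<-|//]; exists (fun i => mktuple (f0 i)); split=> [i|].
    have rfi : realizes R set0 (f0 i).
      by apply: sub_realizes (mf i).
    have [alpha [aa fa aE]] := realizes_conj hM iR (@countable0 M) rfi rb.
    by apply: (eqtp_aut aa) => // j; rewrite tnth_mktuple aE.
  exists k.+1 => J Jinj [x xP]; apply: (kinc J Jinj); exists x.
  split=> [phi phil|i]; last first.
    have /bigE[_ /QE] := xP i.
    suff -> : tnth (mktuple (f0 (J i))) = f0 (J i) by [].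
    by apply/funext => j; rewrite tnth_mktuple.
  by have /bigE[+ _] := xP ord0; exact.
(* The indices that failure of dividing provides are arbitrary. Sorted, they give a subsequence that
   is again a Morley sequence, and an automorphism carries it to the initial segment of [f0]. *)
have step l k : (forall phi, List.In phi l -> sat phi a) -> exists x : n.-tuple M,
    (forall phi, List.In phi l -> sat phi x) /\
      forall i, i < k -> Q (juxt (tnth x) (f0 i)).
  move=> la.
  have [J [Jinj [x [xl xJ]]]] : exists J : 'I_k.+1 -> nat, injective J /\
      exists x : n.-tuple M, (forall phi, List.In phi l -> sat phi x) /\
      forall i, Q (juxt (tnth x) (f0 (J i))).
    apply: contrapT => nJ; apply: ndiv; exists l, k; split=> // J Jinj Jx.
    by apply: nJ; exists J.
  pose js := sort leq (map J (enum 'I_k.+1)).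
  have js_sz : size js = k.+1 by rewrite size_sort size_map size_enum_ord.
  have js_uniq : uniq js by rewrite sort_uniq map_inj_uniq // enum_uniq.
  have js_sorted : sorted ltn js.
    by rewrite ltn_sorted_uniq_leq js_uniq sort_sorted //; exact: leq_total.
  pose s i := nth 0 js i.
  have s_mono i j : i < j -> j < k.+1 -> s i < s j.
    move=> ij jk; apply: (sorted_ltn_nth ltn_trans) => //; rewrite inE js_sz //.
    exact: ltn_trans ij jk.
  have [||alpha [aa aE]] := morley_conj_prefix iR (b := f0 \o s) (c := f0) (N :=
    k.+1).
  - move=> i ik; apply: sub_realizes (mf (s i)) => m [v /In_mkseq[j ji ->] vm].
    by exists (f0 (s j)) => //; apply/In_mkseq; exists (s j) => //; exact: s_mono.
  - by move=> i _; exact: mf.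
  exists (map_tuple alpha x); split=> [phi phil|i ik].
    by apply/aut_sat => //; exact: xl.
  have : s i \in js by apply: mem_nth; rewrite js_sz ltnW.
  rewrite mem_sort => /mapP[i' _ si].
  have := xJ i'; rewrite -si -(aut_definable _ aa (fun x => False_ind _) dQ).
  suff -> : alpha \o juxt (tnth x) (f0 (s i)) = juxt (tnth (map_tuple alpha x))
    (f0 i) by [].
  apply/funext => -[j|j] /=; first by rewrite tnth_map.
  by rewrite (aE i j) // ltnW.
have [a' [a'S a'T a'Q]] : exists a' : 'I_n -> M,
    [/\ forall i, sort_of (a' i) = sort_of (tnth a i), realizes T set0 a' &
        forall i, Q (juxt a' (f0 i))].
  pose Pi : set (('I_n -> M) -> Prop) := tp set0 (tnth a) `|`
    range (fun i v => Q (juxt v (f0 i))).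
  have [|||v [sv vP]] := @saturation _ _ _ hM _ (range (fun z : nat * 'I_d =>
    f0 z.1 z.2))
     (fun i => sort_of (tnth a i)) Pi.
  - exact: countable_range.
  - move=> S [[dS _]|[i _ <-]]; first by apply: sub_definable dS.
    apply: sub_definable (definable_juxt_r (f0 i) dQ) => m [[j _ <-]|//].
    by exists (i, j).
  - move=> l lP.
    have [lphi [k [la lk]]] : exists (lphi : seq (formula L n)) k,
        (forall phi, List.In phi lphi -> sat phi a) /\ forall x : n.-tuple M,
        (forall phi, List.In phi lphi -> sat phi x) ->
        (forall i, i < k -> Q (juxt (tnth x) (f0 i))) ->
        forall S, List.In S l -> S (tnth x).
      elim: l lP => [|S l IH] lP; first by exists [::], 0.
      have [|lphi [k [la lk]]] := IH; first by move=> S' Sl; apply: lP; right.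
      have [[dS Sa]|[i _ SE]] := lP S (or_introl erefl).
        have [phi phiE] := definable_formula dS.
        exists (phi :: lphi), k; split=> [psi [<-|/la //]|x xl xk S' [<-|Sl]].
        + exact/phiE.
        + by apply/phiE/xl; left.
        + by apply: lk => // psi psil; apply: xl; right.
      exists lphi, (maxn i.+1 k); split=> // x xl xk S' [<-|Sl].
        by rewrite -SE; apply: xk; rewrite leq_max leqnn.
      by apply: lk => // j jk; apply: xk; rewrite leq_max jk orbT.
    have [sphi sphiE] : exists lphi : seq (formula L n),
        forall x : n.-tuple M, (forall phi, List.In phi lphi -> sat phi x) <->
          forall i, sort_of (tnth x i) = sort_of (tnth a i).
      have /choice [g gE] : forall i : 'I_n, exists phi : formula L n,
        forall x : n.-tuple M,
          sat phi x <-> sort_of (tnth x i) = sort_of (tnth a i).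
        by move=> i; exact: definable_formula (definable_sort _ _ _).
      exists (map g (enum 'I_n)) => x;
        split=> [H i|H phi /List.in_map_iff[i [<- _]]].
        apply/gE/H; apply: List.in_map; apply: mem_In.
        by rewrite mem_enum.
      exact/gE.
    have [|x [xl xk]] := step (lphi ++ sphi) k.
      move=> phi pl; have [/la//|] := List.in_app_or _ _ _ pl.
      by move: phi {pl}; apply/sphiE.
    exists (tnth x); split.
      by apply/sphiE => phi pl; apply: xl; apply: List.in_or_app; right.
    by apply: lk => // phi pl; apply: xl; apply: List.in_or_app; left.
  exists v; split=> //; last first.
    by move=> i; apply: (vP (fun v => Q (juxt v (f0 i)))); right; exists i.
  by apply: (tp_realizes iT aT) => S dS Sa; apply: vP; left.
(* [a'] satisfies all instances along [f0], yet by commutation a generic realization of R over [a']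
   does not, as Q(v, b) is not in T. *)
have RnQ : R (fun w => ~ Q (juxt a' w)).
  have [|RQ|//] := it_complete iR (P := fun w => Q (juxt a' w)) _.
    exact: sub_definable (definable_juxt_l a' dQ).
  case: TnQ.
  have a'sub : tp set0 a' `<=` T.
    move=> S [dS Sa]; have [//|TnS] :=
      it_complete iT (sub_definable (@sub0set _ setT) dS).
    by case: (a'T _ (definableN dS) TnS).
  exact/(invariant_types_commute hM stM iT iR a'sub bR (@countable0 M) a'T rb dQ).
have /choice [c cP] : forall j, exists c : nat -> 'I_d -> M,
    [/\ forall i, realizes R (before c i) (c i), forall i, i < j -> c i = f0 i &
        forall i, j <= i -> ~ Q (juxt a' (c i))].
  move=> j.
  have [l _|c cP] := @dependent_sequence ('I_d -> M) (fun=> True)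
    (fun l w => if size l < j then w = f0 (size l)
                else realizes R (range a' `|` range_of l) w).
    case: ltnP => _; first by exists (f0 (size l)).
    have [|w rw] := realize hM iR bR (A :=
      range a' `|` range_of l); last by exists w.
    by apply: countableU; [exact: countable_range|exact: countable_range_of].
  have small i : i < j -> c i = f0 i.
    by move=> ij; have [_] := cP i; rewrite size_mkseq ij.
  have large i : j <= i -> realizes R (range a' `|` before c i) (c i).
    by move=> ji; have [_] := cP i; rewrite size_mkseq ltnNge ji.
  exists c; split=> // i; last first.
    move=> /large rc; apply: (rc (fun w => ~ Q (juxt a' w))) => //.
    apply: definableN; apply: sub_definable (definable_juxt_l a' dQ) => m [?|//].
    by left.
  have [ij|ji] := ltnP i j; last by apply: sub_realizes (large i ji) => m; right.
  rewrite small //; apply: sub_realizes (mf i) => m [v /In_mkseq[l li ->] vm].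
  exists (f0 l); first by apply/In_mkseq; exists l.
  by rewrite -small // (ltn_trans li).
have /choice [g gP] : forall j, exists alpha, automorphism alpha /\
    forall i l, alpha (c j i l) = f0 i l.
  by move=> j; have [mc _ _] := cP j; exact: morley_conj iR _ _ mc mf.
have sf i : sorted_by (fun l => sort_of (b l)) (f0 i).
  exact: realizes_sort bR (mf i).
have sa j : sorted_by (fun l => sort_of (tnth a l)) (g j \o a').
  by move=> l; have [aa _] := gP j; rewrite /= aut_sort.
apply: (stable_definable (s := fun l => sort_of (b l)) (t :=
  fun l => sort_of (tnth a l))
  stM (definable_swap dQ)).
exists (fun i => exist _ (f0 i) (sf i)),
  (fun j => exist _ (g j \o a') (sa j)) => i j /=.
have [aa gE] := gP j; have [_ cs cl] := cP j.
rewrite juxt_swap.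
have -> : juxt (g j \o a') (f0 i) = g j \o juxt a' (c j i).
  by apply/funext => -[l|l] //=; rewrite gE.
rewrite (aut_definable _ aa (fun x => False_ind _) dQ).
split=> [Qij|ij]; last by rewrite cs.
by case: ltnP => // /cl.
Qed.

Lemma sub_indep n (a : n.-tuple M) A B : A `<=` B -> indep a B -> indep a A.
Proof.
move=> AB ind theta tA; apply: ind => m /tA; rewrite !set0U; exact: AB.
Qed.

Lemma indep_exists n (a : n.-tuple M) B : countable B ->
  exists e, eqtp set0 e a /\ indep e B.
Proof.
move=> cB; have [T [iT aT]] := invariant_extension hM heq stM hbase (tnth a).
have [v rv] := realize hM iT aT cB.
have ve : v = tnth [tuple v i | i < n] by apply/funext => i; rewrite tnth_mktuple.
rewrite ve in rv; exists [tuple v i | i < n]; split; last first.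
  exact: (realizes_indep hM iT rv).
have ra : realizes T set0 (tnth a) by apply: (tp_realizes iT aT).
have rv0 : realizes T set0 (tnth [tuple v i | i < n]) by apply: sub_realizes rv.
have [alpha [aa fa aE]] := realizes_conj hM iT (@countable0 M) rv0 ra.
exact: (eqtp_aut aa fa aE).
Qed.

(** With a realizing T over B and c realizing R over aB, a formula Q(v, c) of T corresponds by
    commutation to Q(a, w) in R, which c satisfies. *)
Lemma indep_flip n k (a : n.-tuple M) (c : k.-tuple M) B : countable B ->
  indep a B -> indep c (coords a `|` B) -> indep a (coords c `|` B).
Proof.
move=> cB aB caB.
have [T [iT aT]] := invariant_extension hM heq stM hbase (tnth a).
have [R [iR cR]] := invariant_extension hM heq stM hbase (tnth c).
have ra := indep_realizes iT aT aB; have rc := indep_realizes iR cR caB.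
apply: (realizes_indep hM iT) => P [q [phi [e [eA H]]]] TP.
have /choice [e' e'P] : forall i, exists x : ('I_n + 'I_k) + M, par_in B x /\
    forall v, ev v (e i) = ev (juxt v (tnth c)) x.
  move=> i; have := eA i; case: (e i) => [j _|m [[j _ <-]|Bm]].
  - by exists (inl (inl j)).
  - by exists (inl (inr j)).
  - by exists (inr m).
pose Q (w : 'I_n + 'I_k -> M) := sat phi [tuple ev w (e' i) | i < q].
have dQ : definable B Q by apply: definable_sat => i; have [] := e'P i.
have PQ v : P v <-> Q (juxt v (tnth c)).
  rewrite H; apply: sat_eq => i; rewrite !tnth_mktuple.
  by have [_ ->] := e'P i.
have TQ : T (fun v => Q (juxt v (tnth c))).
  suff <- : P = (fun v => Q (juxt v (tnth c))) by [].
  by apply/funext => v; apply/propext.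
have rcB : realizes R B (tnth c) by apply: sub_realizes rc => m; right.
apply/PQ/(rc (fun w => Q (juxt (tnth a) w))); first exact: definable_juxt_l.
exact/(invariant_types_commute hM stM iT iR aT cR cB ra rcB dQ).
Qed.

Lemma indep2_sym n k (a : n.-tuple M) (c : k.-tuple M) : indep2 a c -> indep2 c a.
Proof.
have [T [iT cT]] := invariant_extension hM heq stM hbase (tnth c).
have c0 : indep c set0.
  by apply: (realizes_indep hM iT); apply: (tp_realizes iT cT).
move=> ac; have := indep_flip (@countable0 M) c0; rewrite setU0 => /(_ _ a).
by rewrite setU0; exact.
Qed.

Lemma indep3_of n m k (a : n.-tuple M) (b : m.-tuple M) (c : k.-tuple M) :
  indep2 a b -> indep c (coords a `|` coords b) -> indep3 a b c.
Proof.
move=> ab cab; split=> //.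
  rewrite setUC; apply: indep_flip => //; exact: countable_range.
rewrite setUC; apply: indep_flip; [exact: countable_range|exact: indep2_sym|].
by rewrite setUC.
Qed.

End Forking.

(** * Definable closure under automorphisms, and the size of acl(c) *)

Section Closures.
Variables (L : language) (M : structure L) (K : Type).
Hypotheses (hM : monster M K).
Implicit Types (A B : set M) (alpha beta : M -> M).

Lemma sub_dcl A B : A `<=` B -> dcl A `<=` dcl B.
Proof.
by move=> AB x [theta [tA tx tu]]; exists theta; split=> // m /tA /AB.
Qed.

Lemma dcl_id A : A `<=` dcl A.
Proof.
move=> x Ax; apply: (@sub_dcl [set x]); first by move=> _ ->.
by apply: (fixed_dcl hM) => [|alpha _ ->] //; exact: countable1.
Qed.

Lemma dcl_trans A B : A `<=` dcl B -> dcl A `<=` dcl B.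
Proof.
move=> AB x [theta [tA tx tu]].
(* [fixed_dcl] needs a countable base, so B is first cut down to the parameters that define the
   finitely many parameters of theta. *)
have /choice [C CP] : forall i : 'I_(pdim theta), exists C : set M,
    [/\ C `<=` B, countable C & dcl C (tnth (params theta) i)].
  move=> i; have /AB[eta [eB et eu]] : A (tnth (params theta) i) by apply: tA;
    exists i.
  exists (coords (params eta)); split=> //; first exact: countable_range.
  by exists eta; split=> // m.
apply: (@sub_dcl (\bigcup_i C i)); first by move=> m [i _ Cm]; have [CB _ _] :=
  CP i; exact: CB.
apply: (fixed_dcl hM) => [|alpha aa fC].
  by apply: bigcup_countable => // i _; have [] := CP i.
apply: (@aut_dcl _ _ _ (coords (params theta))) => // [_ [i _ <-]|].
  have [_ _ dC] := CP i; apply: aut_dcl aa _ dC => m Cm.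
  by apply: fC; exists i.
by exists theta; split=> // m.
Qed.

Lemma aut_sub_dcl alpha A : automorphism alpha ->
  alpha @` dcl A `<=` dcl (alpha @` A).
Proof.
move=> aa _ [x [theta [tA tx tu]] <-].
have [beta [ab aK bK]] := aut_inv aa.
have dP := psat_definable tA.
have [|psi [pA pE]] := @definable1_psat _ _ (alpha @` A)
    (fun v => psat theta [tuple beta (v i) | i < 1]).
  apply: (definable_aut (alpha := beta) (A := alpha @` A)
    (P := fun v => psat theta [tuple v i | i < 1]) ab).
  apply: sub_definable dP => m Am; exists (alpha m); last by rewrite aK.
  by exists m.
have E y : [tuple beta y | i < 1] = [tuple beta y].
  by apply: eq_from_tnth => i; rewrite tnth_mktuple ord1.
exists psi; split=> // [|y].
  by apply/pE; rewrite E aK.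
by move=> /pE; rewrite E => /tu; move=> <-; rewrite bK.
Qed.

Lemma aut_dcl_image alpha A : automorphism alpha ->
  alpha @` dcl A = dcl (alpha @` A).
Proof.
move=> aa; apply/seteqP; split; first exact: aut_sub_dcl.
move=> x dx; have [beta [ab aK bK]] := aut_inv aa.
exists (beta x); last by rewrite bK.
have : (beta @` dcl (alpha @` A)) (beta x) by exists x.
move=> /(aut_sub_dcl ab); congr (dcl _ _); apply/seteqP; split.
  by move=> _ [_ [m Am <-] <-]; rewrite aK.
by move=> m Am; exists (alpha m); [exists m|rewrite aK].
Qed.

Lemma coords_map alpha n (v : n.-tuple M) : coords (map_tuple alpha v) = alpha @`
  coords v.
Proof.
apply/seteqP; split=> [_ [i _ <-]|_ [_ [i _ <-] <-]].
  by rewrite tnth_map; exists (tnth v i) => //; exists i.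
by exists i => //; rewrite tnth_map.
Qed.

Lemma fixes_image alpha A : fixes alpha A -> alpha @` A = A.
Proof.
move=> fA; apply/seteqP; split=> [_ [m Am <-]|m Am]; first by rewrite fA.
by exists m => //; exact: fA.
Qed.

Lemma coords_aclt n (c : n.-tuple M) : coords c `<=` aclt c.
Proof.
move=> x cx; apply: (finite_orbit_acl hM (X := [set x])).
- exact: countable_range.
- exact: finite_set1.
- by move=> alpha _ /(_ x cx).
Qed.

Lemma sub_acl A B : A `<=` B -> acl A `<=` acl B.
Proof.
by move=> AB x [theta [tA tx tu]]; exists theta; split=> // m /tA /AB.
Qed.

Lemma coords_cat n k (v : n.-tuple M) (w : k.-tuple M) :
  coords [tuple of v ++ w] = coords v `|` coords w.
Proof.
apply/seteqP; split=> [_ [i _ <-]|_ [[i _ <-]|[i _ <-]]].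
- case: (split_ordP i) => j ->; first by rewrite tnth_lshift; left; exists j.
  by rewrite tnth_rshift; right; exists j.
- by exists (lshift k i) => //; rewrite tnth_lshift.
- by exists (rshift n i) => //; rewrite tnth_rshift.
Qed.

(** Decoding for [small_aclt], where a rank is written as that many negations in the second
    conjunct. *)
Fixpoint negations n (phi : formula L n) : nat :=
  if phi is FNot _ psi then (negations psi).+1 else 0.

Definition conjuncts (phi : {n & formula L n}) : option {n & formula L n} * nat :=
  match phi with
  | existT _ (FAnd n phi psi) => (Some (existT _ n phi), negations psi)
  | _ => (None, 0) end.

(* An element of acl(c) is coded by an algebraic formula over c, padded with a
   conjunct that encodes its rank among the finitely many solutions. *)
Lemma small_aclt n (c : n.-tuple M) : small K (aclt c).
Proof.
have [+ _ _] := hM; apply: card_le_trans.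
pose sol (phi : formula L (1 + n)) := [set y | sat phi [tuple of [tuple y] ++ c]].
have /choice [Phi PhiP] : forall x, exists phi : formula L (1 + n), aclt c x ->
    sol phi x /\ finite_set (sol phi).
  move=> x; have [ax|nax] := pselect (aclt c x); last first.
    by exists (FEq L (lshift n ord0) (lshift n ord0)).
  have [theta [tc tx tfin]] := ax.
  have [q [phi [e [ec H]]]] := psat_definable tc.
  have /choice [g gE] : forall i, exists j : 'I_(1 + n), forall y,
      ev (fun=> y) (e i) = tnth [tuple of [tuple y] ++ c] j.
    move=> i; have := ec i; case: (e i) => [j _|_ [j _ <-]].
      by exists (lshift n j) => y; rewrite tnth_lshift ord1.
    by exists (rshift 1 j) => y; rewrite tnth_rshift.
  have E y : sol (rename phi g) y <-> psat theta [tuple y].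
    have -> : [tuple y] = [tuple (fun _ : 'I_1 => y) i | i < 1].
      by apply: eq_from_tnth => i; rewrite tnth_mktuple ord1.
    rewrite H /sol /= sat_rename; apply: sat_eq => i; rewrite !tnth_mktuple.
    by rewrite (gE i y).
  exists (rename phi g) => _; split; first exact/E.
  by apply: sub_finite_set tfin => y /E.
have /choice [r rP] : forall phi, exists r : M -> nat, finite_set (sol phi) ->
    {in sol phi &, injective r}.
  move=> phi; have [/finite_set_countable/countable_injP[r rP]|nf] :=
    pselect (finite_set (sol phi)).
    by exists r.
  by exists (fun=> 0).
pose code x : {n & formula L n} := existT _ (1 + n)
  (FAnd (Phi x) (iter (r (Phi x) x) (@FNot L (1 + n)) (FEq L (lshift n ord0)
    (lshift n ord0)))).
have neg_iter i : negations (iter i (@FNot L (1 + n)) (FEq L (lshift n ord0)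
  (lshift n ord0))) = i.
  by elim: i => //= i ->.
have code_inj : {in aclt c &, injective code}.
  move=> x y /[!inE] ax ay /(congr1 conjuncts); rewrite /= !neg_iter => -[E r_eq].
  have Exy := inj_pair2_eq_dec _ (@eq_comparable nat) (formula L) _ _ _ E.
  have [sx fx] := PhiP x ax; have [sy _] := PhiP y ay.
  rewrite -Exy in sy r_eq.
  by apply: (rP (Phi x)) => //; rewrite inE.
have := inj_card_eq code_inj.
by move=> /card_eqPle[_] /card_le_trans; apply; exact: card_leT.
Qed.

Lemma small_aclt_tuple n q (c : n.-tuple M) (v : 'I_q ->
  M) : small K (range v `|` aclt c).
Proof.
apply: card_le_trans (small_aclt [tuple of mktuple v ++ c]); apply: subset_card_le.
move=> m [vm|]; last by apply: sub_acl => x cx; rewrite coords_cat; right.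
apply: coords_aclt; rewrite coords_cat; left.
by have [i _ <-] := vm; exists i => //; rewrite tnth_mktuple.
Qed.

Lemma elementary_definable (R : set (M * M)) I A (v w : I -> M) : elementary R ->
  (forall i, R (v i, w i)) -> (forall m, A m -> R (m, m)) ->
  forall P, definable A P -> P v -> P w.
Proof.
move=> eR vw RA P [q [phi [e [eA H]]]]; rewrite !H; apply: (eR q phi _ _ _).1 => i.
rewrite !tnth_mktuple; have := eA i.
by case: (e i) => [j _|m] /=; [exact: vw|exact: RA].
Qed.

Lemma elementary_aut alpha (R : set (M * M)) : automorphism alpha ->
  (forall z, R z -> z.2 = alpha z.1) -> elementary R.
Proof.
move=> aa aR n phi v w vw; rewrite -(aut_sat phi v aa); apply: sat_eq => i.
by rewrite tnth_map -(aR _ (vw i)).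
Qed.

End Closures.

(** * The binding group and the action of F on Y_cd *)

Section Groupoid.
Variables (L : language) (M : structure L) (K : Type).
Hypotheses (hM : monster M K).
Variables (n m : nat) (b0 b1 : n.-tuple M) (G : groupoid_data M n m).
Hypothesis hG : generic_abelian b0 b1 G.
Implicit Types (a b c d e : n.-tuple M) (f g h s y z : m.-tuple M).
Implicit Types (A B : set M) (alpha beta : M -> M) (S : set (m.-tuple M)).

Let gr := ga_groupoid hG.

Lemma hom_init c d f : Hom G c d f -> Ob G c.
Proof. by move=> [Mf <- _]; exact: (init_ob gr Mf). Qed.

Lemma hom_ter c d f : Hom G c d f -> Ob G d.
Proof. by move=> [Mf _ <-]; exact: (ter_ob gr Mf). Qed.

Lemma gcompVK a b c f g : Hom G a b f -> Hom G c b g ->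
  gcomp G g (gcomp G (ginv G g) f) = f.
Proof.
move=> hf hg; rewrite (gcompA gr hf (ginv_hom gr hg) hg).
by rewrite (gcomp_invr gr hg) (gcomp_idl gr hf).
Qed.

Lemma gcompKV a b c f g : Hom G a b f -> Hom G b c g ->
  gcomp G (gcomp G g f) (ginv G f) = g.
Proof.
move=> hf hg; rewrite -(gcompA gr (ginv_hom gr hf) hf hg).
by rewrite (gcomp_invr gr hf) (gcomp_idr gr hg).
Qed.

Lemma gcompKK a b c f g : Hom G a b f -> Hom G a c g ->
  gcomp G (gcomp G g (ginv G f)) f = g.
Proof.
move=> hf hg; rewrite -(gcompA gr hf (ginv_hom gr hf) hg).
by rewrite (gcomp_invl gr hf) (gcomp_idr gr hg).
Qed.

Lemma gcomp_injr a b c f g g' : Hom G a b f -> Hom G b c g -> Hom G b c g' ->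
  gcomp G g f = gcomp G g' f -> g = g'.
Proof.
by move=> hf hg hg' E; rewrite -(gcompKV hf hg) E (gcompKV hf hg').
Qed.

Lemma binding_class d s : Hom G d d s -> binding G (conj_class G s).
Proof. by move=> hs; exists s => //; exists d => //; exact: hom_init hs. Qed.

Lemma mem_conj_class d s : Hom G d d s -> conj_class G s s.
Proof.
move=> hs; have hid := gid_hom gr (hom_init hs).
exists (gid G d); first by have [Mi Ei _] := hid; have [_ Es _] :=
  hs; split; rewrite ?Ei ?Es.
have E : ginv G (gid G d) = gid G d.
  by rewrite -[LHS](gcomp_idr gr (ginv_hom gr hid)) (gcomp_invl gr hid).
by rewrite E (gcomp_idr gr hs) (gcomp_idl gr hs).
Qed.

Lemma binding_at S d : binding G S -> Ob G d -> exists2 s, S s & Hom G d d s.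
Proof.
move=> [s0 [c oc hs0] <-] od.
have [f hf] := ga_connected hG oc od.
exists (gcomp G f (gcomp G s0 (ginv G f))).
  by exists f => //; have [Mf Ef _] := hf; have [_ Es _] :=
    hs0; split; rewrite ?Ef ?Es.
exact: (gcomp_hom gr (gcomp_hom gr (ginv_hom gr hf) hs0) hf).
Qed.

(** Both members of the class come from one s0 at an object c along f and f'. The loop f'^-1 h f at
    c commutes with s0 because vertex groups are abelian, and this is the claim transported along f
    and f'. *)
Lemma binding_natural S d d' h s s' : binding G S ->
  S s -> Hom G d d s -> S s' -> Hom G d' d' s' -> Hom G d d' h ->
  gcomp G h s = gcomp G s' h.
Proof.
move=> [s0 [c oc hs0] <-] [f [Mf fi] fs] hs [f' [Mf' fi'] fs'] hs' hh.
have s0i : ginit G s0 = c by case: hs0.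
have hf : Hom G c d f.
  split=> //; first by rewrite fi.
  have hf1 : Hom G c (gter G f) f by split=> //; rewrite fi.
  have hs1 := gcomp_hom gr (gcomp_hom gr (ginv_hom gr hf1) hs0) hf1.
  by rewrite fs in hs1; case: hs1 => _ <- _; case: hs.
have hf' : Hom G c d' f'.
  split=> //; first by rewrite fi'.
  have hf1 : Hom G c (gter G f') f' by split=> //; rewrite fi'.
  have hs1 := gcomp_hom gr (gcomp_hom gr (ginv_hom gr hf1) hs0) hf1.
  by rewrite fs' in hs1; case: hs1 => _ <- _; case: hs'.
have hfV := ginv_hom gr hf; have hf'V := ginv_hom gr hf'.
pose k := gcomp G (ginv G f') (gcomp G h f).
have hhf := gcomp_hom gr hf hh; have hk : Hom G c c k := gcomp_hom gr hhf hf'V.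
have f'k : gcomp G f' k = gcomp G h f by exact: (gcompVK hhf hf').
have kf : gcomp G k (ginv G f) = gcomp G (ginv G f') h.
  rewrite -(gcompA gr hfV hhf hf'V) -(gcompA gr hfV hf hh).
  by rewrite (gcomp_invr gr hf) (gcomp_idr gr hh).
rewrite -fs -fs' (gcompA gr (gcomp_hom gr hfV hs0) hf hh) -f'k.
rewrite -(gcompA gr (gcomp_hom gr hfV hs0) hk hf') (gcompA gr hfV hs0 hk).
rewrite (ga_abelian hG oc hs0 hk) -(gcompA gr hfV hk hs0) kf.
rewrite -(gcompA gr hh (gcomp_hom gr hf'V hs0) hf').
by rewrite -(gcompA gr hh hf'V hs0).
Qed.

Lemma map_tuple_cat alpha q k (v : q.-tuple M) (w : k.-tuple M) :
  map_tuple alpha [tuple of v ++ w] = [tuple of map_tuple alpha v ++ map_tuple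
    alpha w].
Proof. by apply: val_inj => /=; rewrite map_cat. Qed.

Lemma eqtp_ob a c : Ob G c -> eqtp set0 a c -> Ob G a.
Proof.
rewrite (ga_ob hG) /= => cb ac.
have small0 e : small K (coords e `|` set0).
  by apply: (countable_small hM); apply: countableU => //; exact: countable_range.
have [alpha [aa _ aE]] := eqtp_conj hM (small0 a) ac.
have [beta [ab _ bE]] := eqtp_conj hM (small0 c) cb.
apply: (eqtp_aut (alpha := beta \o alpha)) => // [|i]; first exact: aut_comp.
by rewrite -bE -aE !tnth_map.
Qed.

Lemma ob_aut alpha a : automorphism alpha -> Ob G a -> Ob G (map_tuple alpha a).
Proof.
move=> aa oa; have [beta [ab aK _]] := aut_inv aa.
apply: eqtp_ob oa _; apply: (eqtp_aut ab) => // i.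
by rewrite tnth_map aK.
Qed.

Lemma mor_aut alpha f : automorphism alpha -> Mor G f -> Mor G (map_tuple alpha f).
Proof.
move=> aa; have [so [Phi ->]] := ga_mor hG; move=> [sf fP]; split.
  rewrite -sf; apply: eq_from_tnth => i.
  by rewrite !(tnth_map (@sort_of L M)) tnth_map aut_sort.
by move=> phi /fP; rewrite aut_sat.
Qed.

Lemma hom_aut alpha c d f : automorphism alpha -> Hom G c d f ->
  Hom G (map_tuple alpha c) (map_tuple alpha d) (map_tuple alpha f).
Proof.
move=> aa hf; have [Mf fi ft] := hf; have Maf := mor_aut aa Mf.
have oc := hom_init hf; have od := hom_ter hf.
split=> //.
  have [phi phiE] := ga_init hG; apply/phiE => //; first exact: ob_aut.
  by rewrite -map_tuple_cat; apply/aut_sat => //; apply/phiE.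
have [phi phiE] := ga_ter hG; apply/phiE => //; first exact: ob_aut.
by rewrite -map_tuple_cat; apply/aut_sat => //; apply/phiE.
Qed.

Lemma comp_aut alpha a b c f g : automorphism alpha -> Hom G a b f -> Hom G b c g ->
  gcomp G (map_tuple alpha g) (map_tuple alpha f) = map_tuple alpha (gcomp G g f).
Proof.
move=> aa hf hg; have hgf := gcomp_hom gr hf hg.
have [Mf _ fb] := hom_aut aa hf; have [Mg gb _] := hom_aut aa hg.
have [Mgf _ _] := hom_aut aa hgf.
have [phi phiE] := ga_comp hG; apply/phiE => //; first by rewrite fb gb.
have <- : map_tuple alpha [tuple of g ++ f ++ gcomp G g f] = [tuple of map_tuple
  alpha g ++
    map_tuple alpha f ++ map_tuple alpha (gcomp G g f)].
  by apply: val_inj => /=; rewrite !map_cat.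
apply/aut_sat => //; apply/phiE => //.
- by case: hf.
- by case: hg.
- by case: hgf.
- by case: hf => _ _ ->; case: hg.
Qed.

Lemma map_tuple_fixed alpha q (v : q.-tuple M) A : fixes alpha A ->
  coords v `<=` A ->
  map_tuple alpha v = v.
Proof.
by move=> fA vA; apply: eq_from_tnth => i; rewrite tnth_map fA //; apply: vA;
  exists i.
Qed.

Lemma vertex_acl c s : Hom G c c s -> coords s `<=` aclt c.
Proof.
move=> hs _ [i _ <-].
apply: (finite_orbit_acl hM (X := \bigcup_(s in Hom G c c) coords s)).
- exact: countable_range.
- apply: bigcup_finite => [|s' _];
  first exact: (ga_finitary hG (hom_init hs) (hom_init hs)).
  exact: finite_image.
move=> alpha aa fc; exists (map_tuple alpha s); last by exists i => //;
  rewrite tnth_map.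
by have := hom_aut aa hs; rewrite (map_tuple_fixed fc).
Qed.

Lemma comp_dcl a b c f g : Hom G a b f -> Hom G b c g ->
  coords (gcomp G g f) `<=` dcl (coords g `|` coords f).
Proof.
move=> hf hg _ [i _ <-]; apply: (fixed_dcl hM).
  by apply: countableU; exact: countable_range.
move=> alpha aa fA; have := comp_aut aa hf hg.
rewrite (map_tuple_fixed (v := g) fA) => [|x]; last by left.
rewrite (map_tuple_fixed (v := f) fA) => [|x]; last by right.
by move=> {2}->; rewrite tnth_map.
Qed.

Lemma inv_hom_vertex c d f f' : Hom G c d f -> Hom G c d f' ->
  exists2 s, Hom G c c s &
  f' = gcomp G f s.
Proof.
move=> hf hf'; exists (gcomp G (ginv G f) f');
  first exact: (gcomp_hom gr hf' (ginv_hom gr hf)).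
by rewrite (gcompVK hf' hf).
Qed.

Local Notation Delta c f := (dcl (coords f `|` aclt c)).

(** Parallel morphisms differ by an element of the vertex group at c, which lies in acl(c) because
    it is finite. *)
Lemma sub_Delta c d f f' : Hom G c d f -> Hom G c d f' -> Delta c f' `<=` Delta c f.
Proof.
move=> hf hf'; have [s hs ->] := inv_hom_vertex hf hf'.
apply: (dcl_trans hM) => x [xc|xc]; last by apply: (dcl_id hM); right.
have := comp_dcl hs hf xc; apply: sub_dcl => u [uf|us]; first by left.
by right; exact: vertex_acl us.
Qed.

Lemma Delta_eq c d f f' : Hom G c d f -> Hom G c d f' -> Delta c f = Delta c f'.
Proof. by move=> hf hf'; apply/seteqP; split;
  [exact: (sub_Delta hf')|exact: (sub_Delta hf)]. Qed.

Lemma hom_Y c d f : Hom G c d f -> Y G c d f.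
Proof.
move=> hf; exists f; split=> // [x fx|]; first by apply: (dcl_id hM); left.
by apply: (eqtp_aut (aut_id M)) => [x _|i].
Qed.

Lemma Y_Delta c d f y : Hom G c d f -> Y G c d y ->
  coords y `<=` Delta c f /\ Delta c y = Delta c f.
Proof.
by move=> hf [f0 [hf0 yf0 _ ->]]; rewrite (Delta_eq hf hf0).
Qed.

Lemma Y_aut alpha c d f y : automorphism alpha -> fixes alpha (aclt c) ->
  Hom G c d f -> alpha @` Delta c f = Delta c f -> Y G c d y ->
  Y G c d (map_tuple alpha y).
Proof.
move=> aa fc hf aD Yy; have [yD Dy] := Y_Delta hf Yy.
have [f0 [hf0 _ yf0 _]] := Yy; exists f0; rewrite -(Delta_eq hf hf0).
split=> //.
- by rewrite coords_map -aD; exact: image_subset.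
- have [gamma [ag gc gE]] := eqtp_conj hM (small_aclt_tuple hM c (tnth y)) yf0.
  have [beta [ab aK _]] := aut_inv aa.
  apply: (eqtp_aut (alpha := gamma \o beta)) => [|x cx|i]; first exact: aut_comp.
    by rewrite /= -{1}(fc x cx) aK gc.
  by rewrite /= tnth_map aK -gE tnth_map.
have <- : alpha @` (coords y `|` aclt c) = coords (map_tuple alpha y) `|` aclt c.
  by rewrite image_setU coords_map (fixes_image fc).
by rewrite -aut_dcl_image // Dy.
Qed.

(** Any two elements of Y_cd are interdefinable over acl(c), so an elementary map over acl(c) is
    determined on Y_cd by one value. *)
Lemma aut_over_agree c d sigma sigma' y : Ob G c -> Ob G d ->
  Aut_over (Y G c d) (aclt c) sigma -> Aut_over (Y G c d) (aclt c) sigma' ->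
  Y G c d y -> sigma y = sigma' y -> forall z, Y G c d z -> sigma z = sigma' z.
Proof.
move=> oc od [_ el] [_ el'] Yy E z Yz.
have [f hf] := ga_connected hG oc od.
have [_ Dy] := Y_Delta hf Yy; have [zD _] := Y_Delta hf Yz; rewrite -Dy in zD.
have extend tau : elementary (\bigcup_(x in Y G c d) tgraph x (tau x) `|` id_on
  (aclt c)) ->
    exists alpha, [/\ automorphism alpha, fixes alpha (aclt c),
      map_tuple alpha y = tau y & map_tuple alpha z = tau z].
  move=> eltau.
  have [||alpha [aa fa aE]] := @homogeneous _ _ _ hM ('I_m + 'I_m)%type (aclt c)
    (juxt (tnth y) (tnth z)) (juxt (tnth (tau y)) (tnth (tau z))).
  - apply: card_le_trans (small_aclt_tuple hM c (tnth [tuple of y ++ z])).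
    apply: subset_card_le => x [[[i|i] _ <-]|]; last by right.
      by left; exists (lshift m i) => //; rewrite tnth_lshift.
    by left; exists (rshift m i) => //; rewrite tnth_rshift.
  - apply: (elementary_definable eltau) => [[i|i]|x cx] /=.
    + by left; exists y => //; exists i.
    + by left; exists z => //; exists i.
    + by right; exists x.
  exists alpha; split=> //; apply: eq_from_tnth => i; rewrite tnth_map.
    exact: (aE (inl i)).
  exact: (aE (inr i)).
have [alpha [aa fa ay az]] := extend _ el.
have [alpha' [aa' fa' ay' az']] := extend _ el'.
have [beta [ab aK bK]] := aut_inv aa'.
have E' : map_tuple (beta \o alpha) z = z.
  apply: map_tuple_fixed zD => x; apply: aut_dcl; first exact: aut_comp.
  move=> u [[i _ <-]|uc] /=; last by rewrite fa // -{1}(fa' u uc) aK.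
  have -> : alpha (tnth y i) = alpha' (tnth y i).
    have := congr1 (fun t => tnth t i) (etrans ay (etrans E (esym ay'))).
    by rewrite !tnth_map.
  by rewrite aK.
rewrite -az -az'; apply: eq_from_tnth => i; rewrite !tnth_map.
by rewrite -[in RHS]E' tnth_map /= bK.
Qed.

Variable F : extended_binding G.
Implicit Types (mu nu : eb_group F).

Section Regular.
Variables (c d : n.-tuple M).
Hypotheses (oc : Ob G c) (od : Ob G d) (cd : indep2 c d).

Lemma rho_Y mu y : Y G c d y -> Y G c d (eb_rho c d mu y).
Proof. by have [[+ _ _] _] := @eb_rho_aut _ _ _ _ _ F _ _ oc od cd mu; exact. Qed.

Lemma rho_free mu nu y : Y G c d y -> eb_rho c d mu y = eb_rho c d nu y -> mu = nu.
Proof.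
move=> Yy E; apply: (eb_rho_inj oc od cd) => z; rewrite inE => Yz.
exact: (aut_over_agree oc od (@eb_rho_aut _ _ _ _ _ F _ _ oc od cd mu)
  (@eb_rho_aut _ _ _ _ _ F _ _ oc od cd nu) Yy E).
Qed.

Lemma rho_binding S s f : binding G S -> S s -> Hom G d d s -> Hom G c d f ->
  eb_rho c d (eb_emb F S) f = gcomp G s f.
Proof. exact: (@eb_rho_ext _ _ _ _ _ F _ _ oc od cd). Qed.

Lemma rho_mul mu nu y : Y G c d y ->
  eb_rho c d (mu * nu)%g y = eb_rho c d mu (eb_rho c d nu y).
Proof. exact: (@eb_rho_mul _ _ _ _ _ F _ _ oc od cd). Qed.

Lemma rho_one y : Y G c d y -> eb_rho c d (1%g : eb_group F) y = y.
Proof.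
move=> Yy; have [[_ rho_inj _] _] := @eb_rho_aut _ _ _ _ _ F _ _ oc od cd 1%g.
apply: rho_inj; rewrite ?inE //; first exact: rho_Y.
by rewrite -rho_mul // mulg1.
Qed.

Lemma hom_binding f f' : Hom G c d f -> Hom G c d f' -> exists S s,
  [/\ binding G S, S s, Hom G d d s & f' = gcomp G s f].
Proof.
move=> hf hf'; pose s := gcomp G f' (ginv G f).
have hs : Hom G d d s := gcomp_hom gr (ginv_hom gr hf) hf'.
exists (conj_class G s), s; split=> //; first exact: binding_class hs.
  exact: mem_conj_class hs.
by rewrite (gcompKK hf hf').
Qed.

(** f is carried to y by an automorphism over acl(c), which preserves dcl(f, acl(c)) because y
    generates the same closure. It therefore permutes Y_cd and induces an element of F. *)
Lemma rho_transitive f y : Hom G c d f -> Y G c d y ->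
  exists mu, y = eb_rho c d mu f.
Proof.
move=> hf Yy; have [f1 [hf1 _ yf1 _]] := Yy.
(* The definition of Y_cd provides some morphism f1 rather than f. The two have the same type over
   acl(c) because the action of the binding group is elementary over it. *)
have [S [s [bS Ss hs f1E]]] := hom_binding hf hf1.
have [_ el] := @eb_rho_aut _ _ _ _ _ F _ _ oc od cd (eb_emb F S).
have [|alpha [aa fa aE]] := @homogeneous _ _ _ hM 'I_m (aclt c) (tnth f) (tnth f1)
    (small_aclt_tuple hM c (tnth f)).
  apply: (elementary_definable el) => [i|x cx]; last by right; exists x.
  left; exists f; first exact: hom_Y.
  by exists i => //; rewrite (rho_binding bS Ss hs hf) -f1E.
have [gamma [ag fg gE]] := eqtp_conj hM (small_aclt_tuple hM c (tnth y)) yf1.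
have [delta [ad gK dK]] := aut_inv ag.
pose sigma := delta \o alpha.
have as_ : automorphism sigma by exact: aut_comp.
have fs : fixes sigma (aclt c).
  by move=> x cx; rewrite /sigma /= fa // -{1}(fg x cx) gK.
have sf : map_tuple sigma f = y.
  apply: eq_from_tnth => i; rewrite tnth_map /sigma /= aE -gE tnth_map gK //.
have [_ Dy] := Y_Delta hf Yy.
have sD : sigma @` Delta c f = Delta c f.
  by rewrite aut_dcl_image // image_setU -coords_map sf (fixes_image fs).
have [tau [at_ sK tK]] := aut_inv as_.
have ft : fixes tau (aclt c) by move=> x cx; rewrite -{1}(fs x cx) sK.
have tD : tau @` Delta c f = Delta c f.
  rewrite -{1}sD; apply/seteqP; split=> [_ [_ [x Dx <-] <-]|x Dx];
    first by rewrite sK.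
  by exists (sigma x); [exists x|rewrite sK].
have [|mu muE] := @eb_rho_surj _ _ _ _ _ F _ _ oc od cd (map_tuple sigma).
  split; first split.
  - by move=> z; exact: (Y_aut as_ fs hf sD).
  - move=> z w _ _ E; apply: eq_from_tnth => i; apply: (can_inj sK).
    by have := congr1 (fun t => tnth t i) E; rewrite !tnth_map.
  - move=> z Yz; exists (map_tuple tau z); first exact: (Y_aut at_ ft hf tD).
    by apply: eq_from_tnth => i; rewrite !tnth_map tK.
  apply: (elementary_aut as_) => -[u v] [[z _ [i _ [<- <-]]]|[x cx [<- <-]]] /=.
    by rewrite tnth_map.
  by rewrite fs.
by exists mu; rewrite muE ?sf // inE; exact: hom_Y.
Qed.

End Regular.

(* The compatibility of rho over the pair (a_0, b_0') with its own image under
   rho(S) says that rho(mu) and rho(S) commute. *)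
Lemma binding_central S mu : binding G S -> (mu * eb_emb F S = eb_emb F S * mu)%g.
Proof.
move=> bS; set a := eb_a0 F; set b := eb_b0' F.
have oa : Ob G a := eb_a0_ob F; have ob : Ob G b := eb_b0'_ob F.
have iab : indep2 a b := @eb_a0b0'_indep _ _ _ _ _ F.
pose rS := eb_rho a b (eb_emb F S); pose g0 := eb_g (eb_i0 F).
have hg (i : eb_I F) : Hom G a b (eb_g i) by rewrite -(eb_g_range F); exists i.
have [s Ss hs] := binding_at bS ob.
have rSE f : Hom G a b f -> rS f = gcomp G s f.
  by move=> hf; exact: (rho_binding oa ob iab bS Ss hs hf).
have [[rSY rSinj rSsurj] el] := @eb_rho_aut _ _ _ _ _ F _ _ oa ob iab (eb_emb F S).
have gY (i : eb_I F) : Y G a b (eb_g i) by exact: hom_Y.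
have g'Y (j : eb_J F) : Y G a b (eb_g' j) by rewrite -(eb_gg'_range F); right;
  exists j.
have range_h : range (rS \o @eb_g _ _ _ _ _ F) = Hom G a b.
  apply/seteqP; split=> [_ [i _ <-]|f hf].
    by rewrite /= rSE //; exact: (gcomp_hom gr (hg i) hs).
  have : Hom G a b (gcomp G (ginv G s) f) by exact: (gcomp_hom gr hf (ginv_hom gr
    hs)).
  move=> hf'; have := hf'; rewrite -(eb_g_range F) => -[i _ iE].
  by exists i => //=; rewrite iE rSE // (gcompVK hf hs).
have range_hh' : range (rS \o @eb_g _ _ _ _ _ F) `|` range (rS \o @eb_g' _ _ _ _
  _ F) = Y G a b.
  apply/seteqP; split=> [_ [[i _ <-]|[j _ <-]]|y Yy]; [exact: rSY|exact: rSY|].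
  have [z Yz <-] := rSsurj y Yy; move: Yz; rewrite -(eb_gg'_range F).
  by case=> [[i _ <-]|[j _ <-]]; [left; exists i|right; exists j].
have elem : elementary (\bigcup_i tgraph (eb_g (e := F) i) (rS (eb_g i)) `|`
    \bigcup_j tgraph (eb_g' (e :=
      F) j) (rS (eb_g' j)) `|` tgraph a a `|` tgraph b b).
  move=> q phi v w vw.
  pose R0 := \bigcup_(x in Y G a b) tgraph x (rS x) `|` id_on (aclt a).
  have cases i : R0 (tnth v i, tnth w i) \/ (coords b (tnth v i) /\
    tnth w i = tnth v i).
    case: (vw i) => [[[[k _ Hk]|[k _ Hk]]|[k _ [<- <-]]]|[k _ [<- <-]]].
    - by left; left; exists (eb_g k).
    - by left; left; exists (eb_g' k).
    - by left; right; exists (tnth a k) => //; apply: (coords_aclt hM); exists k.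
    - by right; split=> //; exists k.
  have [||alpha [aa _ aE]] := @homogeneous _ _ _ hM
      ({i : 'I_q | `[< R0 (tnth v i, tnth w i) >]} + 'I_m)%type set0
      (juxt (fun i => tnth v (val i)) (tnth g0)) (juxt (fun i =>
        tnth w (val i)) (tnth (rS g0))).
  - by apply: (countable_small hM); apply: countableU => //; exact: countable_range.
  - apply: (elementary_definable (R :=
    R0) el) => [[[i /= /asboolP //]|i] /=|x []//].
    by left; exists g0; [exact: gY|exists i].
  have ag0 : map_tuple alpha g0 = rS g0.
    by apply: eq_from_tnth => i; rewrite tnth_map (aE (inr i)).
  (* b need not lie in acl(a). It is fixed because g0 and its image s.g0 have the same target b,
     which is why g0 was adjoined to the tuple. *)
  have ab : map_tuple alpha b = b.
    have [_ _ <-] := hom_aut aa (hg (eb_i0 F)).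
    rewrite -/g0 ag0 (rSE _ (hg (eb_i0 F))).
    by have [] := gcomp_hom gr (hg (eb_i0 F)) hs.
  rewrite -(aut_sat phi v aa); apply: sat_eq => i; rewrite tnth_map.
  case: (cases i) => [Ri|[[k _ <-] ->]]; last first.
    by have := congr1 (fun t => tnth t k) ab; rewrite tnth_map.
  exact: (aE (inl (exist _ i (asboolT Ri)))).
have [H H'] := @eb_compat _ _ _ _ _ F a b oa ob iab (rS \o @eb_g _ _ _ _ _ F) (rS
  \o @eb_g' _ _ _ _ _ F)
  range_h range_hh' elem mu.
have Yg0 : Y G a b g0 := gY (eb_i0 F).
apply: (rho_free oa ob iab Yg0); rewrite !(rho_mul oa ob iab) //.
have : Y G a b (eb_rho a b mu g0) by exact: rho_Y.
rewrite -(eb_gg'_range F) => -[[i _ Ei]|[j _ Ej]].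
  by rewrite -[in RHS]Ei; exact: (H i).
by rewrite -[in RHS]Ej; exact: (H' j).
Qed.

End Groupoid.

(** * Paths *)

Section Paths.
Variables (L : language) (M : structure L) (K : Type).
Hypotheses (hM : monster M K) (heq : eq_closed M) (stM : stable M).
Hypothesis hbase : acl (set0 : set M) `<=` dcl set0.
Variables (n m : nat) (b0 b1 : n.-tuple M) (G : groupoid_data M n m).
Hypothesis hG : generic_abelian b0 b1 G.
Variable F : extended_binding G.
Implicit Types (a b c d e : n.-tuple M) (f g h s y z : m.-tuple M).
Implicit Types (sigma tau mu nu : eb_group F) (q r : steps M n m).

Let gr := ga_groupoid hG.

Lemma indep2_ob_exists a B : Ob G a -> countable B -> exists2 e, Ob G e & indep e B.
Proof.
move=> oa cB; have [e [ea ie]] := indep_exists hM heq stM hbase a cB.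
by exists e => //; exact: (eqtp_ob hM hG oa ea).
Qed.

(* An element of F x X_cd stands for the morphism mu.h of the extension of the
   groupoid by F, in which (mu S).h is identified with mu.(S.h). *)
Definition same_value d mu h nu h' : Prop := exists S s,
  [/\ binding G S, S s, Hom G d d s, mu = (nu * eb_emb F S)%g & h' = gcomp G s h].

Lemma rho_eq c d mu h nu h' : indep2 c d -> Hom G c d h -> Hom G c d h' ->
  eb_rho c d mu h = eb_rho c d nu h' <-> same_value d mu h nu h'.
Proof.
move=> icd hh hh'; have oc := hom_init hG hh; have od := hom_ter hG hh.
split=> [E|[S [s [bS Ss hs -> ->]]]]; last first.
  rewrite (rho_mul oc od icd) ?(rho_binding F oc od icd bS Ss hs hh) //.
  exact: (hom_Y hM).
have [S [s [bS Ss hs h'E]]] := hom_binding hG hh hh'.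
exists S, s; split=> //; apply: (rho_free hM hG oc od icd (y := h)).
  exact: (hom_Y hM).
rewrite (rho_mul oc od icd) ?(rho_binding F oc od icd bS Ss hs hh) -?h'E //.
exact: (hom_Y hM).
Qed.

(** Centrality lets tau pass the element of the binding group that relates the two pairs. *)
Lemma same_value_compr b c d mu h nu h' tau g : Hom G b c g ->
  Hom G c d h -> Hom G c d h' ->
  same_value d mu h nu h' <-> same_value d (mu * tau) (gcomp G h g) (nu * tau)
    (gcomp G h' g).
Proof.
move=> hg hh hh'; split=> -[S [s [bS Ss hs]]].
  move=> -> ->; exists S, s; split=> //; last by rewrite (gcompA gr hg hh hs).
  by rewrite -!mulgA (binding_central hM hG tau bS).
move=> E E'; exists S, s; split=> //.
  by apply: (mulIg tau); rewrite E -!mulgA (binding_central hM hG tau bS).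
apply: (gcomp_injr hG hg hh' (gcomp_hom gr hh hs)).
by rewrite E' (gcompA gr hg hh hs).
Qed.

Lemma same_value_rho b c d mu h nu h' g : indep2 b d -> Hom G b c g ->
  Hom G c d h -> Hom G c d h' ->
  same_value d mu h nu h' <-> eb_rho b d mu (gcomp G h g) = eb_rho b d nu (gcomp
    G h' g).
Proof.
move=> ibd hg hh hh'; rewrite (same_value_compr _ _ 1%g hg hh hh') !mulg1.
rewrite (rho_eq _ _ ibd) //; exact: (gcomp_hom gr hg).
Qed.

(** Precomposing with a morphism from cs independent from d turns [same_value] into equality in
    Y_{cs,d}; this is how it is seen to be an equivalence relation. *)
Lemma same_value_class c d mu h nu h' : Hom G c d h -> Hom G c d h' ->
  same_value d mu h nu h' -> forall tau h'', Hom G c d h'' ->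
  (same_value d mu h tau h'' <-> same_value d nu h' tau h'').
Proof.
move=> hh hh' E tau h'' hh''; have oc := hom_init hG hh; have od := hom_ter hG hh.
have [cs ocs ind] := indep2_ob_exists od (countable_range (tnth d)).
have [g hg] := ga_connected hG ocs oc.
by move: E; rewrite !(same_value_rho _ _ ind hg) // => ->.
Qed.

Lemma same_value_refl c d mu h : Hom G c d h -> same_value d mu h mu h.
Proof.
move=> hh; have oc := hom_init hG hh; have od := hom_ter hG hh.
have [cs ocs ind] := indep2_ob_exists od (countable_range (tnth d)).
have [g hg] := ga_connected hG ocs oc.
exact/(same_value_rho _ _ ind hg).
Qed.

Lemma same_value_sym c d mu h nu h' : Hom G c d h -> Hom G c d h' ->
  same_value d mu h nu h' -> same_value d nu h' mu h.
Proof.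
by move=> hh hh' E; apply/(same_value_class hh hh' E _ hh);
  exact: same_value_refl hh.
Qed.

Lemma same_value_comp b c d sigma g sigma' g' mu h mu' h' :
  Hom G b c g -> Hom G b c g' -> Hom G c d h -> Hom G c d h' ->
  same_value c sigma g sigma' g' -> same_value d mu h mu' h' ->
  same_value d (mu * sigma) (gcomp G h g) (mu' * sigma') (gcomp G h' g').
Proof.
move=> hg hg' hh hh' Eg Eh.
have := Eh; rewrite (same_value_compr _ _ sigma hg hh hh') => Eh'.
apply/(same_value_class (gcomp_hom gr hg hh) (gcomp_hom gr hg hh') Eh').
  exact: (gcomp_hom gr hg' hh').
have [S [s [bS Ss hs -> ->]]] := Eg.
have [s' Ss' hs'] := binding_at hG bS (hom_ter hG hh').
exists S, s'; split=> //; first by rewrite mulgA.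
(* The element s relating g to g' sits between g and h'; naturality moves it past h' to the target
   d. *)
by rewrite (gcompA gr hg hs hh') (binding_natural hG bS Ss hs Ss' hs' hh')
  -(gcompA gr hg hh' hs').
Qed.

Lemma indep3_indep2 a b c : indep3 a b c ->
  [/\ indep2 a b, indep2 a c & indep2 b c].
Proof.
move=> [iabc ibac _]; split.
- by apply: sub_indep iabc => x; left.
- by apply: sub_indep iabc => x; right.
- by apply: sub_indep ibac => x; right.
Qed.

(** The partial composition does not depend on how its two arguments are presented. *)
Lemma partial_compP a b c tau f sigma g z : Hom G a b f -> Hom G b c g ->
  partial_comp F a b c (eb_rho b c sigma g) (eb_rho a b tau f) z <->
  indep3 a b c /\ z = eb_rho a c (sigma * tau)%g (gcomp G g f).
Proof.
move=> hf hg; split=> [[i3]|[i3 ->]]; last by split=> //; exists tau, sigma, f, g.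
move=> [tau' [sigma' [f' [g' [hf' hg' Ef Eg ->]]]]]; split=> //.
have [iab iac ibc] := indep3_indep2 i3.
have {}Ef : same_value b tau' f' tau f by apply/(rho_eq _ _ iab).
have {}Eg : same_value c sigma' g' sigma g by apply/(rho_eq _ _ ibc).
apply/(rho_eq _ _ iac); [exact: (gcomp_hom gr hf' hg')|exact: (gcomp_hom gr hf
  hg)|].
exact: (same_value_comp hf' hf hg' hg).
Qed.

Lemma Y_value c d y : Ob G c -> Ob G d -> indep2 c d -> Y G c d y ->
  exists mu f, Hom G c d f /\ y = eb_rho c d mu f.
Proof.
move=> oc od icd Yy; have [f hf] := ga_connected hG oc od.
by have [mu ->] := rho_transitive hM hG F oc od icd hf Yy; exists mu, f.
Qed.

(** A relation, since a step has one presentation tau.g0 for each g0 in X; different choices give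
    pairs with the [same_value]. *)
Fixpoint path_value c q d mu h : Prop :=
  match q with
  | [::] => [/\ c = d, mu = 1%g & h = gid G c]
  | (g, c1) :: q' => exists tau g0 nu k, [/\ Hom G c c1 g0, g = eb_rho c c1 tau g0,
      path_value c1 q' d nu k, mu = (nu * tau)%g & h = gcomp G k g0]
  end.

Lemma path_value_hom c q d mu h : Ob G c -> path_value c q d mu h -> Hom G c d h.
Proof.
elim: q c mu h => [|[g c1] q IH] c mu h oc /=; first by move=> [<- _ ->];
  exact: (gid_hom gr).
move=> [tau [g0 [nu [k [hg0 _ /IH hk _ ->]]]]].
exact: (gcomp_hom gr hg0 (hk (hom_ter hG hg0))).
Qed.

Lemma path_value_exists c q d : is_path G c q d ->
  exists mu h, path_value c q d mu h.
Proof.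
elim: q c => [|[g c1] q IH] c /=; first by move=> <-; exists 1%g, (gid G c).
move=> [oc oc1 icc1 Yg /IH[nu [k qk]]].
have [tau [g0 [hg0 gE]]] := Y_value oc oc1 icc1 Yg.
by exists (nu * tau)%g, (gcomp G k g0), tau, g0, nu, k.
Qed.

Lemma path_value_cat c q1 d q2 e sigma f tau g : Ob G c ->
  path_value c q1 d sigma f -> path_value d q2 e tau g ->
  path_value c (q1 ++ q2) e (tau * sigma)%g (gcomp G g f).
Proof.
elim: q1 c sigma f => [|[g1 c1] q1 IH] c sigma f oc /=.
  move=> [<- -> ->] v2; rewrite mulg1.
  by rewrite (gcomp_idr gr (path_value_hom oc v2)).
move=> [tau' [g0 [nu [k [hg0 gE v1 -> ->]]]]] v2.
have oc1 := hom_ter hG hg0; have hk := path_value_hom oc1 v1.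
exists tau', g0, (tau * nu)%g, (gcomp G g k); split=> //.
- exact: IH.
- by rewrite mulgA.
- exact: (gcompA gr hg0 hk (path_value_hom (hom_ter hG hk) v2)).
Qed.

Lemma is_path_cat c q1 d q2 e : is_path G c q1 d -> is_path G d q2 e ->
  is_path G c (q1 ++ q2) e.
Proof.
elim: q1 c => [|[g1 c1] q1 IH] c /=; first by move=> ->.
by move=> [oc oc1 icc1 Yg p1] p2; split=> //; exact: IH.
Qed.

Lemma countable_path_coords c q : countable (path_coords c q).
Proof.
elim: q c => [|[g c1] q IH] c /=; apply: countableU => //;
  try exact: countable_range.
by apply: countableU => //; exact: countable_range.
Qed.

Lemma coords_path c q : coords c `<=` path_coords c q.
Proof. by case: q => [|[g c1] q] x; left. Qed.

Lemma ter_path c q d : is_path G c q d -> coords d `<=` path_coords c q.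
Proof.
elim: q c => [|[g c1] q IH] c /=; first by move=> -> x; left.
by move=> [_ _ _ _ /IH dp] x /dp; right; right.
Qed.

Lemma transportP cs c q d tau g0 mu h z : Ob G cs -> Ob G c ->
  indep cs (path_coords c q) -> is_path G c q d -> Hom G cs c g0 ->
  path_value c q d mu h ->
  transport F cs c (eb_rho cs c tau g0) q z <->
  z = eb_rho cs d (mu * tau)%g (gcomp G h g0).
Proof.
move=> ocs; elim: q c tau g0 mu h => [|[g c1] q IH] c tau g0 mu h oc ics /=.
  by move=> _ hg0 [<- -> ->]; rewrite mul1g (gcomp_idl gr hg0).
move=> [_ oc1 icc1 Yg pq] hg0 [tau1 [g1 [nu [k [hg1 -> v -> ->]]]]].
have ics1 : indep cs (path_coords c1 q).
  by apply: sub_indep ics => x xq; right; right.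
(* Consecutive vertices are independent and cs is independent from the whole path, as the partial
   composition along each step requires. *)
have i3 : indep3 cs c c1.
  have [i1 i2 i3] : indep3 c c1 cs.
    apply: (indep3_of hM heq stM hbase) => //; apply: sub_indep ics => x [xc|xc];
      first by left.
    by right; right; exact: coords_path.
  by split=> //; [rewrite setUC|rewrite setUC]; rewrite // setUC.
have hk := path_value_hom oc1 v.
have hg10 := gcomp_hom gr hg0 hg1.
have IH' := IH c1 (tau1 * tau)%g (gcomp G g1 g0) nu k oc1 ics1 pq hg10 v.
rewrite -mulgA -(gcompA gr hg0 hg1 hk) -IH'.
split=> [[y /(partial_compP _ _ _ hg0 hg1)[_ ->] //]|tr].
by exists (eb_rho cs c1 (tau1 * tau)%g (gcomp G g1 g0)) => //;
  apply/(partial_compP _ _ _ hg0 hg1).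
Qed.

(** Whatever generic start is chosen, transport multiplies both values on the right by the same
    pair, and this loses no information by [same_value_compr]. Hence one start is as good as any
    other. *)
Lemma path_equivP c d q r mu h nu k : Ob G c -> is_path G c q d ->
  is_path G c r d ->
  path_value c q d mu h -> path_value c r d nu k ->
  path_equiv F c d q r <-> same_value d mu h nu k.
Proof.
move=> oc pq pr vq vr.
have hh := path_value_hom oc vq; have hk := path_value_hom oc vr.
have od := hom_ter hG hh.
have core cs g0 tau z : Ob G cs -> indep cs (path_coords c q `|` path_coords c r) ->
    Hom G cs c g0 -> z = eb_rho cs c tau g0 -> (exists y,
      transport F cs c z q y /\ transport F cs c z r y) <-> same_value d mu h nu k.
  move=> ocs ics hg0 ->.
  have iq : indep cs (path_coords c q) by apply: sub_indep ics => x; left.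
  have ir : indep cs (path_coords c r) by apply: sub_indep ics => x; right.
  have icd : indep2 cs d by apply: sub_indep iq; exact: ter_path.
  rewrite (same_value_compr _ _ tau hg0 hh hk).
  rewrite -(rho_eq _ _ icd (gcomp_hom gr hg0 hh) (gcomp_hom gr hg0 hk)).
  split=> [[y []]|E].
    by rewrite (transportP _ _ ocs oc iq pq hg0 vq) (transportP _ _ ocs oc ir pr
      hg0 vr) => ->.
  exists (eb_rho cs d (mu * tau)%g (gcomp G h g0)).
  by rewrite (transportP _ _ ocs oc iq pq hg0 vq) (transportP _ _ ocs oc ir pr
    hg0 vr).
split=> [[cs [gs [z [ocs ics Ygs _ tr]]]]|E].
  have ics' : indep2 cs c.
    by apply: sub_indep ics => x xc; left; exact: coords_path.
  have [tau [g0 [hg0 gsE]]] := Y_value ocs oc ics' Ygs.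
  by apply/(core cs g0 tau gs ocs ics hg0 gsE); exists z.
have [|cs ocs ics] := indep2_ob_exists oc (B :=
  path_coords c q `|` path_coords c r).
  by apply: countableU; exact: countable_path_coords.
have [g0 hg0] := ga_connected hG ocs oc.
have iq : indep cs (path_coords c q) by apply: sub_indep ics => x; left.
have ics' : indep2 cs c by apply: sub_indep iq; exact: coords_path.
have icd : indep2 cs d by apply: sub_indep iq; exact: ter_path.
have [z [tq tr]] := (core cs g0 (1%g : eb_group F) _ ocs ics hg0 erefl).2 E.
exists cs, (eb_rho cs c (1%g : eb_group F) g0), z; split=> //.
  by apply: rho_Y => //; exact: (hom_Y hM).
move: tq; rewrite (transportP _ _ ocs oc iq pq hg0 vq) => ->.
by apply: rho_Y => //; apply: (hom_Y hM); exact: (gcomp_hom gr hg0 hh).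
Qed.

Definition value_class c d mu h : set (steps M n m) := [set r | dpaths G 2 c d r /\
  exists nu k, path_value c r d nu k /\ same_value d mu h nu k].

Lemma path_class_value c d q mu h : Ob G c -> is_path G c q d ->
  path_value c q d mu h ->
  path_class F c d q = value_class c d mu h.
Proof.
move=> oc pq vq; apply/seteqP; split=> r [[szr pr]].
  move=> qr; split=> //; have [nu [k vr]] := path_value_exists pr.
  by exists nu, k; split=> //; apply/(path_equivP oc pq pr vq vr).
by move=> [nu [k [vr E]]]; split=> //; apply/(path_equivP oc pq pr vq vr).
Qed.

Lemma eq_value_class c d mu h nu k : Hom G c d h -> Hom G c d k ->
  same_value d mu h nu k -> value_class c d mu h = value_class c d nu k.
Proof.
move=> hh hk E; apply/seteqP; split=> r [pr [tau [l [vr E']]]]; split=> //;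
  exists tau, l; split=> //; have hl := path_value_hom (hom_init hG hh) vr.
  exact/(same_value_class hh hk E _ hl).
exact/(same_value_class hh hk E _ hl).
Qed.

Lemma two_step_path c d mu h : Hom G c d h -> exists r, value_class c d mu h r.
Proof.
move=> hh; have oc := hom_init hG hh; have od := hom_ter hG hh.
have [|e oe ie] := indep2_ob_exists oc (B := coords c `|` coords d).
  by apply: countableU; exact: countable_range.
have ice : indep2 c e.
  by apply: (indep2_sym hM heq stM hbase); apply: sub_indep ie => x; left.
have ied : indep2 e d by apply: sub_indep ie => x; right.
have [u hu] := ga_connected hG oc oe.
pose v := gcomp G h (ginv G u); have hv : Hom G e d v :=
  gcomp_hom gr (ginv_hom gr hu) hh.
(* The path runs through a generic e; the second step carries all of mu and v = h u^-1. *)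
exists [:: (eb_rho c e (1%g : eb_group F) u, e); (eb_rho e d mu v, d)]; split.
  by split=> //; split=> //; [|split=> //]; apply: rho_Y => //; exact: (hom_Y hM).
exists mu, h; split; last exact: same_value_refl hh.
exists 1%g, u, mu, v; split=> //; last by rewrite (gcompKK hG hu hh).
  exists mu, v, 1%g, (gid G d); split=> //; first by rewrite mul1g.
  by rewrite (gcomp_idl gr hv).
by rewrite mulg1.
Qed.

Lemma value_class_inj c d mu h nu k : Hom G c d h -> Hom G c d k ->
  value_class c d mu h = value_class c d nu k -> same_value d mu h nu k.
Proof.
move=> hh hk E; have [r rh] := two_step_path mu hh; have := rh; rewrite E.
case: rh => -[_ pr] [tau [l [vr E1]]] [_ [tau' [l' [vr' E2]]]].
have oc := hom_init hG hh.
have hl := path_value_hom oc vr; have hl' := path_value_hom oc vr'.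
(* The common path r is presented twice; comparing r with itself identifies the two values. *)
have El : same_value d tau l tau' l'.
  apply/(path_equivP oc pr pr vr vr')/(path_equivP oc pr pr vr vr).
  exact: same_value_refl hl.
apply/(same_value_class hh hl E1 _ hk)/(same_value_class hl hl' El _ hk).
exact: same_value_sym hk hl' E2.
Qed.

Lemma underYE c d y mu f : Ob G c -> Ob G d -> indep2 c d -> Hom G c d f ->
  y = eb_rho c d mu f -> underY F c d y = value_class c d mu f.
Proof.
move=> oc od icd hf ->; apply: path_class_value => //.
  by split=> //; apply: rho_Y => //; exact: (hom_Y hM).
exists mu, f, 1%g, (gid G d); split=> //; first by rewrite mul1g.
by rewrite (gcomp_idl gr hf).
Qed.

Lemma underXE c d f : Hom G c d f -> underX F c d f = value_class c d 1%g f.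
Proof.
move=> hf; have oc := hom_init hG hf; have od := hom_ter hG hf.
have via e u v : Ob G e -> indep e (coords c `|` coords d) -> Hom G c e u ->
  Hom G e d v ->
    gcomp G v u = f -> path_class F c d [:: (u, e); (v, d)] = value_class c d 1%g f.
  move=> oe ie hu hv <-.
  have ice : indep2 c e.
    by apply: (indep2_sym hM heq stM hbase); apply: sub_indep ie => x; left.
  have ied : indep2 e d by apply: sub_indep ie => x; right.
  apply: path_class_value => //.
    by split=> //; [exact: (hom_Y hM)|split=> //; exact: (hom_Y hM)].
  exists 1%g, u, 1%g, v; split=> //; [|idtac|by rewrite mulg1].
    by rewrite (rho_one F oc oe ice) //; exact: (hom_Y hM).
  exists 1%g, v, 1%g, (gid G d); split=> //.
  - by rewrite (rho_one F oe od ied) //; exact: (hom_Y hM).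
  - by rewrite mul1g.
  - by rewrite (gcomp_idl gr hv).
apply/seteqP; split=> [r [e [u [v [oe ie hu hv [E pr]]]]]|r cr].
  by rewrite -(via e u v).
have [|e oe ie] := indep2_ob_exists oc (B := coords c `|` coords d).
  by apply: countableU; exact: countable_range.
have [u hu] := ga_connected hG oc oe.
pose v := gcomp G f (ginv G u); have hv : Hom G e d v :=
  gcomp_hom gr (ginv_hom gr hu) hf.
have vu : gcomp G v u = f by exact: (gcompKK hG hu hf).
by exists e, u, v; split=> //; split=> //; rewrite (via e u v).
Qed.

Lemma compF_value_class c d e mu f nu g : Hom G c d f -> Hom G d e g ->
  compF F c d e (value_class d e nu g) (value_class c d mu f) = value_class c e
    (nu * mu)%g (gcomp G g f).
Proof.
move=> hf hg; have oc := hom_init hG hf; have od := hom_ter hG hf.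
have hgf := gcomp_hom gr hf hg.
have main q1 q2 : value_class c d mu f q1 -> value_class d e nu g q2 ->
    path_class F c e (q1 ++ q2) = value_class c e (nu * mu)%g (gcomp G g f).
  move=> [[_ p1] [t1 [l1 [v1 E1]]]] [[_ p2] [t2 [l2 [v2 E2]]]].
  have h1 := path_value_hom oc v1; have h2 := path_value_hom od v2.
  rewrite (path_class_value oc (is_path_cat p1 p2) (path_value_cat oc v1 v2)).
  apply: (eq_value_class (gcomp_hom gr h1 h2) hgf).
  apply: (same_value_sym hgf (gcomp_hom gr h1 h2)).
  exact: (same_value_comp hf h1 hg h2).
apply/seteqP; split=> [r [q1 [q2 [c1 c2]]]|r cr]; first by rewrite (main _ _ c1 c2).
(* A member of the product class also needs factors q1 and q2, so neither factor class may be
   empty. *)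
have [q1 c1] := two_step_path mu hf; have [q2 c2] := two_step_path nu hg.
by exists q1, q2; split=> //; rewrite (main _ _ c1 c2).
Qed.

End Paths.

Theorem proposition3p17
  (L : language) (M : structure L) (K : Type)
  (hmonster : monster M K) (heq : eq_closed M) (hstable : stable M)
  (hbase : acl (set0 : set M) `<=` dcl (set0 : set M))
  (n m k : nat) (W : symmetric_witness M n k)
  (G : groupoid_data M n m) (hG : obtained_from W G)
  (F : extended_binding G) :
  (forall a b : n.-tuple M, Ob G a -> Ob G b -> indep2 a b ->
   forall c : n.-tuple M, Ob G c -> indep c (coords a `|` coords b) ->
   forall f g h : m.-tuple M, Y G a b f -> Y G b c g -> Y G a c h ->
     (partial_comp F a b c g f h <->
      underY F a c h = compF F a b c (underY F b c g) (underY F a b f)))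
  /\
  (forall c d e : n.-tuple M, Ob G c -> Ob G d -> Ob G e ->
   forall s t : m.-tuple M, Hom G c d s -> Hom G d e t ->
     compF F c d e (underX F d e t) (underX F c d s) =
     underX F c e (gcomp G t s)).
Proof.
have [gG _] := hG; have gr := ga_groupoid gG; split; last first.
  move=> c d e _ _ _ s t hs ht; have hts := gcomp_hom gr hs ht.
  rewrite !(underXE hmonster heq hstable hbase gG) //.
  by rewrite (compF_value_class hmonster heq hstable hbase gG _ _ hs ht) mulg1.
move=> a b oa ob iab c oc icab f g h Yf Yg Yh.
have i3 := indep3_of hmonster heq hstable hbase iab icab.
have [_ iac ibc] := indep3_indep2 i3.
have [tau [f0 [hf0 fE]]] := Y_value hmonster gG F oa ob iab Yf.
have [sigma [g0 [hg0 gE]]] := Y_value hmonster gG F ob oc ibc Yg.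
have [rho [h0 [hh0 hE]]] := Y_value hmonster gG F oa oc iac Yh.
have hgf := gcomp_hom gr hf0 hg0.
rewrite (underYE hmonster heq hstable hbase gG oa oc iac hh0 hE).
rewrite (underYE hmonster heq hstable hbase gG ob oc ibc hg0 gE).
rewrite (underYE hmonster heq hstable hbase gG oa ob iab hf0 fE).
rewrite (compF_value_class hmonster heq hstable hbase gG _ _ hf0 hg0) fE gE hE.
rewrite (partial_compP hmonster heq hstable hbase gG _ _ _ hf0 hg0).
split=> [[_ /(rho_eq hmonster gG _ _ iac hh0 hgf)]|E].
  exact: (eq_value_class hmonster heq hstable hbase gG).
split=> //; apply/(rho_eq hmonster gG _ _ iac hh0 hgf).
exact: (value_class_inj hmonster heq hstable hbase gG hh0 hgf E).
Qed.
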